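(* Let $(\mathcal{X},\mathcal{Y})$ be a complete hereditary cotorsion pair in ${}_{A}\mathsf{Mod}$. Then $(\widetilde{\mathcal{X}},\mathsf{dg}\mathcal{Y})$ and $(\mathsf{dg}\mathcal{X},\widetilde{\mathcal{Y}})$ are complete, hereditary, and compatible cotorsion pairs in $\mathsf{Dif}(A)$. Consequently, there is an abelian model structure on $\mathsf{Dif}(A)$ such that $\mathsf{dg}\mathcal{X}$, $\mathsf{dg}\mathcal{Y}$ and $\mathscr{E}$ are respectively the classes of cofibrant objects, fibrant objects, and trivial objects, where $\mathscr{E}$ denotes the full subcategory of exact differential left $A$-modules in $\mathsf{Dif}(A)$. The corresponding homotopy category is (equivalent to) the $\mathcal{Q}$-shaped derived category, where $\mathcal{Q}$ is the path category of the Jordan quiver (one vertex, one loop $\varepsilon$) subject to the relation $\varepsilon^2=0$.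
   Context: $A$ is an associative algebra over a commutative noetherian hereditary ring $\Bbbk$ (any ring qualifies with $\Bbbk=\mathbb{Z}$), and ${}_{A}\mathsf{Mod}$ is the category of left $A$-modules. A differential left $A$-module is a pair $(X,d_X)$ with $X\in{}_{A}\mathsf{Mod}$ and $d_X:X\to X$ an $A$-endomorphism with $d_Xd_X=0$; a morphism $(X,d_X)\to(Y,d_Y)$ is an $A$-linear map $f:X\to Y$ with $fd_X=d_Yf$. The resulting abelian category is $\mathsf{Dif}(A)$. $(X,d_X)$ is exact if $\operatorname{Ker}d_X=\operatorname{Im}d_X$. For a class $\mathcal{C}$ of objects of an abelian category $\mathcal{A}$, $\mathcal{C}^{\bot}=\{N\mid\operatorname{Ext}^1_{\mathcal{A}}(C,N)=0\ \forall C\in\mathcal{C}\}$ and ${}^{\bot}\mathcal{C}=\{M\mid\operatorname{Ext}^1_{\mathcal{A}}(M,C)=0\ \forall C\in\mathcal{C}\}$. A cotorsion pair is a pair $(\mathcal{X},\mathcal{Y})$ with $\mathcal{X}^{\bot}=\mathcal{Y}$ and ${}^{\bot}\mathcal{Y}=\mathcal{X}$. It is complete if for each object $M$ there are exact sequences $0\to M\to Y\to X\to 0$ and $0\to Y'\to X'\to M\to 0$ with $X,X'\in\mathcal{X}$, $Y,Y'\in\mathcal{Y}$. It is hereditary if $\mathcal{X}$ is closed under kernels of epimorphisms and $\mathcal{Y}$ is closed under cokernels of monomorphisms. For a cotorsion pair $(\mathcal{X},\mathcal{Y})$ in ${}_{A}\mathsf{Mod}$, define in $\mathsf{Dif}(A)$: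 $\widetilde{\mathcal{X}}=\{(X,d_X)\mid(X,d_X)\text{ exact and }\operatorname{Coker}d_X\in\mathcal{X}\}$, $\widetilde{\mathcal{Y}}=\{(Y,d_Y)\mid(Y,d_Y)\text{ exact and }\operatorname{Ker}d_Y\in\mathcal{Y}\}$, $\mathsf{dg}\mathcal{X}={}^{\bot}\widetilde{\mathcal{Y}}$ and $\mathsf{dg}\mathcal{Y}=\widetilde{\mathcal{X}}^{\bot}$. Cotorsion pairs $(\mathcal{U},\mathcal{V})$ and $(\mathcal{X}',\mathcal{Y}')$ in an abelian category are compatible if $\operatorname{Ext}^1(X,V)=0$ for all $X\in\mathcal{X}'$, $V\in\mathcal{V}$, and $\mathcal{X}'\cap\mathcal{Y}'=\mathcal{U}\cap\mathcal{V}$; here $(\mathcal{U},\mathcal{V})=(\mathsf{dg}\mathcal{X},\widetilde{\mathcal{Y}})$ and $(\mathcal{X}',\mathcal{Y}')=(\widetilde{\mathcal{X}},\mathsf{dg}\mathcal{Y})$. An abelian model structure (Hovey) on a bicomplete abelian category is a model structure in which a morphism is a (trivial) cofibration iff it is a monomorphism with (trivially) cofibrant cokernel, and a (trivial) fibration iff it is an epimorphism with (trivially) fibrant kernel; an object is trivial if it is weakly equivalent to $0$. For $\mathcal{Q}$ the $\Bbbk$-linear path category of the Jordan quiver (one vertex, one loop $\varepsilon$) modulo the relation $\varepsilon^2=0$, that is, the $\Bbbk$-linear category with one object and endomorphism ring $\Bbbk[\varepsilon]/(\varepsilon^2)$, the category of $\Bbbk$-linear functors $\mathcal{Q}\to{}_{A}\mathsf{Mod}$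 is identified with $\mathsf{Dif}(A)$, and the $\mathcal{Q}$-shaped derived category (Holm–Jørgensen) is the homotopy category of the abelian model structure on $\mathsf{Dif}(A)$ in which ${}^{\bot}\mathscr{E}$ is the class of cofibrant objects, $\mathscr{E}$ is the class of trivial objects and every object is fibrant. *)

(* Defs.v *)
From mathcomp Require Import all_boot all_algebra qpoly.
From mathcomp Require Import boolp.
From Stdlib Require Import Relation_Operators.

Set Implicit Arguments.
Unset Strict Implicit.
Unset Printing Implicit Defensive.

Import GRing.Theory.
Local Open Scope ring_scope.

Record category := Category {
  ob :> Type;
  hom : ob -> ob -> Type;
  idm : forall X, hom X X;
  comp : forall X Y Z, hom Y Z -> hom X Y -> hom X Z;
  comp1m : forall X Y (f : hom X Y), comp (idm Y) f = f;
  compm1 : forall X Y (f : hom X Y), comp f (idm X) = f;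
  compA : forall X Y Z T (h : hom Z T) (g : hom Y Z) (f : hom X Y),
    comp h (comp g f) = comp (comp h g) f }.

Arguments hom {c} X Y.
Arguments idm {c} X.
Arguments comp {c X Y Z} g f.

Declare Scope cat_scope.
Delimit Scope cat_scope with cat.
Notation "g ∘ f" := (comp g f) (at level 40, left associativity) : cat_scope.
Local Open Scope cat_scope.

(* The notions below are those of abelian categories; their definitions only  *)
(* involve the zero object and composition of morphisms.                      *)
Record zcategory := ZCategory {
  zcat :> category;
  zob : zcat;
  from0 : forall X : zcat, hom zob X;
  to0 : forall X : zcat, hom X zob;
  from0_uniq : forall (X : zcat) (f : hom zob X), f = from0 X;
  to0_uniq : forall (X : zcat) (f : hom X zob), f = to0 X }.

Arguments zob {z}.
Arguments from0 {z} X.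
Arguments to0 {z} X.

Section Exactness.
Variable C : zcategory.
Implicit Types X Y K : C.

Definition zero_mor X Y : hom X Y := from0 Y ∘ to0 X.

Definition mono X Y (f : hom X Y) : Prop :=
  forall T (g h : hom T X), f ∘ g = f ∘ h -> g = h.

Definition epi X Y (f : hom X Y) : Prop :=
  forall T (g h : hom Y T), g ∘ f = h ∘ f -> g = h.

Definition is_kernel X Y (f : hom X Y) K (i : hom K X) : Prop :=
  f ∘ i = zero_mor K Y /\
  forall T (g : hom T X), f ∘ g = zero_mor T Y -> exists! u : hom T K, i ∘ u = g.

Definition is_cokernel X Y (f : hom X Y) K (p : hom Y K) : Prop :=
  p ∘ f = zero_mor X K /\
  forall T (g : hom Y T), g ∘ f = zero_mor X T -> exists! u : hom K T, u ∘ p = g.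

Definition short_exact X Y Z (i : hom X Y) (p : hom Y Z) : Prop :=
  is_kernel p i /\ is_cokernel i p.

End Exactness.

Definition obclass (C : zcategory) := C -> Prop.

Section Cotorsion.
Variable C : zcategory.
Implicit Types (M N X Y : C) (cX cY : obclass C).

(* 0 -> N -> E -> M -> 0 *)
Record extension M N := Extension {
  ext_mid : C;
  ext_in : hom N ext_mid;
  ext_out : hom ext_mid M;
  ext_exact : short_exact ext_in ext_out }.

Definition ext_equiv M N (e1 e2 : extension M N) : Prop :=
  exists u : hom (ext_mid e1) (ext_mid e2),
    u ∘ ext_in e1 = ext_in e2 /\ ext_out e2 ∘ u = ext_out e1.

(* Ext^1(M, N) is the set of extensions of M by N modulo ext_equiv; the split *)
(* extension being always there, Ext^1(M, N) = 0 says there is one class.     *)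
Definition Ext1_zero M N : Prop := forall e1 e2 : extension M N, ext_equiv e1 e2.

Definition rperp cX : obclass C := fun N => forall X, cX X -> Ext1_zero X N.
Definition lperp cY : obclass C := fun M => forall Y, cY Y -> Ext1_zero M Y.

Definition cotorsion_pair cX cY : Prop :=
  (forall N, rperp cX N <-> cY N) /\ (forall M, lperp cY M <-> cX M).

Definition complete_pair cX cY : Prop := forall M,
  (exists Y X (i : hom M Y) (p : hom Y X), [/\ short_exact i p, cY Y & cX X]) /\
  (exists Y X (i : hom Y X) (p : hom X M), [/\ short_exact i p, cY Y & cX X]).

Definition hereditary_pair cX cY : Prop :=
  (forall X X' (p : hom X X') K (i : hom K X),
     epi p -> is_kernel p i -> cX X -> cX X' -> cX K) /\
  (forall Y' Y (i : hom Y' Y) K (p : hom Y K),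
     mono i -> is_cokernel i p -> cY Y' -> cY Y -> cY K).

Definition compatible_pairs cU cV cX cY : Prop :=
  (forall X V, cX X -> cV V -> Ext1_zero X V) /\
  (forall Z, cX Z /\ cY Z <-> cU Z /\ cV Z).

End Cotorsion.

Section Models.
Variable C : category.
Implicit Types X Y Z : C.

Definition morclass := forall X Y : C, hom X Y -> Prop.

Definition retract (X Y X' Y' : C) (f : hom X Y) (g : hom X' Y') : Prop :=
  exists (i : hom X X') (r : hom X' X) (j : hom Y Y') (s : hom Y' Y),
    [/\ r ∘ i = idm X, s ∘ j = idm Y, g ∘ i = j ∘ f & f ∘ r = s ∘ g].

Definition retract_closed (W : morclass) : Prop :=
  forall (X Y X' Y' : C) (f : hom X Y) (g : hom X' Y'), retract f g -> W _ _ g -> W _ _ f.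

Definition two_of_three (W : morclass) : Prop :=
  forall X Y Z (f : hom X Y) (g : hom Y Z),
    [/\ W _ _ f -> W _ _ g -> W _ _ (g ∘ f),
        W _ _ f -> W _ _ (g ∘ f) -> W _ _ g
      & W _ _ g -> W _ _ (g ∘ f) -> W _ _ f].

Definition lifts (L R : morclass) : Prop :=
  forall (X Y X' Y' : C) (i : hom X Y) (p : hom X' Y') (f : hom X X') (g : hom Y Y'),
    L _ _ i -> R _ _ p -> p ∘ f = g ∘ i ->
    exists h : hom Y X', h ∘ i = f /\ p ∘ h = g.

Definition factors (L R : morclass) : Prop :=
  forall X Y (f : hom X Y), exists Z (i : hom X Z) (p : hom Z Y),
    [/\ L _ _ i, R _ _ p & f = p ∘ i].

Definition capm (L R : morclass) : morclass :=
  fun X Y f => L X Y f /\ R X Y f.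

Record model_structure := ModelStructure {
  weq : morclass;
  cof : morclass;
  fib : morclass;
  weq_23 : two_of_three weq;
  weq_retract : retract_closed weq;
  cof_retract : retract_closed cof;
  fib_retract : retract_closed fib;
  tcof_fib_lift : lifts (capm cof weq) fib;
  cof_tfib_lift : lifts cof (capm fib weq);
  tcof_fib_factor : factors (capm cof weq) fib;
  cof_tfib_factor : factors cof (capm fib weq) }.

End Models.

Arguments weq {C} m {X Y} f.
Arguments cof {C} m {X Y} f.
Arguments fib {C} m {X Y} f.

Section AbelianModels.
Variables (C : zcategory) (M : model_structure C).

Definition cofibrant (X : C) : Prop := cof M (from0 X).
Definition fibrant (X : C) : Prop := fib M (to0 X).

Definition weakly_equivalent : C -> C -> Prop :=
  clos_refl_sym_trans C (fun X Y => exists f : hom X Y, weq M f).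
Definition trivial_ob (X : C) : Prop := weakly_equivalent X zob.

Definition abelian_model : Prop :=
  forall (X Y : C) (f : hom X Y),
  [/\ cof M f <->
        mono f /\ exists K (p : hom Y K), is_cokernel f p /\ cofibrant K,
      cof M f /\ weq M f <->
        mono f /\ exists K (p : hom Y K),
          [/\ is_cokernel f p, cofibrant K & trivial_ob K],
      fib M f <->
        epi f /\ exists K (i : hom K X), is_kernel f i /\ fibrant K
    & fib M f /\ weq M f <->
        epi f /\ exists K (i : hom K X),
          [/\ is_kernel f i, fibrant K & trivial_ob K]].

End AbelianModels.

Section Localization.
Variables (C : category) (W : morclass C).

(* Finite strings of composable arrows of C and reversed arrows of W.         *)
Inductive zigzag : C -> C -> Type :=
| zz_nil X : zigzag X X
| zz_fwd X Y Z (f : hom X Y) (s : zigzag Y Z) : zigzag X Z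
| zz_bwd X Y Z (w : hom Y X) (Ww : W w) (s : zigzag Y Z) : zigzag X Z.

Inductive zz_eq : forall X Y, zigzag X Y -> zigzag X Y -> Prop :=
| zz_refl X Y (s : zigzag X Y) : zz_eq s s
| zz_sym X Y (s t : zigzag X Y) : zz_eq s t -> zz_eq t s
| zz_trans X Y (s t u : zigzag X Y) : zz_eq s t -> zz_eq t u -> zz_eq s u
| zz_fwd_congr X Y Z (f : hom X Y) (s t : zigzag Y Z) :
    zz_eq s t -> zz_eq (zz_fwd f s) (zz_fwd f t)
| zz_bwd_congr X Y Z (w : hom Y X) (Ww : W w) (s t : zigzag Y Z) :
    zz_eq s t -> zz_eq (zz_bwd Ww s) (zz_bwd Ww t)
| zz_id X Y (s : zigzag X Y) : zz_eq (zz_fwd (idm X) s) s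
| zz_comp X Y Z T (f : hom X Y) (g : hom Y Z) (s : zigzag Z T) :
    zz_eq (zz_fwd f (zz_fwd g s)) (zz_fwd (g ∘ f) s)
| zz_fwdK X Y Z (w : hom X Y) (Ww : W w) (s : zigzag X Z) :
    zz_eq (zz_fwd w (zz_bwd Ww s)) s
| zz_bwdK X Y Z (w : hom Y X) (Ww : W w) (s : zigzag X Z) :
    zz_eq (zz_bwd Ww (zz_fwd w s)) s.

Fixpoint zz_cat X Y Z (s : zigzag X Y) : zigzag Y Z -> zigzag X Z :=
  match s in zigzag X Y return zigzag Y Z -> zigzag X Z with
  | zz_nil _ => fun t => t
  | zz_fwd _ _ _ f s' => fun t => zz_fwd f (zz_cat s' t)
  | zz_bwd _ _ _ _ Ww s' => fun t => zz_bwd Ww (zz_cat s' t)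
  end.

Definition loc_hom (X Y : C) : Type :=
  {P : zigzag X Y -> Prop | exists s, P = zz_eq s}.

Definition zz_class X Y (s : zigzag X Y) : loc_hom X Y :=
  exist _ (zz_eq s) (ex_intro _ s erefl).

Definition zz_repr X Y (h : loc_hom X Y) : zigzag X Y :=
  projT1 (cid (svalP h)).

Lemma zz_reprK X Y (h : loc_hom X Y) : zz_class (zz_repr h) = h.
Proof.
case: h => P hP; rewrite /zz_class /zz_repr /=; case: cid => s /= Ps.
by subst P; congr exist; apply: Prop_irrelevance.
Qed.

Lemma zz_class_eq X Y (s t : zigzag X Y) : zz_eq s t <-> zz_class s = zz_class t.
Proof.
split=> [st | /(congr1 sval) /= ->]; last exact: zz_refl.
apply: eq_sig_hprop => [P p q|]; first exact: Prop_irrelevance.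
apply/funext => u; apply/propext; split; last exact: zz_trans.
by apply: zz_trans; apply: zz_sym.
Qed.

Lemma zz_classK X Y (s : zigzag X Y) : zz_eq (zz_repr (zz_class s)) s.
Proof. by apply/zz_class_eq; rewrite zz_reprK. Qed.

Lemma zz_cat_congr X Y Z (s s' : zigzag X Y) (t t' : zigzag Y Z) :
  zz_eq s s' -> zz_eq t t' -> zz_eq (zz_cat s t) (zz_cat s' t').
Proof.
move=> ss' tt'; apply: (@zz_trans _ _ _ (zz_cat s t')).
  elim: s {s' ss'} t t' tt' => //= [X' Y' Z' f s IHs|X' Y' Z' w Ww s IHs] t t' tt'.
    by apply: zz_fwd_congr; apply: IHs.
  by apply: zz_bwd_congr; apply: IHs.
move: t' {t tt'}; elim: ss' => /=.
- by move=> *; apply: zz_refl.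
- by move=> X' Y' s1 s2 _ IH t'; apply: zz_sym.
- by move=> X' Y' s1 s2 s3 _ IH12 _ IH23 t'; apply: zz_trans (IH12 t') (IH23 t').
- by move=> X' Y' Z' f s1 s2 _ IH t'; apply: zz_fwd_congr.
- by move=> X' Y' Z' w Ww s1 s2 _ IH t'; apply: zz_bwd_congr.
- by move=> *; apply: zz_id.
- by move=> *; apply: zz_comp.
- by move=> *; apply: zz_fwdK.
- by move=> *; apply: zz_bwdK.
Qed.

Lemma zz_cats0 X Y (s : zigzag X Y) : zz_cat s (zz_nil Y) = s.
Proof.
by elim: s => //= [X' Y' Z' f s IHs | X' Y' Z' w Ww s IHs]; rewrite IHs.
Qed.

Lemma zz_catA X Y Z T (s : zigzag X Y) (t : zigzag Y Z) (u : zigzag Z T) :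
  zz_cat s (zz_cat t u) = zz_cat (zz_cat s t) u.
Proof. by elim: s t => //= [X' Y' Z' f s IHs|X' Y' Z' w Ww s IHs] t; rewrite IHs. Qed.

Definition loc_id X : loc_hom X X := zz_class (zz_nil X).

Definition loc_comp X Y Z (g : loc_hom Y Z) (f : loc_hom X Y) : loc_hom X Z :=
  zz_class (zz_cat (zz_repr f) (zz_repr g)).

Lemma loc_comp1m X Y (f : loc_hom X Y) : loc_comp (loc_id Y) f = f.
Proof.
rewrite -[RHS]zz_reprK; apply/zz_class_eq; rewrite -[X in zz_eq _ X]zz_cats0.
by apply: zz_cat_congr; [apply: zz_refl | apply: zz_classK].
Qed.

Lemma loc_compm1 X Y (f : loc_hom X Y) : loc_comp f (loc_id X) = f.
Proof.
rewrite -[RHS]zz_reprK; apply/zz_class_eq.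
rewrite -[X in zz_eq _ X]/(zz_cat (zz_nil X) _).
by apply: zz_cat_congr; [apply: zz_classK | apply: zz_refl].
Qed.

Lemma loc_compA X Y Z T (h : loc_hom Z T) (g : loc_hom Y Z) (f : loc_hom X Y) :
  loc_comp h (loc_comp g f) = loc_comp (loc_comp h g) f.
Proof.
apply/zz_class_eq.
apply: (@zz_trans _ _ _ (zz_cat (zz_cat (zz_repr f) (zz_repr g)) (zz_repr h))).
  by apply: zz_cat_congr; [apply: zz_classK | apply: zz_refl].
rewrite -zz_catA; apply: zz_cat_congr; first exact: zz_refl.
by apply: zz_sym; apply: zz_classK.
Qed.

Definition localization : category :=
  Category loc_comp1m loc_compm1 loc_compA.

End Localization.

Definition Ho (C : category) (M : model_structure C) : category :=
  localization (@weq C M).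

Record functor (C D : category) := Functor {
  fob :> C -> D;
  fmap : forall X Y, hom X Y -> hom (fob X) (fob Y);
  fmap1 : forall X, fmap (idm X) = idm (fob X);
  fmapM : forall X Y Z (g : hom Y Z) (f : hom X Y),
    fmap (g ∘ f) = fmap g ∘ fmap f }.

Arguments fmap {C D} f {X Y} _ : rename.

Definition is_iso (C : category) (X Y : C) (f : hom X Y) : Prop :=
  exists g : hom Y X, g ∘ f = idm X /\ f ∘ g = idm Y.

Definition equivalent_cat (C D : category) : Prop :=
  exists (F : functor C D) (G : functor D C)
         (eta : forall X : C, hom X (G (F X)))
         (eps : forall Y : D, hom (F (G Y)) Y),
  [/\ forall X, is_iso (eta X), forall Y, is_iso (eps Y),
      forall X X' (f : hom X X'), fmap G (fmap F f) ∘ eta X = eta X' ∘ f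
    & forall Y Y' (g : hom Y Y'), g ∘ eps Y = eps Y' ∘ fmap F (fmap G g)].

Section LinearMaps.
Variable A : pzRingType.

Lemma linear_ext (U V : lmodType A) (f g : {linear U -> V}) : f =1 g -> f = g.
Proof.
case: f g => f [[f1] [f2]] [g [[g1] [g2]]] /= /funext e; subst g.
by rewrite (Prop_irrelevance f1 g1) (Prop_irrelevance f2 g2).
Qed.

Definition lin_id (U : lmodType A) : {linear U -> U} := idfun.
Definition lin_comp (U V T : lmodType A) (g : {linear V -> T})
  (f : {linear U -> V}) : {linear U -> T} := g \o f.
Definition lin_zero (U V : lmodType A) : {linear U -> V} := \0.

Definition Mod_cat : category.
refine (@Category (lmodType A) (fun U V => {linear U -> V}) lin_id lin_comp _ _ _);
  by move=> *; apply: linear_ext.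
Defined.

Definition zero_mod : lmodType A := 'rV[A]_0.

Definition Mod : zcategory.
refine (@ZCategory Mod_cat zero_mod (lin_zero zero_mod) (lin_zero^~ zero_mod) _ _).
- by move=> X f; apply: linear_ext => x; rewrite [x]thinmx0 linear0.
- by move=> X f; apply: linear_ext => x; rewrite [f x]thinmx0 /= [RHS]thinmx0.
Defined.

Record difmod := DifMod {
  dmod :> lmodType A;
  dif : {linear dmod -> dmod};
  difK : forall x, dif (dif x) = 0 }.

Record difhom (X Y : difmod) := DifHom {
  dhom :> {linear X -> Y};
  dhomC : forall x, dhom (dif X x) = dif Y (dhom x) }.

Lemma difhom_ext (X Y : difmod) (f g : difhom X Y) : f =1 g -> f = g.
Proof.
case: f g => f f1 [g g1] /= /linear_ext e; subst g.
by rewrite (Prop_irrelevance f1 g1).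
Qed.

Definition dif_id (X : difmod) : difhom X X :=
  DifHom (dhom := lin_id X) (fun=> erefl).

Lemma dif_compP (X Y Z : difmod) (g : difhom Y Z) (f : difhom X Y) x :
  lin_comp g f (dif X x) = dif Z (lin_comp g f x).
Proof. by rewrite /= !dhomC. Qed.

Definition dif_comp (X Y Z : difmod) (g : difhom Y Z) (f : difhom X Y) :
  difhom X Z := DifHom (dif_compP g f).

Definition Dif_cat : category.
refine (@Category difmod difhom dif_id dif_comp _ _ _);
  by move=> *; apply: difhom_ext.
Defined.

Definition zero_dif : difmod :=
  DifMod (dif := lin_zero zero_mod zero_mod) (fun=> erefl).

Lemma dif_zeroP (X Y : difmod) x :
  lin_zero X Y (dif X x) = dif Y (lin_zero X Y x).
Proof. by rewrite /= linear0. Qed.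

Definition dif_zero (X Y : difmod) : difhom X Y := DifHom (@dif_zeroP X Y).

Definition Dif : zcategory.
refine (@ZCategory Dif_cat zero_dif (dif_zero zero_dif) (dif_zero^~ zero_dif) _ _).
- by move=> X f; apply: difhom_ext => x; rewrite [x]thinmx0 linear0.
- by move=> X f; apply: difhom_ext => x; rewrite [f x]thinmx0 /= [RHS]thinmx0.
Defined.

Definition exact_dif : obclass Dif :=
  fun X : difmod => forall x, dif X x = 0 <-> exists y, x = dif X y.

(* Coker d and Ker d are determined up to isomorphism only, hence the         *)
(* existential quantifiers; cotorsion classes are closed under isomorphism.   *)
Definition tildeX (cX : obclass Mod) : obclass Dif := fun X : difmod =>
  exact_dif X /\
  exists (K : Mod) (p : @hom Mod X K), is_cokernel (dif X : @hom Mod X X) p /\ cX K.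

Definition tildeY (cY : obclass Mod) : obclass Dif := fun Y : difmod =>
  exact_dif Y /\
  exists (K : Mod) (i : @hom Mod K Y), is_kernel (dif Y : @hom Mod Y Y) i /\ cY K.

Definition dgX (cY : obclass Mod) : obclass Dif := lperp (tildeY cY).
Definition dgY (cX : obclass Mod) : obclass Dif := rperp (tildeX cX).

End LinearMaps.

Record lcategory (k : comNzRingType) := LCategory {
  lob :> Type;
  lhom : lob -> lob -> lmodType k;
  lid : forall q, lhom q q;
  lcomp : forall q r s, lhom r s -> lhom q r -> lhom q s;
  lcomp1m : forall q r (f : lhom q r), lcomp (lid r) f = f;
  lcompm1 : forall q r (f : lhom q r), lcomp f (lid q) = f;
  lcompA : forall q r s t (h : lhom s t) (g : lhom r s) (f : lhom q r),
    lcomp h (lcomp g f) = lcomp (lcomp h g) f;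
  lcomp_linearr : forall q r s (g : lhom r s) c (f f' : lhom q r),
    lcomp g (c *: f + f') = c *: lcomp g f + lcomp g f';
  lcomp_linearl : forall q r s (f : lhom q r) c (g g' : lhom r s),
    lcomp (c *: g + g') f = c *: lcomp g f + lcomp g' f }.

Section LinearFunctors.
Variables (k : comNzRingType) (A : algType k) (Q : lcategory k).

(* k-linear functors Q -> Mod A, where k acts on Hom_A(U, V) through k -> A.  *)
Record lfunctor := LFunctor {
  lfob :> Q -> lmodType A;
  lfmap : forall q r, lhom q r -> {linear lfob q -> lfob r};
  lfmap1 : forall q x, lfmap (lid q) x = x;
  lfmapM : forall q r s (g : lhom r s) (f : lhom q r) x,
    lfmap (lcomp g f) x = lfmap g (lfmap f x);
  lfmap_linear : forall q r c (f g : lhom q r) x,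
    lfmap (c *: f + g) x = c%:A *: lfmap f x + lfmap g x }.

Record lnat (F G : lfunctor) := LNat {
  lnatf :> forall q, {linear F q -> G q};
  lnatC : forall q r (f : lhom q r) x,
    lnatf r (lfmap F f x) = lfmap G f (lnatf q x) }.

Lemma lnat_ext (F G : lfunctor) (a b : lnat F G) : (forall q, a q =1 b q) -> a = b.
Proof.
case: a b => a a1 [b b1] /= e.
have {}e : a = b by apply: functional_extensionality_dep => q; exact/linear_ext/e.
by subst b; rewrite (Prop_irrelevance a1 b1).
Qed.

Definition lnat_id (F : lfunctor) : lnat F F :=
  LNat (lnatf := fun q => lin_id (F q)) (fun _ _ _ _ => erefl).

Lemma lnat_compP (F G H : lfunctor) (b : lnat G H) (a : lnat F G)
  q r (f : lhom q r) x :
  lin_comp (b r) (a r) (lfmap F f x) = lfmap H f (lin_comp (b q) (a q) x).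
Proof. by rewrite /= !lnatC. Qed.

Definition lnat_comp (F G H : lfunctor) (b : lnat G H) (a : lnat F G) : lnat F H :=
  LNat (lnat_compP b a).

Definition Fun_cat : category.
refine (@Category lfunctor lnat lnat_id lnat_comp _ _ _);
  by move=> *; apply: lnat_ext => q x.
Defined.

Definition zero_lfun : lfunctor.
refine (@LFunctor (fun=> zero_mod A)
  (fun _ _ _ => lin_zero (zero_mod A) (zero_mod A)) _ _ _).
- by move=> q x; rewrite [x]thinmx0.
- by [].
- by move=> *; rewrite /= scaler0 addr0.
Defined.

Lemma lnat_zeroP (F G : lfunctor) q r (f : lhom q r) x :
  lin_zero (F r) (G r) (lfmap F f x) = lfmap G f (lin_zero (F q) (G q) x).
Proof. by rewrite /= linear0. Qed.

Definition lnat_zero (F G : lfunctor) : lnat F G := LNat (@lnat_zeroP F G).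

Definition Fun : zcategory.
refine (@ZCategory Fun_cat zero_lfun (lnat_zero zero_lfun) (lnat_zero^~ zero_lfun) _ _).
- by move=> F a; apply: lnat_ext => q x; rewrite [x]thinmx0 linear0.
- by move=> F a; apply: lnat_ext => q x; rewrite [a q x]thinmx0 /= [RHS]thinmx0.
Defined.

End LinearFunctors.

Section Jordan.
Variable k : comNzRingType.

(* One object, with endomorphism ring k[eps]/(eps^2). *)
Definition Jordan : lcategory k.
refine (@LCategory k unit (fun _ _ => {poly %/ ('X^2 : {poly k})})
  (fun=> 1) (fun _ _ _ g f => g * f) _ _ _ _ _).
- by move=> *; rewrite mul1r.
- by move=> *; rewrite mulr1.
- by move=> *; rewrite mulrA.
- by move=> *; rewrite mulrDr scalerAr.
- by move=> *; rewrite mulrDl scalerAl.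
Defined.

Definition jeps : @lhom k Jordan tt tt := 'qX.

Lemma jeps2 : lcomp jeps jeps = 0.
Proof.
rewrite /jeps /= -in_qpolyM -expr2; apply: val_inj => /=.
by rewrite mk_monic_Xn Pdiv.RingMonic.rmodpp // monicXn.
Qed.

Variable A : algType k.

Lemma lfmap_jepsK (F : lfunctor A Jordan) x :
  lfmap F jeps (lfmap F jeps x) = 0.
Proof.
rewrite -lfmapM jeps2; have := lfmap_linear (-1) 0 (0 : @lhom k Jordan tt tt) x.
by rewrite scaler0 addr0 scaleN1r scaleNr scale1r addNr.
Qed.

(* The identification of Fun A Jordan with Dif A, on objects. *)
Definition dif_of_lfun (F : lfunctor A Jordan) : difmod A :=
  DifMod (@lfmap_jepsK F).

Definition exact_lfun : obclass (Fun A Jordan) :=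
  fun F => exact_dif (dif_of_lfun F).

Definition Qshaped_model (N : model_structure (Fun A Jordan)) : Prop :=
  [/\ abelian_model N,
      forall F, cofibrant N F <-> lperp exact_lfun F,
      forall F, trivial_ob N F <-> exact_lfun F
    & forall F, fibrant N F].

End Jordan.

Definition noetherian (k : comNzRingType) : Prop :=
  forall I : {pred k^o}, submod_closed I ->
  exists s : seq k, forall x : k,
    x \in I <-> exists c : nat -> k, x = \sum_(i < size s) c i * s`_i.

Definition projective (k : comNzRingType) (P : lmodType k) : Prop :=
  forall (U V : lmodType k) (g : {linear U -> V}) (f : {linear P -> V}),
    (forall v, exists u, g u = v) -> exists h : {linear P -> U}, g \o h =1 f.

(* Ideals are taken up to isomorphism: modules embedding into k. *)
Definition hereditary_ring (k : comNzRingType) : Prop :=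
  forall (I : lmodType k) (i : {linear I -> k^o}), injective i -> projective I.

(* Main.v *)
From HB Require Import structures.
From mathcomp Require Import all_boot all_algebra qpoly.
From mathcomp Require Import boolp.
From mathcomp.multinomials Require Import freeg.
From Stdlib Require Import Relation_Operators.
Require Import Defs.

(** The two induced cotorsion pairs come from one description of the two tilde
    classes.  A differential module T is exact with cycles K exactly when its
    differential factors as T -> K -> T for a short exact sequence
    0 -> K -> T -> K -> 0, and then K is both the kernel and the cokernel of the
    differential.  So both tilde classes have the form [cycles_in c], and such a T
    is an extension of two spheres, i.e. modules with zero differential
    ([cycles_filtration]).

    Completeness is obtained by special embeddings M -> Y -> X with X in tilde X
    and Y in dg Y.  Every M is an extension of spheres ([sphere_filtration]), and
    objects having a special embedding are closed under extensions by a horseshoe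
    construction ([horseshoe], [special_emb_ext]); this is where heredity enters.
    For a sphere on V one iterates the given special embeddings of modules
    V -> J_0 -> J_1 -> ... with J_i in Y.  The product of the J_i with the shifted
    maps as differential lies in dg Y, because a morphism from tilde X into it can
    be contracted one factor at a time, and V embeds into it with exact cokernel
    ([sphere_coresolution]).  The exact cokernel need not be in tilde X, but every
    exact object has a special approximation with both terms exact, obtained from
    the horseshoe for its cycles ([exact_emb], [exact_cover]), and a pullback
    corrects the cokernel ([special_emb_fix]).  The other pair is dual, with direct
    sums in place of products ([sphere_resolution]).  The same exact approximations
    split for an exact object of dg X or of dg Y, whence tilde X = dg X & E and
    tilde Y = dg Y & E ([tildeX_exact], [tildeY_exact]); compatibility follows.

    The model structure is Hovey's, with the quasi-isomorphisms as weak
    equivalences ([hovey_model], [induced_model]).  The Q-shaped model structure is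
    the special case of the pair (projectives, all modules), moved along the
    equivalence between functors on the Jordan category and differential modules
    ([projective_model], [pull_abelian]).  In any abelian model structure whose
    trivial objects are the exact ones the weak equivalences must be the
    quasi-isomorphisms ([abelian_weq]); both homotopy categories therefore localize
    equivalent categories at corresponding morphisms, hence are equivalent
    ([localization_equivalent]).

    Everything that only uses kernels, cokernels, pullbacks and pushouts is done in
    an axiomatic setting stable under passing to the opposite category
    ([abelianlike]), so that each such statement also yields its dual. *)

Set Implicit Arguments.
Unset Strict Implicit.
Unset Printing Implicit Defensive.

Import GRing.Theory.
Local Open Scope ring_scope.
Local Open Scope cat_scope.

(** * Opposite categories and the axiomatic setting *)
Section Opposite.
Variable C : zcategory.

Definition op_cat : category.
refine (@Category C (fun X Y => hom Y X) (@idm C) (fun _ _ _ g f => f ∘ g) _ _ _).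
- by move=> *; rewrite compm1.
- by move=> *; rewrite comp1m.
- by move=> *; rewrite compA.
Defined.

Definition op : zcategory :=
  @ZCategory op_cat zob (@to0 C) (@from0 C) (@to0_uniq C) (@from0_uniq C).
End Opposite.

Section Squares.
Variable C : category.
Implicit Types P X Y Z : C.

Definition pullback P X Y Z (a : hom P X) (b : hom P Y) (f : hom X Z)
    (g : hom Y Z) : Prop :=
  f ∘ a = g ∘ b /\
  forall T (u : hom T X) (v : hom T Y), f ∘ u = g ∘ v ->
    exists! w : hom T P, a ∘ w = u /\ b ∘ w = v.

Definition pushout P X Y Z (a : hom P X) (b : hom P Y) (f : hom X Z)
    (g : hom Y Z) : Prop :=
  f ∘ a = g ∘ b /\
  forall T (u : hom X T) (v : hom Y T), u ∘ a = v ∘ b ->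
    exists! w : hom Z T, w ∘ f = u /\ w ∘ g = v.

Definition bicart P X Y Z (a : hom P X) (b : hom P Y) (f : hom X Z)
    (g : hom Y Z) : Prop :=
  pullback a b f g /\ pushout a b f g.
End Squares.

Record biproduct (C : zcategory) (N M : C) := Biproduct {
  bip : C;
  bi1 : hom N bip;
  bi2 : hom M bip;
  bp1 : hom bip N;
  bp2 : hom bip M;
  bp1i1 : bp1 ∘ bi1 = idm N;
  bp2i2 : bp2 ∘ bi2 = idm M;
  bp1i2 : bp1 ∘ bi2 = zero_mor M N;
  bp2i1 : bp2 ∘ bi1 = zero_mor N M;
  bpair : forall T (u : hom T N) (v : hom T M),
    exists! w : hom T bip, bp1 ∘ w = u /\ bp2 ∘ w = v;
  bcopair : forall T (u : hom N T) (v : hom M T),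
    exists! w : hom bip T, w ∘ bi1 = u /\ w ∘ bi2 = v }.

(** The facts about an abelian category used below, chosen so that the list is
    self-dual.  Squares are asked to be bicartesian at once because kernels are
    read off a pullback and cokernels off a pushout.  There is no addition of
    morphisms: [al_split] replaces the use of 1 - s p, and [al_five] that of
    diagram chasing. *)
Record abelianlike (C : zcategory) : Prop := AbelianLike {
  al_coker : forall (X Y : C) (f : hom X Y), mono f ->
    exists K (p : hom Y K), short_exact f p;
  al_ker : forall (X Y : C) (f : hom X Y), epi f ->
    exists K (i : hom K X), short_exact i f;
  al_pull : forall (X Y Z : C) (f : hom X Z) (g : hom Y Z), epi g ->
    exists P (a : hom P X) (b : hom P Y), bicart a b f g /\ epi a;
  al_push : forall (P X Y : C) (a : hom P X) (b : hom P Y), mono a ->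
    exists Z (f : hom X Z) (g : hom Y Z), bicart a b f g /\ mono g;
  al_five : forall (N E E' M : C) (i : hom N E) (p : hom E M) (i' : hom N E')
      (p' : hom E' M) (u : hom E E'), short_exact i p -> short_exact i' p' ->
    u ∘ i = i' -> p' ∘ u = p -> is_iso u;
  al_biprod : forall N M : C, inhabited (biproduct N M);
  al_split : forall (N E M : C) (i : hom N E) (p : hom E M), short_exact i p ->
    (exists s, p ∘ s = idm M) <-> (exists r, r ∘ i = idm N) }.

Lemma ex_uniq (T : Type) (P : T -> Prop) : (exists! x, P x) ->
  (exists x, P x) /\ (forall x y, P x -> P y -> x = y).
Proof.
by case=> x [Px ux]; split; [exists x | move=> y z /ux <- /ux <-].
Qed.

Section OpDuality.
Variable C : zcategory.
Implicit Types X Y Z : C.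

Lemma short_exact_op X Y Z (i : hom X Y) (p : hom Y Z) :
  short_exact i p -> @short_exact (op C) Z Y X p i.
Proof. by case=> ? ?; split. Qed.

Lemma op_short_exact X Y Z (i : hom X Y) (p : hom Y Z) :
  @short_exact (op C) Z Y X p i -> short_exact i p.
Proof. by case=> ? ?; split. Qed.

Lemma pullback_sym (P X Y Z : C) (a : hom P X) (b : hom P Y) (f : hom X Z) (g : hom Y Z) :
  pullback a b f g -> pullback b a g f.
Proof.
case=> e h; split=> // T u v /esym /h[w [[w1 w2] uw]].
by exists w; split=> // w' [? ?]; apply: uw.
Qed.

Lemma bicart_sym (P X Y Z : C) (a : hom P X) (b : hom P Y) (f : hom X Z) (g : hom Y Z) :
  bicart a b f g -> bicart b a g f.
Proof.
case=> /pullback_sym h [e k]; split=> //; split=> // T u v /esym /k[w [[w1 w2] uw]].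
by exists w; split=> // w' [? ?]; apply: uw.
Qed.

Lemma bicart_op (P X Y Z : C) (a : hom P X) (b : hom P Y) (f : hom X Z) (g : hom Y Z) :
  bicart a b f g -> @bicart (op C) Z X Y P f g a b.
Proof. by case. Qed.

Lemma op_bicart (P X Y Z : C) (a : hom P X) (b : hom P Y) (f : hom X Z) (g : hom Y Z) :
  @bicart (op C) Z X Y P f g a b -> bicart a b f g.
Proof. by case. Qed.

Lemma is_iso_op X Y (f : hom X Y) : is_iso f <-> @is_iso (op C) Y X f.
Proof. by split=> -[g [? ?]]; exists g. Qed.

Lemma abelianlike_op : abelianlike C -> abelianlike (op C).
Proof.
case=> Hc Hk Hpl Hps H5 Hb Hs; split.
- by move=> X Y f /Hk[K [i h]]; exists K, i; exact: short_exact_op.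
- by move=> X Y f /Hc[K [i h]]; exists K, i; exact: short_exact_op.
- move=> X Y Z f g mg; have [P [a [b [h m]]]] := Hps Z Y X g f mg.
  by exists P, b, a; split; [exact/bicart_op/bicart_sym|].
- move=> P X Y a b ea; have [Z [f [g [h m]]]] := Hpl Y X P b a ea.
  by exists Z, g, f; split; [exact/bicart_op/bicart_sym|].
- move=> N E E' M i p i' p' u h h' e1 e2; apply/is_iso_op.
  exact: (H5 M E' E N p' i' p i u (op_short_exact h') (op_short_exact h) e2 e1).
- move=> N M; have [[B i1 i2 p1 p2 e1 e2 e3 e4 h1 h2]] := Hb N M.
  by constructor; exact: (@Biproduct (op C) N M B p1 p2 i1 i2).
- move=> N E M i p /op_short_exact/Hs h; exact: iff_sym.
Qed.
End OpDuality.

(** * Kernels, cokernels and short exact sequences *)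
Section KernelFormalities.
Variable C : zcategory.
Implicit Types X Y Z M N E K T : C.

Lemma comp_zero X Y Z (f : hom Y Z) : f ∘ zero_mor X Y = zero_mor X Z.
Proof. by rewrite /zero_mor compA (from0_uniq (f ∘ _)). Qed.

Lemma zero_comp X Y Z (f : hom X Y) : zero_mor Y Z ∘ f = zero_mor X Z.
Proof. by rewrite /zero_mor -compA (to0_uniq (_ ∘ f)). Qed.

Lemma zero_zob X (f : hom X zob) Y (g : hom zob Y) : g ∘ f = zero_mor X Y.
Proof. by rewrite (to0_uniq f) (from0_uniq g). Qed.

Lemma ker_mono X Y K (f : hom X Y) (i : hom K X) : is_kernel f i -> mono i.
Proof.
case=> e h T u v euv; have /h/ex_uniq[_ uq] : f ∘ (i ∘ u) = zero_mor T Y.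
  by rewrite compA e zero_comp.
exact: uq.
Qed.

Lemma ses_mono N E M (i : hom N E) (p : hom E M) : short_exact i p -> mono i.
Proof. by case=> /ker_mono. Qed.

Lemma ses0 N E M (i : hom N E) (p : hom E M) :
  short_exact i p -> p ∘ i = zero_mor N M.
Proof. by case=> -[]. Qed.

Lemma ker_fact N E M (i : hom N E) (p : hom E M) : is_kernel p i ->
  forall T (g : hom T E), p ∘ g = zero_mor T M -> exists u, i ∘ u = g.
Proof. by case=> _ h T g /h[u [<- _]]; exists u. Qed.

Lemma ses_fact N E M (i : hom N E) (p : hom E M) : short_exact i p ->
  forall T (g : hom T E), p ∘ g = zero_mor T M -> exists u, i ∘ u = g.
Proof. by case=> /ker_fact. Qed.

Lemma mono_comp X Y Z (f : hom X Y) (g : hom Y Z) : mono f -> mono g -> mono (g ∘ f).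
Proof. by move=> mf mg T u v; rewrite -!compA => /mg/mf. Qed.

Lemma pullback_ker P X Y Z (a : hom P X) (b : hom P Y) (f : hom X Z) (g : hom Y Z)
  K (k : hom K P) : pullback a b f g -> is_kernel a k -> is_kernel g (b ∘ k).
Proof.
move=> [e h] [ek hk]; split; first by rewrite compA -e -compA ek comp_zero.
move=> T v gv.
have /h[w [[w1 w2] _]] : f ∘ zero_mor T X = g ∘ v by rewrite comp_zero gv.
have /hk[u [eu uq]] := w1.
exists u; split; first by rewrite -compA eu.
move=> u' eu'; apply: uq; have /h/ex_uniq[_ uq'] : f ∘ zero_mor T X = g ∘ v.
  by rewrite comp_zero gv.
apply: uq'; last by split.
by rewrite compA ek zero_comp compA.
Qed.

Lemma ker_pullback P X Y Z (a : hom P X) (b : hom P Y) (f : hom X Z) (g : hom Y Z)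
  K (k : hom K Y) : pullback a b f g -> is_kernel g k ->
  exists k' : hom K P, b ∘ k' = k /\ is_kernel a k'.
Proof.
move=> [e h] [ek hk].
have h0 : f ∘ zero_mor K X = g ∘ k by rewrite comp_zero ek.
have [k' [[k1 k2] _]] := h _ _ _ h0.
exists k'; split=> //; split=> // T v av.
have gbv : g ∘ (b ∘ v) = zero_mor T Z by rewrite compA -e -compA av comp_zero.
have [u [eu uq]] := hk _ _ gbv.
have h1 : f ∘ (a ∘ v) = g ∘ (b ∘ v) by rewrite !compA e.
have [_ uq'] := ex_uniq (h _ _ _ h1).
exists u; split.
  by apply: uq' => //; split; rewrite compA ?k1 ?zero_comp ?av // k2.
by move=> u' eu'; apply: uq; rewrite -k2 -compA eu'.
Qed.

Lemma mono_pullback P X Y Z (a : hom P X) (b : hom P Y) (f : hom X Z) (g : hom Y Z) :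
  pullback a b f g -> mono g -> mono a.
Proof.
move=> [e h] mg T u v euv.
have h1 : f ∘ (a ∘ v) = g ∘ (b ∘ v) by rewrite !compA e.
have [_ uq] := ex_uniq (h _ _ _ h1); apply: uq; split=> //.
by apply: mg; rewrite !compA -e -!compA euv.
Qed.

End KernelFormalities.

Section CokernelFormalities.
Variable C : zcategory.
Implicit Types X Y Z M N E K T : C.

Lemma coker_epi X Y K (f : hom X Y) (p : hom Y K) : is_cokernel f p -> epi p.
Proof. exact: (@ker_mono (op C)). Qed.

Lemma ses_epi N E M (i : hom N E) (p : hom E M) : short_exact i p -> epi p.
Proof. by move/short_exact_op/ses_mono. Qed.

Lemma coker_fact N E M (i : hom N E) (p : hom E M) : is_cokernel i p ->
  forall T (g : hom E T), g ∘ i = zero_mor N T -> exists u, u ∘ p = g.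
Proof. exact: (@ker_fact (op C)). Qed.

Lemma ses_cofact N E M (i : hom N E) (p : hom E M) : short_exact i p ->
  forall T (g : hom E T), g ∘ i = zero_mor N T -> exists u, u ∘ p = g.
Proof. by case=> _ /coker_fact. Qed.

Lemma epi_comp X Y Z (f : hom X Y) (g : hom Y Z) : epi f -> epi g -> epi (g ∘ f).
Proof. move=> ef eg; exact: (@mono_comp (op C) _ _ _ g f). Qed.

Lemma pushout_coker P X Y Z (a : hom P X) (b : hom P Y) (f : hom X Z) (g : hom Y Z)
  K (k : hom Z K) : pushout a b f g -> is_cokernel f k -> is_cokernel b (k ∘ g).
Proof. exact: (@pullback_ker (op C)). Qed.

Lemma coker_pushout P X Y Z (a : hom P X) (b : hom P Y) (f : hom X Z) (g : hom Y Z)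
  K (k : hom Y K) : pushout a b f g -> is_cokernel b k ->
  exists k' : hom Z K, k' ∘ g = k /\ is_cokernel f k'.
Proof. exact: (@ker_pullback (op C)). Qed.

Lemma epi_pushout P X Y Z (a : hom P X) (b : hom P Y) (f : hom X Z) (g : hom Y Z) :
  pushout a b f g -> epi b -> epi f.
Proof. exact: (@mono_pullback (op C)). Qed.

Lemma epi_cancel X Y Z (f : hom X Y) (g : hom Y Z) : epi (g ∘ f) -> epi g.
Proof. by move=> e T u v h; apply: e; rewrite !compA h. Qed.

(** Two cokernels of f are uniquely isomorphic, so f, being a kernel of one, is a
    kernel of the other. *)
Lemma mono_coker_ker X Y K K' (f : hom X Y) (p : hom Y K) (p' : hom Y K') :
  short_exact f p -> is_cokernel f p' -> short_exact f p'.
Proof.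
move=> [[e k] c] c'; split=> //.
have [u eu] := coker_fact c' (proj1 c); have [v ev] := coker_fact c (proj1 c').
split; first by case: c'.
by move=> T g h; apply: k; rewrite -eu -compA h comp_zero.
Qed.
End CokernelFormalities.

Section PullbackSequences.
Variables (C : zcategory) (ab : abelianlike C).
Implicit Types X Y Z M N E K T : C.

Lemma mono_coker_ses X Y K (f : hom X Y) (p : hom Y K) :
  mono f -> is_cokernel f p -> short_exact f p.
Proof. by move=> /(al_coker ab)[K' [p' h]]; apply: mono_coker_ker h. Qed.

(** [al_push] provides one pushout of a monomorphism whose opposite side is a
    monomorphism; any other pushout maps to it. *)
Lemma mono_pushout P X Y Z (a : hom P X) (b : hom P Y) (f : hom X Z) (g : hom Y Z) :
  pushout a b f g -> mono a -> mono g.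
Proof.
move=> [e h] ma; have [Z' [f' [g' [[_ [e' _]] mg]]]] := al_push ab b ma.
have [w [[w1 w2] _]] := h _ _ _ e'.
by move=> T u v /(congr1 (comp w)); rewrite !compA w2 => /mg.
Qed.

Lemma pull_ses N E M M' (i : hom N E) (p : hom E M) (f : hom M' M) :
  short_exact i p -> exists E' (i' : hom N E') (p' : hom E' M') (g : hom E' E),
    [/\ short_exact i' p', g ∘ i' = i & bicart p' g f p].
Proof.
move=> h; have [E' [p' [g [[pb po] ep]]]] := al_pull ab f (ses_epi h).
have [i' [gi' k]] := ker_pullback pb (proj1 h).
exists E', i', p', g; split=> //.
have [K [k' s']] := al_ker ab ep.
exact/op_short_exact/(mono_coker_ker (short_exact_op s') k).
Qed.
End PullbackSequences.

Section PushoutSequences.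
Variables (C : zcategory) (ab : abelianlike C).
Implicit Types X Y Z M N E K T : C.
Let abo := abelianlike_op ab.

Lemma epi_ker_ses X Y K (p : hom X Y) (i : hom K X) :
  epi p -> is_kernel p i -> short_exact i p.
Proof. by move=> ep k; apply/op_short_exact/(mono_coker_ses abo). Qed.

Lemma epi_pullback P X Y Z (a : hom P X) (b : hom P Y) (f : hom X Z) (g : hom Y Z) :
  pullback a b f g -> epi f -> epi b.
Proof. exact: (mono_pushout abo). Qed.

Lemma push_ses N N' E M (i : hom N E) (p : hom E M) (f : hom N N') :
  short_exact i p -> exists E' (i' : hom N' E') (p' : hom E' M) (g : hom E E'),
    [/\ short_exact i' p', p' ∘ g = p & bicart i f g i'].
Proof.
move=> /short_exact_op h; have [E' [i' [p' [g [h1 h2 h3]]]]] := pull_ses abo f h.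
by exists E', p', i', g; split; [exact: op_short_exact | | exact/bicart_sym/op_bicart].
Qed.

(** The pushout of the first sequence along f is a sequence with the same right
    end as the second, hence isomorphic to it by the five lemma. *)
Lemma ses_mor_bicart N N' E E' M (i : hom N E) (p : hom E M) (i' : hom N' E')
    (p' : hom E' M) (f : hom N N') (g : hom E E') :
  short_exact i p -> short_exact i' p' -> g ∘ i = i' ∘ f -> p' ∘ g = p ->
  bicart i f g i'.
Proof.
move=> h h' e1 e2; have [F [j [q [k [s qk [pb po]]]]]] := push_ses f h.
have [w [[w1 w2] _]] := proj2 po _ _ _ e1.
have qw : p' ∘ w = q.
  have [e h1] := po; have e0 : p ∘ i = zero_mor _ _ ∘ f by rewrite zero_comp (ses0 h).
  have [_ uq] := ex_uniq (h1 _ _ _ e0); apply: uq; split=> //.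
  - by rewrite -compA w1.
  - by rewrite -compA w2 (ses0 h').
  - by rewrite (ses0 s).
have [v [vw wv]] := al_five ab s h' w2 qw.
split.
  split=> // T u t ut.
  have /(proj2 pb)[x [[x1 x2] uq]] : k ∘ u = j ∘ t.
    by rewrite -[k]comp1m -vw -(compA v) w1 -compA ut -w2 -!compA compA vw comp1m.
  by exists x; split.
split=> // T u t ut.
have [x [[x1 x2] uq]] := proj2 po _ _ _ ut.
exists (x ∘ v); split.
  by split; [rewrite -w1 -x1|rewrite -w2 -x2]; rewrite -!compA; congr comp; rewrite compA vw comp1m.
move=> y [y1 y2]; have <- : y ∘ w = x by symmetry; apply: uq; rewrite -!compA w1 w2.
by rewrite -compA wv compm1.
Qed.

End PushoutSequences.

Section Orthogonality.
Variables (C : zcategory) (ab : abelianlike C).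
Implicit Types X Y Z M N E K T : C.

Lemma ses_mor_bicart_op N E E' M M' (i : hom N E) (p : hom E M) (i' : hom N E')
    (p' : hom E' M') (f : hom M M') (g : hom E E') :
  short_exact i p -> short_exact i' p' -> g ∘ i = i' -> p' ∘ g = f ∘ p ->
  bicart p g f p'.
Proof.
move=> h h' e1 e2; apply/op_bicart/bicart_sym.
exact: (ses_mor_bicart (abelianlike_op ab) (short_exact_op h') (short_exact_op h)).
Qed.

Lemma biprod_ses N M (b : biproduct N M) : short_exact (bi1 b) (bp2 b).
Proof.
case: b => B i1 i2 p1 p2 e11 e22 e12 e21 h1 h2 /=; split; split=> //.
- move=> T g pg; exists (p1 ∘ g); split; last by move=> u <-; rewrite compA e11 comp1m.
  have /ex_uniq[_ uq] := h1 T (p1 ∘ g) (p2 ∘ g).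
  by apply: uq; split=> //; rewrite compA ?e11 ?e21 ?comp1m // zero_comp pg.
- move=> T g gi; exists (g ∘ i2); split; last by move=> u <-; rewrite -compA e22 compm1.
  have /ex_uniq[_ uq] := h2 T (g ∘ i1) (g ∘ i2).
  by apply: uq; split=> //; rewrite -compA ?e21 ?e22 ?compm1 // comp_zero gi.
Qed.

(** Vanishing of Ext^1 in its usable form: every extension splits. *)
Definition orth M N : Prop := forall E (i : hom N E) (p : hom E M),
  short_exact i p -> exists s, p ∘ s = idm M.

Lemma orthr M N E (i : hom N E) (p : hom E M) :
  orth M N -> short_exact i p -> exists r, r ∘ i = idm N.
Proof. by move=> o h; apply: (proj1 (al_split ab h)); exact: o h. Qed.

(** The biproduct is a split extension, so if all extensions are equivalent they
    split; conversely a retraction of one extension and a section of another glue,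
    through the biproduct, to an equivalence. *)
Lemma Ext1P M N : Ext1_zero M N <-> orth M N.
Proof.
have [b] := al_biprod ab N M; have hb := biprod_ses b; split=> [h E i p s | h].
  have [u [u1 u2]] := h (Extension hb) (Extension s).
  by exists (u ∘ bi2 b); rewrite compA u2 /= bp2i2.
move=> [E1 i1 p1 h1] [E2 i2 p2 h2]; rewrite /ext_equiv /=.
have [s es] := h _ _ _ h2; have [r er] := orthr h h1.
have [w [[w1 w2] _]] := bpair b r p1.
have [v [[v1 v2] _]] := bcopair b i2 s.
exists (v ∘ w); split.
  rewrite -compA; suff -> : w ∘ i1 = bi1 b by [].
  have [_ uq] := ex_uniq (bpair b (idm N) (zero_mor N M)).
  by apply: uq; rewrite ?bp1i1 ?bp2i1 // !compA w1 w2 er (ses0 h1).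
rewrite compA; suff -> : p2 ∘ v = bp2 b by [].
have /ex_uniq[_ uq] := bcopair b (zero_mor N M) (idm M).
by apply: uq; rewrite ?bp2i2 ?bp2i1 // -!compA v1 v2 es (ses0 h2).
Qed.

(** Split the pullback of the sequence along f. *)
Lemma orth_lift M N E B (i : hom N E) (p : hom E B) (f : hom M B) :
  orth M N -> short_exact i p -> exists g, p ∘ g = f.
Proof.
move=> o h; have [E' [i' [p' [g [s _ [[e _] _]]]]]] := pull_ses ab f h.
by have [t et] := o _ _ _ s; exists (g ∘ t); rewrite compA -e -compA et compm1.
Qed.

Lemma orth_ext M N E A (i : hom A E) (p : hom E M) (f : hom A N) :
  orth M N -> short_exact i p -> exists g, g ∘ i = f.
Proof.
move=> o h; have [E' [i' [p' [g [s _ [[e _] _]]]]]] := push_ses ab f h.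
by have [t et] := orthr o s; exists (t ∘ g); rewrite -compA e compA et comp1m.
Qed.

Lemma orth_retractl M M' N (i : hom M M') (r : hom M' M) :
  r ∘ i = idm M -> orth M' N -> orth M N.
Proof.
move=> e o E j p h; have [g eg] := orth_lift r o h.
by exists (g ∘ i); rewrite compA eg.
Qed.

(** Push an extension of M by N out along p.  The result splits since
    Ext^1(M, N2) = 0, and its section lifts along E -> E / N1, whose kernel is N1. *)
Lemma orth_extl M N N1 N2 (i : hom N1 N) (p : hom N N2) :
  short_exact i p -> orth M N1 -> orth M N2 -> orth M N.
Proof.
move=> h o1 o2 E j q s.
have [F [j' [q' [g [s' eq' [pb po]]]]]] := push_ses ab p s.
have [t et] := o2 _ _ _ s'.
have sg : short_exact (j ∘ i) g.
  apply: (epi_ker_ses ab); first exact: (epi_pushout po (ses_epi h)).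
  exact: (pullback_ker (pullback_sym pb) (proj1 h)).
have [x ex] := orth_lift t o1 sg.
by exists x; rewrite -eq' -compA ex.
Qed.

End Orthogonality.

Section OrthogonalityDuals.
Variables (C : zcategory) (ab : abelianlike C).
Implicit Types X Y Z M N E K T : C.
Let abo := abelianlike_op ab.

Lemma orth_op M N : orth M N -> @orth (op C) N M.
Proof. by move=> o E i p /op_short_exact s; exact: (orthr ab o s). Qed.

Lemma op_orth M N : @orth (op C) N M -> orth M N.
Proof. by move=> o E i p /short_exact_op s; exact: (orthr abo o s). Qed.

Lemma orth_by_retraction M N :
  (forall E (i : hom N E) (p : hom E M), short_exact i p ->
     exists r, r ∘ i = idm N) -> orth M N.
Proof. by move=> h E i p s; apply: (proj2 (al_split ab s)); exact: h s. Qed.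

Lemma orth_retractr M N N' (i : hom N N') (r : hom N' N) :
  r ∘ i = idm N -> orth M N' -> orth M N.
Proof. by move=> e /orth_op o; apply/op_orth/(orth_retractl abo e). Qed.

Lemma orth_extr M1 M2 M N (i : hom M1 M) (p : hom M M2) :
  short_exact i p -> orth M1 N -> orth M2 N -> orth M N.
Proof.
move=> /short_exact_op h /orth_op o1 /orth_op o2.
exact/op_orth/(orth_extl abo h).
Qed.

(** Dimension shifting without Ext^2.  An extension E of T by N'' is covered by
    some X0 -> E with X0 in cX; the kernel T' of X0 -> T is again in cX.  The map
    T' -> N'' lifts to N and extends to X0, and since E is the pushout of X0 along
    T' -> N'' this gives a retraction of N'' -> E. *)
Lemma rperp_coker (cX : obclass C) N' N N'' (i : hom N' N) (p : hom N N'') :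
  (forall X X' K (j : hom K X) (q : hom X X'), short_exact j q ->
     cX X -> cX X' -> cX K) ->
  (forall M, exists X (q : hom X M), epi q /\ cX X) ->
  short_exact i p -> (forall X, cX X -> orth X N') ->
  (forall X, cX X -> orth X N) -> forall X, cX X -> orth X N''.
Proof.
move=> hker hen h o1 o2 T cT; apply: orth_by_retraction => E j e s.
have [X0 [q [eq cX0]]] := hen E.
have [T' [t st]] := al_ker ab (epi_comp eq (ses_epi s)).
have cT' := hker _ _ _ _ _ st cX0 cT.
have [f ef] : exists f, j ∘ f = q ∘ t.
  by apply: (ses_fact s); rewrite compA (ses0 st).
have [f1 ef1] := orth_lift ab f (o1 _ cT') h.
have [g eg] := orth_ext ab f1 (o2 _ cT) st.
have [_ [_ po]] := ses_mor_bicart ab st s (esym ef) erefl.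
have /po[r [[_ er] _]] : (p ∘ g) ∘ t = idm N'' ∘ f by rewrite -compA eg ef1 comp1m.
by exists r.
Qed.

Definition ses_mor (A B D A' B' D' : C) (a : hom A B) (b : hom B D) (a' : hom A' B')
    (b' : hom B' D') (f : hom A A') (g : hom B B') (h : hom D D') : Prop :=
  g ∘ a = a' ∘ f /\ h ∘ b = b' ∘ g.

(** In the classical horseshoe lemma the outer columns are glued by projectivity.
    Here one first pushes B out along A -> Y1, getting an extension E of D by Y1,
    and has to extend this class from D to Y3; the obstruction lives in
    Ext^2(X3, Y1) = 0.  Concretely, embed E into some W in cY: the map from D to
    W / Y1, which is in cY, extends to Y3 as Ext^1(X3, W / Y1) = 0, and Y2 is the
    pullback of W along this extension. *)
Lemma horseshoe (cX cY : obclass C) (A B D Y1 Y3 X1 X3 : C) (a : hom A B) (b : hom B D)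
    (u1 : hom A Y1) (v1 : hom Y1 X1) (u3 : hom D Y3) (v3 : hom Y3 X3) :
  (forall X Y, cX X -> cY Y -> orth X Y) ->
  (forall Y' Y K (j : hom Y' Y) (q : hom Y K), short_exact j q ->
     cY Y' -> cY Y -> cY K) ->
  (forall M, exists Y (j : hom M Y), mono j /\ cY Y) ->
  short_exact a b -> short_exact u1 v1 -> short_exact u3 v3 -> cY Y1 -> cX X3 ->
  exists Y2 X2 (m : hom Y1 Y2) (n : hom Y2 Y3) (m' : hom X1 X2) (n' : hom X2 X3)
    (u2 : hom B Y2) (v2 : hom Y2 X2),
    [/\ short_exact m n, short_exact m' n', short_exact u2 v2,
        ses_mor a b m n u1 u2 u3 & ses_mor m n m' n' v1 v2 v3].
Proof.
move=> hO hcok hen sab s1 s3 cY1 cX3.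
have [E [al [be [g [sE eg [pbg pog]]]]]] := push_ses ab u1 sab.
have ega := proj1 pbg.
have [W [w [mw cW]]] := hen E.
have [D1 [om sW]] := al_coker ab (mono_comp (ses_mono sE) mw).
have cD := hcok _ _ _ _ _ sW cY1 cW.
have [de ede] : exists de, de ∘ be = om ∘ w.
  by apply: (ses_cofact sE); rewrite -compA (ses0 sW).
have [ga ega'] := orth_ext ab de (hO _ _ cX3 cD) s3.
have [Y2 [m [n [h [sY hm [pbh poh]]]]]] := pull_ses ab ga sW.
have [pe ph] := pbh.
have hk : ga ∘ (u3 ∘ be) = om ∘ w by rewrite compA ega' ede.
have [ka [[ka1 ka2] _]] := ph _ _ _ hk.
have kal : ka ∘ al = m.
  have h0 : ga ∘ (n ∘ m) = om ∘ (h ∘ m) by rewrite !compA pe.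
  have [_ uq] := ex_uniq (ph _ _ _ h0); apply: uq; split=> //.
    by rewrite compA ka1 -compA (ses0 sE) comp_zero (ses0 sY).
  by rewrite compA ka2 hm.
have [pbk pok] := ses_mor_bicart_op ab sE sY kal ka1.
(* The square on E, Y2, D, Y3 is bicartesian, so E -> Y2 is monic with the same
   cokernel X3 as D -> Y3; its pushout along E -> X1 then gives X2. *)
have sk : short_exact ka (v3 ∘ n).
  apply: (mono_coker_ses ab); first exact: (mono_pullback (pullback_sym pbk) (ses_mono s3)).
  exact: (@pushout_coker C _ _ _ _ be ka u3 n _ v3 pok (proj2 s3)).
have mg : mono g by apply: (mono_pushout ab _ (ses_mono s1)); exact: (proj2 (bicart_sym (conj pbg pog))).
have [xi [xal cxi]] := coker_pushout pog (proj2 s1).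
have sxi := mono_coker_ses ab mg cxi.
have [X2 [v2 [m' [[pbx pox] mm']]]] := al_push ab xi (ses_mono sk).
have [n' [nv cn']] := coker_pushout (proj2 (bicart_sym (conj pbx pox))) (proj2 sk).
exists Y2, X2, m, n, m', n', (ka ∘ g), v2; split=> //.
- exact: (mono_coker_ses ab).
- apply: (epi_ker_ses ab); first exact: (epi_pushout pox (ses_epi sxi)).
  exact: (pullback_ker (pullback_sym pbx) (proj1 sxi)).
- by split; [rewrite -compA ega compA kal | rewrite compA ka1 -compA eg].
- by split; [rewrite -kal compA (proj1 pox) -compA xal | rewrite nv].
Qed.

(** Salce's trick: pulling a sequence M -> J -> D back along an approximation
    X' -> D replaces the cokernel D by X' at the cost of enlarging J by Y'. *)
Lemma salce (M J D Y' X' : C) (i : hom M J) (p : hom J D) (j : hom Y' X')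
    (q : hom X' D) :
  short_exact i p -> short_exact j q -> 
  exists Q (i' : hom M Q) (p' : hom Q X') (j' : hom Y' Q) (q' : hom Q J),
    [/\ short_exact i' p', short_exact j' q' & q' ∘ i' = i].
Proof.
move=> s s'; have [Q [i' [p' [g [s1 gi [pb _]]]]]] := pull_ses ab q s.
have [j' [_ k]] := ker_pullback (pullback_sym pb) (proj1 s').
exists Q, i', p', j', g; split=> //; apply: (epi_ker_ses ab) => //.
exact: (epi_pullback ab pb (ses_epi s')).
Qed.

(** After pulling p back along g one looks for a section of an epimorphism P -> B
    with kernel K that extends a given map f' on A.  The quotient P / A is an
    extension of D = B / A by K, hence splits, and P is the pullback of P / A -> D
    and B -> D, so the splitting and the identity of B define the section. *)
Lemma orth_lifting (A B D X Y K : C) (i : hom A B) (c : hom B D) (j : hom K X) (p : hom X Y)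
    (f : hom A X) (g : hom B Y) :
  orth D K -> short_exact i c -> short_exact j p -> p ∘ f = g ∘ i ->
  exists h : hom B X, h ∘ i = f /\ p ∘ h = g.
Proof.
move=> o si sj e.
have [P [k [q [g' [sP gk [pb _]]]]]] := pull_ses ab g sj.
have [_ pbu] := pb.
have [f' [[f1 f2] _]] := pbu _ i f (esym e).
have mf : mono f' by move=> T u v /(congr1 (comp q)); rewrite !compA f1 => /(ses_mono si).
have [Q [r sr]] := al_coker ab mf.
have [t et] : exists t, t ∘ r = c ∘ q.
  by apply: (ses_cofact sr); rewrite -compA f1 (ses0 si).
have [[_ pbt] pot] := ses_mor_bicart_op ab sr si f1 (esym et).
have st : short_exact (r ∘ k) t.
  apply: (epi_ker_ses ab).
    by apply: (@epi_cancel C _ _ _ r); rewrite et; apply: epi_comp (ses_epi si); exact: ses_epi sP.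
  have pbs : pullback q r c t.
    exact: (pullback_sym (proj1 (ses_mor_bicart_op ab sr si f1 (esym et)))).
  exact: (pullback_ker pbs (proj1 sP)).
have [s es] := o _ _ _ st.
have h0 : t ∘ (s ∘ c) = c ∘ idm B by rewrite compA es comp1m compm1.
have [h [[h1 h2] _]] := pbt _ _ _ h0.
exists (g' ∘ h); split; last by have [eb _] := pb; rewrite compA -eb -compA h2 compm1.
have h3 : t ∘ (r ∘ f') = c ∘ (q ∘ f') by rewrite !compA et.
have [_ uq] := ex_uniq (pbt _ _ _ h3).
rewrite -compA -f2; congr (_ ∘ _); apply: uq; split=> //.
  by rewrite compA h1 -compA (ses0 si) comp_zero (ses0 sr).
by rewrite compA h2 comp1m f1.
Qed.

End OrthogonalityDuals.

(** * Special embeddings *)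
Section SpecialSequences.
Variables (C : zcategory) (ab : abelianlike C) (cX : obclass C).

Definition rorth : obclass C := fun N => forall X, cX X -> orth X N.

(** The special preenvelopes of relative homological algebra. *)
Definition special_emb M := exists (Y X : C) (i : hom M Y) (p : hom Y X),
  [/\ short_exact i p, rorth Y & cX X].

(** Suppose M embeds into an object J of the right class, but with a cokernel D
    that is not in cX.  An approximation of D corrects this. *)
Lemma special_emb_fix (M J D Y' X' : C) (i : hom M J) (p : hom J D) (j : hom Y' X')
    (q : hom X' D) : short_exact i p -> short_exact j q -> rorth J -> rorth Y' ->
  cX X' -> special_emb M.
Proof.
move=> s s' oJ oY cX'; have [Q [i' [p' [j' [q' [s1 s2 _]]]]]] := salce ab s s'.
exists Q, X', i', p'; split=> // X cXX.
by apply: (orth_extl ab s2); [apply: oY | apply: oJ].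
Qed.

Hypotheses (hker : forall (X X' K : C) (j : hom K X) (q : hom X X'),
    short_exact j q -> cX X -> cX X' -> cX K)
  (hext : forall (X X' K : C) (j : hom K X) (q : hom X X'),
    short_exact j q -> cX K -> cX X' -> cX X)
  (hepi : forall M : C, exists X (q : hom X M), epi q /\ cX X)
  (hmono : forall M : C, exists Y (j : hom M Y), mono j /\ rorth Y).

Lemma rorth_coker (N' N N'' : C) (i : hom N' N) (p : hom N N'') :
  short_exact i p -> rorth N' -> rorth N -> rorth N''.
Proof. by move=> s h1 h2; exact: (rperp_coker ab hker hepi s). Qed.

Lemma special_emb_ext (M1 M M2 : C) (a : hom M1 M) (b : hom M M2) : short_exact a b ->
  special_emb M1 -> special_emb M2 -> special_emb M.
Proof.
move=> s [Y1 [X1 [u1 [v1 [s1 o1 c1]]]]] [Y3 [X3 [u3 [v3 [s3 o3 c3]]]]].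
have [Y2 [X2 [m [n [m' [n' [u2 [v2 [sY sX s2 _ _]]]]]]]]] :=
  horseshoe ab (fun X Y cX' (oY : rorth Y) => oY X cX') rorth_coker hmono s s1 s3 o1 c3.
exists Y2, X2, u2, v2; split=> //; last exact: hext sX c1 c3.
by move=> X cX'; apply: (orth_extl ab sY); [apply: o1 | apply: o3].
Qed.

Lemma special_cover (M : C) : (forall M, special_emb M) ->
  exists Y X (i : hom Y X) (p : hom X M), [/\ short_exact i p, rorth Y & cX X].
Proof.
move=> h; have [X0 [q [eq c0]]] := hepi M; have [K [k sk]] := al_ker ab eq.
have [Y [X [i [p [s oY cX']]]]] := h K.
have [Q [i' [p' [j' [q' [s1 s2 _]]]]]] :=
  salce (abelianlike_op ab) (short_exact_op sk) (short_exact_op s).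
exists Y, Q, p', i'; split=> //; first exact: op_short_exact.
exact: hext (op_short_exact s2) c0 cX'.
Qed.
End SpecialSequences.

(** * Factorization and Hovey's model structure *)
Section FactorMono.
Variables (C : zcategory) (ab : abelianlike C).
Implicit Types X Y Z M N E K T : C.

Definition mono_coker_in (cX : obclass C) : morclass C := fun A B f =>
  exists K (p : hom B K), short_exact f p /\ cX K.

Definition epi_ker_in (cY : obclass C) : morclass C := fun A B f =>
  exists K (i : hom K A), short_exact i f /\ cY K.

(** Approximate the cokernel of f and pull back. *)
Lemma factor_mono (cX cY : obclass C) :
  (forall M, exists Y X (i : hom Y X) (p : hom X M), [/\ short_exact i p, cY Y & cX X]) ->
  forall A B (f : hom A B), mono f -> exists Z (i : hom A Z) (p : hom Z B),
    [/\ mono_coker_in cX i, epi_ker_in cY p & f = p ∘ i].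
Proof.
move=> h A B f mf; have [D [c sc]] := al_coker ab mf.
have [Y [X [j [q [s cy cx]]]]] := h D.
have [Q [i [p [j' [q' [s1 s2 e]]]]]] := salce ab sc s.
by exists Q, i, q'; split=> //; [exists X, p | exists Y, j'].
Qed.

Lemma epi_ker_in_comp (cY : obclass C) :
  (forall N1 N N2 (i : hom N1 N) (p : hom N N2), short_exact i p ->
     cY N1 -> cY N2 -> cY N) ->
  forall A B D (f : hom A B) (g : hom B D), epi_ker_in cY f -> epi_ker_in cY g ->
    epi_ker_in cY (g ∘ f).
Proof.
move=> hext A B D f g [K1 [k1 [s1 c1]]] [K2 [k2 [s2 c2]]].
have [E [i [p [h [s e [[pe pb] _]]]]]] := pull_ses ab k2 s1.
exists E, h; split; last exact: hext s c1 c2.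
apply: (epi_ker_ses ab); first exact: epi_comp (ses_epi s1) (ses_epi s2).
split; first by rewrite -compA -pe compA (ses0 s2) zero_comp.
move=> T t gft; have [u eu] : exists u, k2 ∘ u = f ∘ t.
  by apply: (ses_fact s2); rewrite compA.
have [w [[w1 w2] uq]] := pb _ _ _ eu.
exists w; split=> // w' ew'; apply: uq; split=> //.
by apply: (ses_mono s2); rewrite eu -ew' compA pe compA.
Qed.
End FactorMono.

Section Factorization.
Variables (C : zcategory) (ab : abelianlike C).
Implicit Types X Y Z M N E K T : C.

Lemma factor_epi (cX cY : obclass C) :
  (forall M, exists Y X (i : hom M Y) (p : hom Y X), [/\ short_exact i p, cY Y & cX X]) ->
  forall A B (f : hom A B), epi f -> exists Z (i : hom A Z) (p : hom Z B),
    [/\ mono_coker_in cX i, epi_ker_in cY p & f = p ∘ i].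
Proof.
move=> h A B f ef.
have h' : forall M : op C, exists (Y X : op C) (i : @hom (op C) Y X) (p : @hom (op C) X M),
    [/\ short_exact i p, cX Y & cY X].
  move=> M; have [Y [X [i [p [s cy cx]]]]] := h M.
  by exists X, Y, p, i; split=> //; exact: short_exact_op.
have [Z [i [p [[K [k [s1 c1]]] [K' [k' [s2 c2]]] e]]]] :=
  factor_mono (abelianlike_op ab) h' (ef : @mono (op C) B A f).
exists Z, p, i; split=> //.
- by exists K', k'; split=> //; exact: op_short_exact.
- by exists K, k; split=> //; exact: op_short_exact.
Qed.

(** Write f as the inclusion of A into its biproduct with B followed by (f, 1),
    which is an epimorphism.  Factor (f, 1) by the dual of [factor_mono], and then
    the monomorphism that goes from A to the middle term. *)
Lemma factor (cX cY : obclass C) : complete_pair cX cY ->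
  (forall N1 N N2 (i : hom N1 N) (p : hom N N2), short_exact i p ->
     cY N1 -> cY N2 -> cY N) -> factors (mono_coker_in cX) (epi_ker_in cY).
Proof.
move=> cpl hext A B f; have [b] := al_biprod ab A B.
have [q [[q1 q2] _]] := bcopair b f (idm B).
have mb : mono (bi1 b) := ses_mono (biprod_ses b).
have eq : epi q.
  by apply: (@epi_cancel C _ _ _ (bi2 b)); rewrite q2 => T u v; rewrite !compm1.
have [Z1 [j1 [p1 [cj1 cp1 e1]]]] := factor_epi (fun M => proj1 (cpl M)) eq.
have mj : mono (j1 ∘ bi1 b).
  by apply: mono_comp mb _; case: cj1 => K [k [/ses_mono]].
have [Z2 [j2 [p2 [cj2 cp2 e2]]]] := factor_mono ab (fun M => proj2 (cpl M)) mj.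
exists Z2, j2, (p1 ∘ p2); split=> //; first exact: epi_ker_in_comp.
by rewrite -compA -e2 compA -e1.
Qed.

Lemma mono_coker_in_retract (cX : obclass C) :
  (forall M M' (i : hom M M') (r : hom M' M), r ∘ i = idm M -> cX M' -> cX M) ->
  retract_closed (mono_coker_in cX).
Proof.
move=> hr X Y X' Y' f g [i [r [j [s [ri sj gi fr]]]]] [K' [p' [sg ck]]].
have mf : mono f.
  move=> T u v /(congr1 (comp j)); rewrite !compA -gi -!compA => /(ses_mono sg).
  by move/(congr1 (comp r)); rewrite !compA ri !comp1m.
have [K [p sf]] := al_coker ab mf.
exists K, p; split=> //.
have [a ea] : exists a, a ∘ p = p' ∘ j.
  by apply: (ses_cofact sf); rewrite -compA -gi compA (ses0 sg) zero_comp.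
have [b eb] : exists b, b ∘ p' = p ∘ s.
  by apply: (ses_cofact sg); rewrite -compA -fr compA (ses0 sf) zero_comp.
apply: (hr _ _ a b) ck; apply: (ses_epi sf).
by rewrite -compA ea compA eb -compA sj compm1 comp1m.
Qed.

End Factorization.

Section EpiRetracts.
Variables (C : zcategory) (ab : abelianlike C).
Implicit Types X Y Z M N E K T : C.

Lemma epi_ker_in_retract (cY : obclass C) :
  (forall M M' (i : hom M M') (r : hom M' M), r ∘ i = idm M -> cY M' -> cY M) ->
  retract_closed (epi_ker_in cY).
Proof.
move=> hr X Y X' Y' f g [i [r [j [s [ri sj gi fr]]]]] [K' [p' [sg ck]]].
have h : @mono_coker_in (op C) cY Y X f.
  apply: (@mono_coker_in_retract (op C) (abelianlike_op ab) cY _ Y X Y' X' f g).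
  - by move=> M M' i' r' e; apply: hr e.
  - by exists s, j, r, i; split.
  - by exists K', p'; split=> //; exact: short_exact_op.
by case: h => K [k [sk c]]; exists K, k; split=> //; exact: op_short_exact.
Qed.

Lemma ses_id_to0 X : short_exact (idm X) (to0 X).
Proof.
split; split.
- by rewrite (to0_uniq (to0 X ∘ _)) [RHS]to0_uniq.
- by move=> T g _; exists g; split; rewrite ?comp1m // => u; rewrite comp1m.
- by rewrite (to0_uniq (to0 X ∘ _)) [RHS]to0_uniq.
- move=> T g; rewrite compm1 => ->; exists (from0 T); split; first exact: zero_zob.
  by move=> u _; rewrite [RHS]from0_uniq.
Qed.
End EpiRetracts.

Section HoveyModel.
Variables (C : zcategory) (ab : abelianlike C).
Implicit Types X Y Z M N K T : C.

Lemma ses_from0_id X : short_exact (from0 X) (idm X).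
Proof. exact/op_short_exact/(@ses_id_to0 (op C)). Qed.

Lemma perp_orth (cX cY : obclass C) : cotorsion_pair cX cY ->
  (forall X, cX X <-> forall Y, cY Y -> orth X Y) /\
  (forall Y, cY Y <-> forall X, cX X -> orth X Y).
Proof.
move=> [h1 h2]; split=> M; rewrite -?h1 -?h2; split=> h K cK.
- exact/(Ext1P ab)/h.
- exact/(Ext1P ab)/h.
- exact/(Ext1P ab)/h.
- exact/(Ext1P ab)/h.
Qed.

Lemma ses_coker_uniq A B K K' (f : hom A B) (p : hom B K) (p' : hom B K') :
  is_cokernel f p -> is_cokernel f p' -> exists (i : hom K K') (r : hom K' K), r ∘ i = idm K.
Proof.
move=> c c'; have [a ea] := coker_fact c (proj1 c'); have [b eb] := coker_fact c' (proj1 c).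
by exists a, b; apply: (coker_epi c); rewrite -compA ea eb comp1m.
Qed.

Lemma ses_ker_uniq A B K K' (f : hom A B) (p : hom K A) (p' : hom K' A) :
  is_kernel f p -> is_kernel f p' -> exists (i : hom K K') (r : hom K' K), r ∘ i = idm K.
Proof.
move=> c c'; have [a ea] := ker_fact c (proj1 c'); have [b eb] := ker_fact c' (proj1 c).
by exists b, a; apply: (ker_mono c); rewrite compA ea eb compm1.
Qed.

Definition retract_closed_ob (c : obclass C) :=
  forall M M' (i : hom M M') (r : hom M' M), r ∘ i = idm M -> c M' -> c M.

Lemma cot_retract (cX cY : obclass C) : cotorsion_pair cX cY ->
  retract_closed_ob cX /\ retract_closed_ob cY.
Proof.
move=> /perp_orth[h1 h2]; split=> M M' i r e.
- by move=> /h1 h; apply/h1 => Y cY'; apply: (orth_retractl ab e); exact: h.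
- by move=> /h2 h; apply/h2 => Y cY'; apply: (orth_retractr ab e); exact: h.
Qed.

Lemma cot_ext (cX cY : obclass C) : cotorsion_pair cX cY ->
  forall N1 N N2 (i : hom N1 N) (p : hom N N2), short_exact i p ->
     cY N1 -> cY N2 -> cY N.
Proof.
move=> /perp_orth[h1 h2] N1 N N2 i p s /h2 a /h2 b; apply/h2 => X cX'.
by apply: (orth_extl ab s); [apply: a | apply: b].
Qed.

Variables (cU cV cX cY E : obclass C) (W : morclass C).
Hypotheses (cotUV : cotorsion_pair cU cV) (cplUV : complete_pair cU cV).
Hypotheses (cotXY : cotorsion_pair cX cY) (cplXY : complete_pair cX cY).
Hypotheses (XE : forall Z, cX Z <-> cU Z /\ E Z) (VE : forall Z, cV Z <-> cY Z /\ E Z).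
Hypotheses (W23 : two_of_three W) (Wr : retract_closed W) (E0 : E zob).
Hypotheses (WE_mono : forall X Y K (i : hom X Y) (p : hom Y K),
   short_exact i p -> (W i <-> E K)).
Hypotheses (WE_epi : forall X Y K (i : hom K X) (p : hom X Y),
   short_exact i p -> (W p <-> E K)).

Let cofm := mono_coker_in cU.
Let fibm := epi_ker_in cY.

Lemma tcofP X Y (f : hom X Y) : capm cofm W f <-> mono_coker_in cX f.
Proof.
split.
  by case=> -[K [p [s c]]] w; exists K, p; split=> //; apply/XE; split=> //; apply/(WE_mono s).
by case=> K [p [s /XE[c e]]]; split; [exists K, p | apply/(WE_mono s)].
Qed.

Lemma tfibP X Y (f : hom X Y) : capm fibm W f <-> epi_ker_in cV f.
Proof.
split.
  by case=> -[K [p [s c]]] w; exists K, p; split=> //; apply/VE; split=> //; apply/(WE_epi s).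
by case=> K [p [s /VE[c e]]]; split; [exists K, p | apply/(WE_epi s)].
Qed.

Lemma lifts_of_cot (c1 c2 : obclass C) : cotorsion_pair c1 c2 ->
  lifts (mono_coker_in c1) (epi_ker_in c2).
Proof.
move=> /perp_orth[h _] X Y X' Y' i p f g [K [c [s1 cK]]] [K' [j [s2 cK']]] e.
apply: (orth_lifting ab _ s1 s2 e); exact: (proj1 (h K)).
Qed.

(** The class W of weak equivalences is given in advance and linked to the trivial
    objects E by [WE_mono] and [WE_epi]; this spares constructing it from the two
    cotorsion pairs and proving two out of three abstractly. *)
Definition hovey_model : model_structure C.
Proof.
refine (@ModelStructure C W cofm fibm W23 Wr _ _ _ _ _ _).
- exact/(mono_coker_in_retract ab)/(proj1 (cot_retract cotUV)).
- exact/(epi_ker_in_retract ab)/(proj2 (cot_retract cotXY)).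
- by move=> X Y X' Y' i p f g /tcofP; exact: (lifts_of_cot cotXY).
- by move=> X Y X' Y' i p f g h /tfibP; exact: (lifts_of_cot cotUV) h.
- move=> X Y f; have [Z [i [p [h1 h2 e]]]] := factor ab cplXY (cot_ext cotXY) f.
  by exists Z, i, p; split=> //; apply/tcofP.
- move=> X Y f; have [Z [i [p [h1 h2 e]]]] := factor ab cplUV (cot_ext cotUV) f.
  by exists Z, i, p; split=> //; apply/tfibP.
Defined.

Lemma hovey_cofibrant X : cofibrant hovey_model X <-> cU X.
Proof.
split; last by exists X, (idm X); split=> //; exact: ses_from0_id.
case=> K [p [s c]].
have [i [r e]] := ses_coker_uniq (proj2 (ses_from0_id X)) (proj2 s).
exact: (proj1 (cot_retract cotUV)) e c.
Qed.

Lemma hovey_fibrant X : fibrant hovey_model X <-> cY X.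
Proof.
split; last by exists X, (idm X); split=> //; exact: ses_id_to0.
case=> K [p [s c]].
have [i [r e]] := ses_ker_uniq (proj1 (ses_id_to0 X)) (proj1 s).
exact: (proj2 (cot_retract cotXY)) e c.
Qed.

(** E X holds iff X -> 0 is in W, so by two out of three E is invariant along
    morphisms of W. *)
Lemma hovey_trivial X : trivial_ob hovey_model X <-> E X.
Proof.
have EW Z : E Z <-> W (to0 Z) by symmetry; exact: WE_epi (ses_id_to0 Z).
split=> [h|/EW w]; last by apply: rst_step; exists (to0 X).
suff : E X <-> E zob by case=> _; apply.
elim: {X} h => [X Y [f w]| | |] //.
- have e : to0 X = to0 Y ∘ f by rewrite [RHS]to0_uniq.
  have [h1 _ h3] := W23 f (to0 Y); rewrite !EW e; split=> h; last exact: h1.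
  by have [_ h2 _] := W23 f (to0 Y); apply: h2.
- by move=> X Y _ [? ?]; split.
- by move=> X Y Z _ [a b] _ [c d]; split=> ?; [apply/c/a | apply/b/d].
Qed.

Lemma hovey_abelian : abelian_model hovey_model.
Proof.
have cofE X Y (f : hom X Y) c : mono_coker_in c f <->
    mono f /\ exists K (p : hom Y K), is_cokernel f p /\ c K.
  split=> [[K [p [s ck]]] | [m [K [p [cp ck]]]]].
    by split; [exact: ses_mono s | exists K, p; split=> //; case: s].
  by exists K, p; split=> //; exact: mono_coker_ses.
have fibE X Y (f : hom X Y) c : epi_ker_in c f <->
    epi f /\ exists K (p : hom K X), is_kernel f p /\ c K.
  split=> [[K [p [s ck]]] | [m [K [p [cp ck]]]]].
    by split; [exact: ses_epi s | exists K, p; split=> //; case: s].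
  by exists K, p; split=> //; exact: epi_ker_ses.
move=> X Y f; split.
- apply: (iff_trans (cofE X Y f cU)); split=> -[m [K [p [cp ck]]]]; split=> //; exists K, p;
    by split=> //; apply/hovey_cofibrant.
- apply: (iff_trans (tcofP f)); apply: (iff_trans (cofE X Y f cX)); split=> -[m [K [p h]]]; split=> //; exists K, p; move: h.
    by case=> ? /XE[/hovey_cofibrant ? /hovey_trivial].
  by case=> ? /hovey_cofibrant ? /hovey_trivial ?; split=> //; apply/XE.
- apply: (iff_trans (fibE X Y f cY)); split=> -[m [K [p [cp ck]]]]; split=> //; exists K, p;
    by split=> //; apply/hovey_fibrant.
- apply: (iff_trans (tfibP f)); apply: (iff_trans (fibE X Y f cV)); split=> -[m [K [p h]]]; split=> //; exists K, p; move: h.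
    by case=> ? /VE[/hovey_fibrant ? /hovey_trivial].
  by case=> ? /hovey_fibrant ? /hovey_trivial ?; split=> //; apply/VE.
Qed.

End HoveyModel.

(** * Submodules, quotients, products and direct sums of modules *)
Section LinearTools.
Variable A : pzRingType.
Implicit Types U V W : lmodType A.

Definition mklin U V (f : U -> V) (h : linear f) : {linear U -> V} :=
  HB.pack f (GRing.isLinear.Build A U V *:%R f h).

(** Linear maps are mostly given by describing their values implicitly; the graph
    only has to be a functional linear relation. *)
Lemma linear_relation U V (R : U -> V -> Prop) :
  (forall u, exists v, R u v) -> (forall u v v', R u v -> R u v' -> v = v') ->
  (forall a u u' v v', R u v -> R u' v' -> R (a *: u + u') (a *: v + v')) ->
  exists f : {linear U -> V}, forall u, R u (f u).
Proof.
move=> tot fct lin; have [f hf] := choice tot.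
have fl : linear f by move=> a u u'; apply: (fct (a *: u + u')) => //; exact: lin.
by exists (mklin fl).
Qed.

Record submodule V := Submodule {
  sm_in :> V -> Prop;
  sm_0 : sm_in 0;
  sm_lin : forall a u v, sm_in u -> sm_in v -> sm_in (a *: u + v) }.

Section Sub.
Variables (V : lmodType A) (N : submodule V).

Lemma sm_D u v : N u -> N v -> N (u + v).
Proof. by move=> hu hv; rewrite -[u]scale1r; exact: sm_lin. Qed.
Lemma sm_Z a u : N u -> N (a *: u).
Proof. by move=> hu; rewrite -[_ *: _]addr0; apply: sm_lin => //; exact: sm_0. Qed.
Lemma sm_N u : N u -> N (- u).
Proof. by move=> hu; rewrite -scaleN1r; exact: sm_Z. Qed.

Definition sub_of := {v : V | N v}.
HB.instance Definition _ := gen_eqMixin sub_of.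
HB.instance Definition _ := gen_choiceMixin sub_of.

Lemma sub_inj : injective (sval : sub_of -> V).
Proof. by move=> [u hu] [v hv] /= e; subst v; congr exist; exact: Prop_irrelevance. Qed.

Definition sub_add (u v : sub_of) : sub_of := exist _ _ (sm_D (svalP u) (svalP v)).
Definition sub_opp (u : sub_of) : sub_of := exist _ _ (sm_N (svalP u)).
Definition sub_zero : sub_of := exist _ _ (sm_0 N).
Definition sub_scale a (u : sub_of) : sub_of := exist _ _ (sm_Z a (svalP u)).

Fact sub_addA : associative sub_add.
Proof. by move=> *; apply: sub_inj; rewrite /= addrA. Qed.
Fact sub_addC : commutative sub_add.
Proof. by move=> *; apply: sub_inj; rewrite /= addrC. Qed.
Fact sub_add0 : left_id sub_zero sub_add.
Proof. by move=> *; apply: sub_inj; rewrite /= add0r. Qed.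
Fact sub_addN : left_inverse sub_zero sub_opp sub_add.
Proof. by move=> *; apply: sub_inj; rewrite /= addNr. Qed.
HB.instance Definition _ := GRing.isZmodule.Build sub_of sub_addA sub_addC sub_add0 sub_addN.

Fact sub_scaleA a b v : sub_scale a (sub_scale b v) = sub_scale (a * b) v.
Proof. by apply: sub_inj; rewrite /= scalerA. Qed.
Fact sub_scale1 : left_id 1 sub_scale.
Proof. by move=> ?; apply: sub_inj; rewrite /= scale1r. Qed.
Fact sub_scaleDr : right_distributive sub_scale +%R.
Proof. by move=> *; apply: sub_inj; rewrite /= scalerDr. Qed.
Fact sub_scaleDl v : {morph sub_scale^~ v : a b / a + b}.
Proof. by move=> *; apply: sub_inj; rewrite /= scalerDl. Qed.
HB.instance Definition _ := GRing.Zmodule_isLmodule.Build A sub_of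
  sub_scaleA sub_scale1 sub_scaleDr sub_scaleDl.

Lemma submoduleP : exists (K : lmodType A) (i : {linear K -> V}),
  injective i /\ forall v, N v <-> exists k, v = i k.
Proof.
have h : linear (sval : sub_of -> V) by [].
exists sub_of, (mklin h); split; first exact: sub_inj.
by move=> v; split=> [hv|[[u hu] ->]] //; exists (exist _ v hv).
Qed.

(** A chosen representative of the class of x modulo N.  It only depends on the
    class because [choose] is extensional in the predicate; quotients are realised
    on the set of chosen representatives. *)
Definition canon (x : V) : V := choose (fun y => `[< N (x - y) >]) x.

Lemma canonP x : N (x - canon x).
Proof. by apply/asboolP/(@chooseP _ (fun y => `[< N (x - y) >])); rewrite subrr asboolT; [|exact: sm_0]. Qed.

Lemma canon_eq x y : N (x - y) <-> canon x = canon y.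
Proof.
split=> [h|e]; last first.
  have := sm_D (canonP x) (sm_N (canonP y)).
  by rewrite e opprB addrA subrK.
have h0 z : N (z - z) by rewrite subrr; exact: sm_0.
have Ne : (fun z => `[< N (x - z) >]) =1 (fun z => `[< N (y - z) >]).
  move=> z; apply/asbool_equiv_eq; split=> h'.
    by have := sm_D (sm_N h) h'; rewrite opprB addrA subrK.
  by have := sm_D h h'; rewrite addrA subrK.
rewrite /canon (eq_choose Ne); apply: (@choose_id _ (fun z => `[< N (y - z) >])).
  by rewrite asboolT // -opprB; exact: sm_N.
by rewrite asboolT.
Qed.

Definition quot_of := {x : V | canon x = x}.
HB.instance Definition _ := gen_eqMixin quot_of.
HB.instance Definition _ := gen_choiceMixin quot_of.

Lemma quot_inj : injective (sval : quot_of -> V).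
Proof. by move=> [u hu] [v hv] /= e; subst v; congr exist; exact: Prop_irrelevance. Qed.

Lemma canonK x : canon (canon x) = canon x.
Proof. by symmetry; apply/canon_eq/canonP. Qed.

Definition quot_proj (x : V) : quot_of := exist _ (canon x) (canonK x).

Lemma quot_projP x y : quot_proj x = quot_proj y <-> N (x - y).
Proof.
rewrite canon_eq; split=> [/(congr1 sval)//|e]; exact: quot_inj.
Qed.

Lemma quot_valK (x : quot_of) : quot_proj (sval x) = x.
Proof. by apply: quot_inj; case: x. Qed.

Lemma quot_ind (P : quot_of -> Prop) : (forall x, P (quot_proj x)) -> forall x, P x.
Proof. by move=> h x; rewrite -(quot_valK x). Qed.

Definition quot_add (u v : quot_of) : quot_of := quot_proj (sval u + sval v).
Definition quot_opp (u : quot_of) : quot_of := quot_proj (- sval u).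
Definition quot_scale a (u : quot_of) : quot_of := quot_proj (a *: sval u).

Lemma quot_addE x y : quot_add (quot_proj x) (quot_proj y) = quot_proj (x + y).
Proof.
apply/quot_projP => /=; rewrite opprD addrACA -opprB -[X in _ + X]opprB -opprD.
by apply/sm_N/sm_D; exact: canonP.
Qed.
Lemma quot_oppE x : quot_opp (quot_proj x) = quot_proj (- x).
Proof. by apply/quot_projP => /=; rewrite opprK addrC; exact: canonP. Qed.
Lemma quot_scaleE a x : quot_scale a (quot_proj x) = quot_proj (a *: x).
Proof.
by apply/quot_projP => /=; rewrite -scalerBr -opprB scalerN; apply/sm_N/sm_Z/canonP.
Qed.

Fact quot_addA : associative quot_add.
Proof. by do 3![elim/quot_ind=> ?]; rewrite !quot_addE addrA. Qed.
Fact quot_addC : commutative quot_add.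
Proof. by do 2![elim/quot_ind=> ?]; rewrite !quot_addE addrC. Qed.
Fact quot_add0 : left_id (quot_proj 0) quot_add.
Proof. by elim/quot_ind=> ?; rewrite !quot_addE add0r. Qed.
Fact quot_addN : left_inverse (quot_proj 0) quot_opp quot_add.
Proof. by elim/quot_ind=> ?; rewrite quot_oppE quot_addE addNr. Qed.
HB.instance Definition _ := GRing.isZmodule.Build quot_of quot_addA quot_addC quot_add0 quot_addN.

Fact quot_scaleA a b v : quot_scale a (quot_scale b v) = quot_scale (a * b) v.
Proof. by elim/quot_ind: v => ?; rewrite !quot_scaleE scalerA. Qed.
Fact quot_scale1 : left_id 1 quot_scale.
Proof. by elim/quot_ind=> ?; rewrite quot_scaleE scale1r. Qed.
Fact quot_scaleDr : right_distributive quot_scale +%R.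
Proof.
move=> a; do 2![elim/quot_ind=> ?]; rewrite [in LHS]/+%R /=.
by rewrite quot_addE !quot_scaleE scalerDr [RHS]quot_addE.
Qed.
Fact quot_scaleDl v : {morph quot_scale^~ v : a b / a + b}.
Proof. by elim/quot_ind: v => ? a b; rewrite !quot_scaleE scalerDl [RHS]quot_addE. Qed.
HB.instance Definition _ := GRing.Zmodule_isLmodule.Build A quot_of
  quot_scaleA quot_scale1 quot_scaleDr quot_scaleDl.

Lemma quotientP : exists (Q : lmodType A) (p : {linear V -> Q}),
  (forall q, exists v, p v = q) /\ forall v, p v = 0 <-> N v.
Proof.
have h : linear quot_proj.
  by move=> a u v; rewrite -[LHS]quot_addE -quot_scaleE.
exists quot_of, (mklin h); split.
  by elim/quot_ind=> v; exists v.
by move=> v; rewrite -[X in N X]subr0; exact: quot_projP.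
Qed.
End Sub.

Section Product.
Variable V : nat -> lmodType A.

Definition prod_of := forall i, V i.
HB.instance Definition _ := gen_eqMixin prod_of.
HB.instance Definition _ := gen_choiceMixin prod_of.

Definition prod_add (u v : prod_of) : prod_of := fun i => u i + v i.
Definition prod_opp (u : prod_of) : prod_of := fun i => - u i.
Definition prod_zero : prod_of := fun i => 0.
Definition prod_scale a (u : prod_of) : prod_of := fun i => a *: u i.

Fact prod_addA : associative prod_add.
Proof. by move=> *; apply: functional_extensionality_dep => i; exact: addrA. Qed.
Fact prod_addC : commutative prod_add.
Proof. by move=> *; apply: functional_extensionality_dep => i; exact: addrC. Qed.
Fact prod_add0 : left_id prod_zero prod_add.
Proof. by move=> *; apply: functional_extensionality_dep => i; exact: add0r. Qed.
Fact prod_addN : left_inverse prod_zero prod_opp prod_add.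
Proof. by move=> *; apply: functional_extensionality_dep => i; exact: addNr. Qed.
HB.instance Definition _ := GRing.isZmodule.Build prod_of prod_addA prod_addC prod_add0 prod_addN.

Fact prod_scaleA a b v : prod_scale a (prod_scale b v) = prod_scale (a * b) v.
Proof. by apply: functional_extensionality_dep => i; exact: scalerA. Qed.
Fact prod_scale1 : left_id 1 prod_scale.
Proof. by move=> ?; apply: functional_extensionality_dep => i; exact: scale1r. Qed.
Fact prod_scaleDr : right_distributive prod_scale +%R.
Proof. by move=> *; apply: functional_extensionality_dep => i; exact: scalerDr. Qed.
Fact prod_scaleDl v : {morph prod_scale^~ v : a b / a + b}.
Proof. by move=> *; apply: functional_extensionality_dep => i; exact: scalerDl. Qed.
HB.instance Definition _ := GRing.Zmodule_isLmodule.Build A prod_of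
  prod_scaleA prod_scale1 prod_scaleDr prod_scaleDl.

Lemma productP : exists (P : lmodType A) (pr : forall i, {linear P -> V i}),
  (forall x y, (forall i, pr i x = pr i y) -> x = y) /\
  (forall x : forall i, V i, exists p, forall i, pr i p = x i).
Proof.
have h i : linear (fun x : prod_of => x i) by [].
exists prod_of, (fun i => mklin (h i)); split.
  by move=> x y e; apply: functional_extensionality_dep.
by move=> x; exists x.
Qed.
End Product.

(** The direct sum, described by coordinates: sequences that are eventually zero. *)
Lemma directsumP (V : nat -> lmodType A) :
  exists (S : lmodType A) (pr : forall i, {linear S -> V i}),
  [/\ forall x y, (forall i, pr i x = pr i y) -> x = y,
      forall x, exists n, forall i, (n <= i)%N -> pr i x = 0
    & forall x : forall i, V i, (exists n, forall i, (n <= i)%N -> x i = 0) ->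
        exists s, forall i, pr i s = x i].
Proof.
have [P [pr [inj sur]]] := productP V.
pose N (x : P) := exists n, forall i, (n <= i)%N -> pr i x = 0.
have N0 : N 0 by exists 0%N => i _; rewrite linear0.
have NL a u v : N u -> N v -> N (a *: u + v).
  move=> [m hm] [n hn]; exists (maxn m n) => i; rewrite geq_max => /andP[? ?].
  by rewrite linearP hm // hn // scaler0 addr0.
have [S [s [sinj hs]]] := submoduleP (Submodule N0 NL).
have hl i : linear (pr i \o s) by move=> a u v; rewrite /= !linearP.
exists S, (fun i => mklin (hl i)); split=> [x y e|x|x [n hn]].
- exact/sinj/inj.
- by apply/(hs (s x)); exists x.
- have [p hp] := sur x; have /hs[k ek] : N p by exists n => i /hn; rewrite hp.
  by exists k => i; rewrite -hp ek.
Qed.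

End LinearTools.

(** * From elements to the axiomatic setting *)
Section Concrete.
Variable A : pzRingType.
Local Open Scope cat_scope.

Definition lin_exact (U V W : lmodType A) (i : U -> V) (p : V -> W) : Prop :=
  [/\ injective i, forall w, exists v, p v = w
    & forall v, p v = 0 <-> exists u, v = i u].

(** A faithful underlying-module functor with enough structure to chase elements:
    morphisms can be subtracted, kernels, cokernels and biproducts are computed on
    underlying modules, and linear maps through which a morphism factors along an
    injection or a surjection are themselves morphisms.  Modules and differential
    modules both satisfy this. *)
Record concrete (C : zcategory) := Concrete {
  car : C -> lmodType A;
  fn : forall X Y : C, hom X Y -> {linear car X -> car Y};
  fn_inj : forall (X Y : C) (f g : hom X Y), fn f =1 fn g -> f = g;
  fn_id : forall (X : C) x, fn (idm X) x = x;
  fn_comp : forall (X Y Z : C) (g : hom Y Z) (f : hom X Y) x,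
    fn (g ∘ f) x = fn g (fn f x);
  fn_zero : forall (X Y : C) x, fn (zero_mor X Y) x = 0;
  fn_sub : forall (X Y : C) (f g : hom X Y), exists h : hom X Y,
    forall x, fn h x = fn f x - fn g x;
  cc_ker : forall (X Y : C) (f : hom X Y), exists K (i : hom K X),
    injective (fn i) /\ forall x, fn f x = 0 <-> exists k, x = fn i k;
  cc_coker : forall (X Y : C) (f : hom X Y), exists K (p : hom Y K),
    (forall k, exists y, fn p y = k) /\ forall y, fn p y = 0 <-> exists x, y = fn f x;
  cc_lift : forall (K X T : C) (i : hom K X) (g : hom T X) (h : {linear car T -> car K}),
    injective (fn i) -> (forall t, fn i (h t) = fn g t) -> exists h', fn h' =1 h;
  cc_desc : forall (K X T : C) (p : hom X K) (g : hom X T) (h : {linear car K -> car T}),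
    (forall k, exists x, fn p x = k) -> (forall x, h (fn p x) = fn g x) ->
    exists h', fn h' =1 h;
  cc_bip : forall N M : C, exists B (i1 : hom N B) (i2 : hom M B) (p1 : hom B N) (p2 : hom B M),
    [/\ p1 ∘ i1 = idm N, p2 ∘ i2 = idm M, p1 ∘ i2 = zero_mor M N,
        p2 ∘ i1 = zero_mor N M & forall b, b = fn i1 (fn p1 b) + fn i2 (fn p2 b)] }.

Section Theory.
Variables (C : zcategory) (cc : concrete C).
Implicit Types X Y Z M N E K T : C.
Local Notation fn := (fn cc).

Lemma fn_add X Y (f g : hom X Y) : exists h : hom X Y, forall x, fn h x = fn f x + fn g x.
Proof.
have [g' eg] := fn_sub cc (zero_mor X Y) g; have [h eh] := fn_sub cc f g'.
by exists h => x; rewrite eh eg fn_zero sub0r opprK.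
Qed.

Lemma mono_injP X Y (f : hom X Y) : mono f <-> injective (fn f).
Proof.
split=> [mf x y e | fi T u v e]; last first.
  by apply: (fn_inj (c := cc)) => t; apply: fi; rewrite -!fn_comp e.
have [K [i [ii hi]]] := cc_ker cc f.
have e0 : i = zero_mor K X.
  apply: mf; apply: (fn_inj (c := cc)) => k; rewrite comp_zero fn_zero fn_comp.
  by apply/hi; exists k.
have /hi[k] : fn f (x - y) = 0 by rewrite linearB e subrr.
by rewrite e0 fn_zero => /eqP; rewrite subr_eq0 => /eqP.
Qed.

Lemma epi_surjP X Y (f : hom X Y) : epi f <-> forall y, exists x, fn f x = y.
Proof.
split=> [mf y | fs T u v e]; last first.
  by apply: (fn_inj (c := cc)) => y; have [x <-] := fs y; rewrite -!fn_comp e.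
have [K [p [ps hp]]] := cc_coker cc f.
have e0 : p = zero_mor Y K.
  apply: mf; apply: (fn_inj (c := cc)) => x; rewrite zero_comp fn_zero fn_comp.
  by apply/hp; exists x.
by have /hp[x ->] : fn p y = 0; [rewrite e0 fn_zero | exists x].
Qed.

Lemma lift_inj K X T (i : hom K X) (g : hom T X) : injective (fn i) ->
  (forall t, exists k, fn g t = fn i k) -> exists h : hom T K, i ∘ h = g.
Proof.
move=> ii h; have [f ef] : exists f : {linear car cc T -> car cc K}, forall t, fn g t = fn i (f t).
  apply: linear_relation (h) _ _.
  - by move=> t k k' -> /ii.
  - by move=> a t t' k k' e e'; rewrite !linearP e e'.
have [h' eh] := cc_lift (c := cc) ii (fun t => esym (ef t)).
by exists h'; apply: (fn_inj (c := cc)) => t; rewrite fn_comp eh -ef.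
Qed.

Lemma desc_surj K X T (p : hom X K) (g : hom X T) : (forall k, exists x, fn p x = k) ->
  (forall x, fn p x = 0 -> fn g x = 0) -> exists h : hom K T, h ∘ p = g.
Proof.
move=> ps h; have [f ef] : exists f : {linear car cc K -> car cc T},
    forall k, exists2 x, fn p x = k & fn g x = f k.
  apply: (linear_relation (R := fun k t => exists2 x, fn p x = k & fn g x = t)).
  - by move=> k; have [x ex] := ps k; exists (fn g x); exists x.
  - move=> k t t' [x ex <-] [y ey <-]; apply/eqP; rewrite -subr_eq0 -linearB; apply/eqP/h.
    by rewrite linearB ex ey subrr.
  - by move=> a k k' t t' [x <- <-] [y <- <-]; exists (a *: x + y); rewrite linearP.
have e x : f (fn p x) = fn g x.
  have [y ey <-] := ef (fn p x); apply/eqP; rewrite -subr_eq0 -linearB; apply/eqP/h.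
  by rewrite linearB ey subrr.
have [h' eh] := cc_desc (c := cc) ps e.
by exists h'; apply: (fn_inj (c := cc)) => x; rewrite fn_comp eh.
Qed.

(** Kernels in the sense of universal properties are compared with elements by
    testing against the kernel object provided by [cc_ker]. *)
Lemma sesP N E M (i : hom N E) (p : hom E M) : short_exact i p <-> lin_exact (fn i) (fn p).
Proof.
split=> [s | [ii ps ex]].
  have /mono_injP ii := ses_mono s; have /epi_surjP ps := ses_epi s.
  split=> // v; split=> [pv | [u ->]]; last by rewrite -fn_comp (ses0 s) fn_zero.
  have [K [j [ji hj]]] := cc_ker cc p.
  have [u eu] : exists u, i ∘ u = j.
    apply: (ses_fact s); apply: (fn_inj (c := cc)) => k; rewrite fn_comp fn_zero.
    by apply/hj; exists k.
  by have /hj[k ->] := pv; exists (fn u k); rewrite -fn_comp eu.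
have pi0 : p ∘ i = zero_mor N M.
  by apply: (fn_inj (c := cc)) => n; rewrite fn_comp fn_zero; apply/ex; exists n.
split; split=> // T g eg.
- have [h eh] : exists h, i ∘ h = g.
    by apply: lift_inj => // t; apply/ex; rewrite -fn_comp eg fn_zero.
  exists h; split=> // h' eh'; have /mono_injP mi := ii; apply: mi.
  by rewrite eh.
- have [h eh] : exists h, h ∘ p = g.
    by apply: desc_surj => // x /ex[n ->]; rewrite -fn_comp eg fn_zero.
  exists h; split=> // h' eh'; have /epi_surjP mi := ps; apply: mi.
  by rewrite eh.
Qed.

Lemma concrete_biproduct N M : exists b : biproduct N M,
  forall x, x = fn (bi1 b) (fn (bp1 b) x) + fn (bi2 b) (fn (bp2 b) x).
Proof.
have [B [i1 [i2 [p1 [p2 [e11 e22 e12 e21 eb]]]]]] := cc_bip cc N M.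
have h1 T (u : hom T N) (v : hom T M) : exists! w : hom T B, p1 ∘ w = u /\ p2 ∘ w = v.
  have [w ew] := fn_add (i1 ∘ u) (i2 ∘ v).
  exists w; split; [split; apply: (fn_inj (c := cc)) => t |].
  - by rewrite fn_comp ew linearD -!fn_comp !compA e11 e12 comp1m zero_comp fn_zero addr0.
  - by rewrite fn_comp ew linearD -!fn_comp !compA e21 e22 comp1m zero_comp fn_zero add0r.
  - move=> w' [h h']; apply: (fn_inj (c := cc)) => t.
    by rewrite [RHS]eb ew !fn_comp -h -h' !fn_comp.
have h2 T (u : hom N T) (v : hom M T) : exists! w : hom B T, w ∘ i1 = u /\ w ∘ i2 = v.
  have [w ew] := fn_add (u ∘ p1) (v ∘ p2).
  exists w; split; [split; apply: (fn_inj (c := cc)) => t |].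
  - by rewrite fn_comp ew -!fn_comp -!compA e11 e21 compm1 comp_zero fn_zero addr0.
  - by rewrite fn_comp ew -!fn_comp -!compA e12 e22 compm1 comp_zero fn_zero add0r.
  - move=> w' [h h']; apply: (fn_inj (c := cc)) => b.
    by rewrite [in RHS](eb b) linearD ew !fn_comp -h -h' !fn_comp.
by exists (@Biproduct C N M B i1 i2 p1 p2 e11 e22 e12 e21 h1 h2).
Qed.

Lemma fn_bip N M (b : biproduct N M) :
  ((forall x, fn (bp1 b) (fn (bi1 b) x) = x) * (forall x, fn (bp2 b) (fn (bi2 b) x) = x)) *
  ((forall x, fn (bp1 b) (fn (bi2 b) x) = 0) * (forall x, fn (bp2 b) (fn (bi1 b) x) = 0)).
Proof.
by split; split=> x; rewrite -fn_comp ?bp1i1 ?bp2i2 ?bp1i2 ?bp2i1 ?fn_id ?fn_zero.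
Qed.

(** The pullback is the kernel P of f - g on the biproduct.  It is also a pushout:
    g being surjective, a map out of Z is defined through Y, and the pairs (0, y)
    of P show that it is well defined. *)
Lemma concrete_pull X Y Z (f : hom X Z) (g : hom Y Z) : epi g ->
  exists P (a : hom P X) (b : hom P Y), bicart a b f g /\ epi a.
Proof.
move=> /epi_surjP gs; have [B eB] := concrete_biproduct X Y.
have [h eh] := fn_sub cc (f ∘ bp1 B) (g ∘ bp2 B).
have [P [k [ki hk]]] := cc_ker cc h.
have P_of x y : fn f x = fn g y -> exists p, fn (bp1 B ∘ k) p = x /\ fn (bp2 B ∘ k) p = y.
  move=> e; have /hk[p ep] : fn h (fn (bi1 B) x + fn (bi2 B) y) = 0.
    by rewrite eh !fn_comp !linearD !fn_bip !linear0 addr0 add0r e subrr.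
  by exists p; rewrite !fn_comp -ep !linearD !fn_bip addr0 add0r.
have e : f ∘ (bp1 B ∘ k) = g ∘ (bp2 B ∘ k).
  apply: (fn_inj (c := cc)) => p; apply/eqP; rewrite -subr_eq0 !compA !(fn_comp _ k) -eh.
  by apply/eqP/hk; exists p.
have jinj p q : fn (bp1 B ∘ k) p = fn (bp1 B ∘ k) q ->
    fn (bp2 B ∘ k) p = fn (bp2 B ∘ k) q -> p = q.
  by rewrite !fn_comp => e1 e2; apply: ki; rewrite [LHS]eB e1 e2 -eB.
exists P, (bp1 B ∘ k), (bp2 B ∘ k); split; last first.
  by apply/epi_surjP => x; have [y /esym/P_of[p [e1 _]]] := gs (fn f x); exists p.
split; split=> // T u v uv.
- have [[w [w1 w2]] _] := ex_uniq (bpair B u v).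
  have [z ez] : exists z, k ∘ z = w.
    apply: lift_inj => // t; apply/hk; rewrite eh -!fn_comp -!compA w1 w2 uv.
    exact: subrr.
  exists z; split; first by rewrite -!compA ez.
  move=> z' [h1 h2]; apply: (fn_inj (c := cc)) => t; apply: jinj; rewrite -!(fn_comp _ _ t).
    by rewrite h1 -compA ez w1.
  by rewrite h2 -compA ez w2.
- have [w ew] : exists w, w ∘ g = v.
    apply: desc_surj => // y gy.
    have [p [p1 p2]] : exists p, fn (bp1 B ∘ k) p = 0 /\ fn (bp2 B ∘ k) p = y.
      by apply: P_of; rewrite linear0 gy.
    by rewrite -p2 -fn_comp -uv fn_comp p1 linear0.
  exists w; split; last by move=> w' [_ h2]; have /epi_surjP eg := gs; apply: eg; rewrite ew h2.
  split=> //; apply: (fn_inj (c := cc)) => x.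
  have [y /esym exy] := gs (fn f x); have [p [p1 p2]] := P_of _ _ exy.
  by rewrite fn_comp exy -fn_comp ew -p1 -p2 -!(fn_comp _ _ p) uv.
Qed.

(** The pushout is the cokernel Z of (a, -b).  It is also a pullback: elements of X
    and Y with the same image in Z come from some p in P, and p is unique since a
    is injective. *)
Lemma concrete_push P X Y (a : hom P X) (b : hom P Y) : mono a ->
  exists Z (f : hom X Z) (g : hom Y Z), bicart a b f g /\ mono g.
Proof.
move=> ma; have /mono_injP ai := ma; have [B eB] := concrete_biproduct X Y.
have [h eh] := fn_sub cc (bi1 B ∘ a) (bi2 B ∘ b).
have [Z [q [qs hq]]] := cc_coker cc h.
have bE x y : (fn (bp1 B) (fn (bi1 B) x - fn (bi2 B) y) = x) *
    (fn (bp2 B) (fn (bi1 B) x - fn (bi2 B) y) = - y).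
  by rewrite !linearB !fn_bip subr0 sub0r.
have qE x y : fn (q ∘ bi1 B) x = fn (q ∘ bi2 B) y -> exists p, x = fn a p /\ y = fn b p.
  move=> /eqP; rewrite -subr_eq0 !fn_comp -linearB => /eqP/hq[p].
  rewrite eh !fn_comp => ep; exists p; split.
    by rewrite -(bE x y).1 ep (bE _ _).1.
  by apply: oppr_inj; rewrite -(bE x y).2 ep (bE _ _).2.
have e : (q ∘ bi1 B) ∘ a = (q ∘ bi2 B) ∘ b.
  apply: (fn_inj (c := cc)) => p; apply/eqP; rewrite -subr_eq0 -!compA !(fn_comp q) -linearB -eh.
  by apply/eqP/hq; exists p.
exists Z, (q ∘ bi1 B), (q ∘ bi2 B); split; last first.
  apply/mono_injP => y y' eyy; apply/eqP; rewrite -subr_eq0; apply/eqP.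
  have [p [p1 ->]] : exists p, 0 = fn a p /\ y - y' = fn b p.
    by apply: qE; rewrite linear0 linearB eyy subrr.
  by rewrite (_ : p = 0) ?linear0 //; apply: ai; rewrite -p1 linear0.
split; split=> // T u v uv.
- have [w ew] : exists w, a ∘ w = u.
    apply: lift_inj => // t.
    have [p [-> _]] : exists p, fn u t = fn a p /\ fn v t = fn b p.
      by apply: qE; rewrite -!(fn_comp _ _ t) uv.
    by exists p.
  exists w; split; last by move=> w' [h1 _]; apply: ma; rewrite ew h1.
  split=> //; apply: (fn_inj (c := cc)) => t.
  have [p [p1 p2]] : exists p, fn u t = fn a p /\ fn v t = fn b p.
    by apply: qE; rewrite -!(fn_comp _ _ t) uv.
  by rewrite fn_comp p2; congr (fn b _); apply: ai; rewrite -fn_comp ew p1.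
- have [[w [w1 w2]] _] := ex_uniq (bcopair B u v).
  have [z ez] : exists z, z ∘ q = w.
    apply: desc_surj => // x /hq[p ->].
    by rewrite eh linearB -!fn_comp !compA w1 w2 uv subrr.
  exists z; split; first by rewrite !compA ez.
  have /epi_surjP eq := qs; move=> z' [h1 h2]; apply: eq; rewrite ez.
  have [_ uq] := ex_uniq (bcopair B u v); apply: uq => //.
  by rewrite -!compA.
Qed.

Lemma concrete_abelianlike : abelianlike C.
Proof.
split.
- move=> X Y f mf; have [K [p [ps hp]]] := cc_coker cc f.
  by exists K, p; apply/sesP; split=> //; apply/mono_injP.
- move=> X Y f mf; have [K [p [ps hp]]] := cc_ker cc f.
  by exists K, p; apply/sesP; split=> //; apply/epi_surjP.
- exact: concrete_pull.
- exact: concrete_push.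
- move=> N E E' M i p i' p' u /sesP[ii ps ex] /sesP[ii' ps' ex'] ui pu.
  have uinj : injective (fn u).
    move=> x y e; apply/eqP; rewrite -subr_eq0; apply/eqP.
    have e0 : fn u (x - y) = 0 by rewrite linearB e subrr.
    have /ex[n en] : fn p (x - y) = 0 by rewrite -pu fn_comp e0 linear0.
    move: e0; rewrite en -fn_comp ui -(linear0 (fn i')) => /ii' ->.
    exact: linear0.
  have usurj y : exists x, fn u x = y.
    have [x ex0] := ps (fn p' y).
    have /ex'[n en] : fn p' (y - fn u x) = 0.
      by rewrite linearB -fn_comp pu ex0 subrr.
    by exists (fn i n + x); rewrite linearD -fn_comp ui -en subrK.
  have [v ev] : exists v, u ∘ v = idm E'.
    by apply: lift_inj => // y; have [x <-] := usurj y; exists x; rewrite fn_id.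
  exists v; split=> //; apply: (fn_inj (c := cc)) => x; apply: uinj.
  by rewrite -!(fn_comp _ _ x) compA ev comp1m compm1.
- by move=> N M; have [b _] := concrete_biproduct N M.
- move=> N E M i p /sesP[ii ps ex]; split=> -[s es].
    have [h eh] := fn_sub cc (idm E) (s ∘ p).
    have [r er] : exists r, i ∘ r = h.
      apply: lift_inj => // t; apply/ex; rewrite eh linearB -!fn_comp compA es comp1m compm1.
      exact: subrr.
    exists r; apply: (fn_inj (c := cc)) => n; apply: ii.
    rewrite -!(fn_comp _ _ n) compA er compm1 fn_comp eh fn_id !fn_comp.
    have /ex-> : exists u, fn i n = fn i u by exists n.
    by rewrite linear0 subr0.
  have [h eh] := fn_sub cc (idm E) (i ∘ s).
  have [r er] : exists r, r ∘ p = h.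
    apply: desc_surj => // x /ex[n ->].
    by rewrite eh fn_id -!fn_comp -compA es compm1 subrr.
  exists r; apply: (fn_inj (c := cc)) => m; have [x <-] := ps m.
  rewrite -!(fn_comp _ _ x) -compA er comp1m fn_comp eh fn_id linearB fn_comp.
  have /ex-> : exists u, fn i (fn s x) = fn i u by exists (fn s x).
  by rewrite subr0.
Qed.
End Theory.
End Concrete.

(** * Modules and differential modules *)
Section Instances.
Variable A : pzRingType.
Implicit Types U V W : lmodType A.

Lemma ker_closed U V (f : {linear U -> V}) :
  (f 0 = 0) /\ (forall a u v, f u = 0 -> f v = 0 -> f (a *: u + v) = 0).
Proof.
by split; [rewrite linear0 | move=> a u v e1 e2; rewrite linearP e1 e2 scaler0 addr0].
Qed.

Definition ker_sub U V (f : {linear U -> V}) : submodule U :=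
  Submodule (sm_in := fun u => f u = 0) (proj1 (ker_closed f)) (proj2 (ker_closed f)).

Lemma im_closed U V (f : {linear U -> V}) :
  (exists u, 0 = f u) /\
  (forall a v w, (exists u, v = f u) -> (exists u, w = f u) -> exists u, a *: v + w = f u).
Proof.
split; first by exists 0; rewrite linear0.
by move=> a v w [u ->] [u' ->]; exists (a *: u + u'); rewrite linearP.
Qed.

Definition im_sub U V (f : {linear U -> V}) : submodule V :=
  Submodule (sm_in := fun v => exists u, v = f u) (proj1 (im_closed f)) (proj2 (im_closed f)).

Lemma fst_lin U V : linear (fst : (U * V)%type -> U). Proof. by []. Qed.
Lemma snd_lin U V : linear (snd : (U * V)%type -> V). Proof. by []. Qed.
Lemma inl_lin U V : linear (fun u => (u, 0) : (U * V)%type).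
Proof. by move=> a u v; congr pair; rewrite /= scaler0 addr0. Qed.
Lemma inr_lin U V : linear (fun v => (0, v) : (U * V)%type).
Proof. by move=> a u v; congr pair; rewrite /= scaler0 addr0. Qed.

Lemma pairDE U V (x : U * V) : x = (x.1, 0) + (0, x.2).
Proof. by case: x => u v; congr pair; rewrite /= ?addr0 ?add0r. Qed.

Definition Mod_concrete : concrete A (Mod A).
Proof.
refine (@Concrete A (Mod A) (fun V => V) (fun U V f => f) _ _ _ _ _ _ _ _ _ _).
- by move=> U V f g e; exact: linear_ext.
- by [].
- by [].
- by [].
- move=> U V f g; have h : linear (fun x => f x - g x).
    by move=> a x y; rewrite [f _]linearP [g _]linearP scalerBr opprD addrACA.
  by exists (mklin h).
- move=> U V f; have [K [i [ii hi]]] := submoduleP (ker_sub f).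
  by exists K, i.
- move=> U V f; have [K [i [ii hi]]] := quotientP (im_sub f).
  by exists K, i.
- by move=> K X T i g h _ _; exists h.
- by move=> K X T i g h _ _; exists h.
- move=> N M; exists (N * M : lmodType A)%type.
  exists (mklin (@inl_lin N M)), (mklin (@inr_lin N M)), (mklin (@fst_lin N M)), (mklin (@snd_lin N M)).
  by split; try (exact: linear_ext); exact: pairDE.
Defined.

Definition ModA : abelianlike (Mod A) := concrete_abelianlike Mod_concrete.

Lemma dif_pairP (N M : difmod A) : linear (fun x : N * M => (dif N x.1, dif M x.2)).
Proof. by move=> a x y; congr pair; rewrite /= linearP. Qed.

Lemma dif_pairK (N M : difmod A) (x : N * M) : mklin (@dif_pairP N M) (mklin (@dif_pairP N M) x) = 0.
Proof. by rewrite /= !difK. Qed.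

Definition dif_pair (N M : difmod A) : difmod A := DifMod (@dif_pairK N M).

Definition Dif_concrete : concrete A (Dif A).
Proof.
refine (@Concrete A (Dif A) (fun X => dmod X) (fun X Y f => dhom f) _ _ _ _ _ _ _ _ _ _).
- by move=> U V f g e; exact: difhom_ext.
- by [].
- by [].
- by [].
- move=> U V f g; have h : linear (fun x => dhom f x - dhom g x).
    by move=> a x y; rewrite [dhom f _]linearP [dhom g _]linearP scalerBr opprD addrACA.
  have hd x : mklin h (dif U x) = dif V (mklin h x) by rewrite /= !dhomC -linearB.
  by exists (DifHom hd).
- move=> U V f; have [K [i [ii hi]]] := submoduleP (ker_sub (dhom f)).
  have [d ed] : exists d : {linear K -> K}, forall k, dif U (i k) = i (d k).
    apply: (linear_relation (R := fun k l => dif U (i k) = i l)).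
    + move=> k; apply/hi; rewrite /= dhomC; have -> : dhom f (i k) = 0 by apply/hi; exists k.
      by rewrite linear0.
    + by move=> k k1 k2 -> /ii.
    + by move=> a k k1 l l1 e e1; rewrite !linearP e e1.
  have dd k : d (d k) = 0 by apply: ii; rewrite -!ed difK linear0.
  by exists (DifMod dd), (@DifHom _ (DifMod dd) U i (fun k => esym (ed k))).
- move=> U V f; have [Q [p [ps hp]]] := quotientP (im_sub (dhom f)).
  have [d ed] : exists d : {linear Q -> Q}, forall q, exists2 v, p v = q & p (dif V v) = d q.
    apply: (linear_relation (R := fun q r => exists2 v, p v = q & p (dif V v) = r)).
    + by move=> q; have [v <-] := ps q; exists (p (dif V v)), v.
    + move=> q r r' [v <-] <- [v' e <-]; apply/eqP; rewrite -subr_eq0 -!linearB; apply/eqP/hp.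
      have /hp[u eu] : p (v - v') = 0 by rewrite linearB e subrr.
      by exists (dif U u); rewrite dhomC -eu.
    + by move=> a q r q' r' [v <- <-] [v' <- <-]; exists (a *: v + v'); rewrite !linearP.
  have pd v : p (dif V v) = d (p v).
    have [v' e <-] := ed (p v); apply/eqP; rewrite -subr_eq0 -!linearB; apply/eqP/hp.
    have /hp[u eu] : p (v - v') = 0 by rewrite linearB e subrr.
    by exists (dif U u); rewrite dhomC -eu.
  have dd q : d (d q) = 0 by have [v <-] := ps q; rewrite -!pd difK linear0.
  by exists (DifMod dd), (@DifHom _ V (DifMod dd) p pd).
- move=> K X T i g h ii e.
  have hd t : h (dif T t) = dif K (h t) by apply: ii; rewrite e !dhomC e.
  by exists (DifHom hd).
- move=> K X T p g h ps e.
  have hd k : h (dif K k) = dif T (h k).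
    by have [x <-] := ps k; rewrite -dhomC !e dhomC.
  by exists (DifHom hd).
- move=> N M; exists (dif_pair N M).
  have h1 n : mklin (@inl_lin N M) (dif N n) = dif (dif_pair N M) (mklin (@inl_lin N M) n).
    by rewrite /= linear0.
  have h2 n : mklin (@inr_lin N M) (dif M n) = dif (dif_pair N M) (mklin (@inr_lin N M) n).
    by rewrite /= linear0.
  have h3 n : mklin (@fst_lin N M) (dif (dif_pair N M) n) = dif N (mklin (@fst_lin N M) n) by [].
  have h4 n : mklin (@snd_lin N M) (dif (dif_pair N M) n) = dif M (mklin (@snd_lin N M) n) by [].
  exists (@DifHom A N (dif_pair N M) _ h1), (@DifHom A M (dif_pair N M) _ h2).
  exists (@DifHom A (dif_pair N M) N _ h3), (@DifHom A (dif_pair N M) M _ h4).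
  by split; try (exact: difhom_ext); exact: pairDE.
Defined.

Definition DifA : abelianlike (Dif A) := concrete_abelianlike Dif_concrete.

Lemma Mod_sesP (N E M : Mod A) (i : hom N E) (p : hom E M) :
  short_exact i p <-> lin_exact (i : {linear _ -> _}) (p : {linear _ -> _}).
Proof. exact: (sesP Mod_concrete). Qed.

Lemma Dif_sesP (N E M : Dif A) (i : hom N E) (p : hom E M) :
  short_exact i p <-> lin_exact (dhom i) (dhom p).
Proof. exact: (sesP Dif_concrete). Qed.
End Instances.

Lemma dep_choice (I : Type) (T : I -> Type) (R : forall i, T i -> Prop) :
  (forall i, exists t, R i t) -> exists f : forall i, T i, forall i, R i (f i).
Proof. by move=> h; exists (fun i => projT1 (cid (h i))) => i; exact: projT2 (cid (h i)). Qed.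

Section DirectSum.
Variable A : pzRingType.

(** The universal property is proved from the coordinates: a map out of the direct
    sum is the sum of its components up to any bound of the support. *)
Lemma directsum_universal (V : nat -> lmodType A) :
  exists (S : lmodType A) (pr : forall i, {linear S -> V i}) (inj : forall i, {linear V i -> S}),
  [/\ forall x y, (forall i, pr i x = pr i y) -> x = y,
      forall x : forall i, V i, (exists n, forall i, (n <= i)%N -> x i = 0) ->
        exists s, forall i, pr i s = x i,
      forall x, exists n, forall i, (n <= i)%N -> pr i x = 0,
      forall i v, pr i (inj i v) = v /\ forall j, i != j -> pr j (inj i v) = 0
    & forall (W : lmodType A) (f : forall i, {linear V i -> W}),
      exists F : {linear S -> W},
        (forall i v, F (inj i v) = f i v) /\
        forall G : {linear S -> W}, (forall i v, G (inj i v) = f i v) -> G =1 F].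
Proof.
have [S [pr [sep bnd ex]]] := directsumP V.
have injP i : exists h : {linear V i -> S}, forall v,
    pr i (h v) = v /\ forall j, i != j -> pr j (h v) = 0.
  apply: (linear_relation (R := fun v s => pr i s = v /\ forall j, i != j -> pr j s = 0)).
  - move=> v; have [|s es] := ex (dfwith (fun j => 0 : V j) v).
      by exists i.+1 => j ij; rewrite dfwith_out // neq_ltn ij.
    exists s; rewrite es dfwith_in; split=> // j ij.
    by rewrite es dfwith_out.
  - move=> v s s' [e1 e2] [e1' e2']; apply: sep => j.
    by have [<-|ij] := eqVneq i j; rewrite ?e1 ?e1' // e2 // e2'.
  - move=> a v v' s s' [e1 e2] [e1' e2']; rewrite linearP e1 e1'; split=> // j ij.
    by rewrite linearP e2 // e2' // scaler0 addr0.
have [inj injE] := dep_choice injP.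
exists S, pr, inj; split=> // W f.
have sumE x n : (forall i, (n <= i)%N -> pr i x = 0) -> x = \sum_(i < n) inj i (pr i x).
  move=> hn; apply: sep => j; rewrite linear_sum /=.
  have [jn|nj] := ltnP j n.
    rewrite (bigD1 (Ordinal jn)) //= (injE j _).1 big1 ?addr0 // => i ij.
    by apply: (injE i _).2.
  by rewrite hn // big1 // => i _; apply: (injE i _).2; rewrite neq_ltn (leq_trans (ltn_ord i)).
have sum_widen x n m : (n <= m)%N -> (forall i, (n <= i)%N -> pr i x = 0) ->
    \sum_(i < n) f i (pr i x) = \sum_(i < m) f i (pr i x).
  move=> nm hn; rewrite (big_ord_widen m (fun i => f i (pr i x)) nm).
  rewrite [RHS](bigID (fun i : 'I_m => (i < n)%N)) /= [X in _ + X]big1 ?addr0 // => i.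
  by rewrite -leqNgt => /hn ->; rewrite linear0.
have [F eF] : exists F : {linear S -> W}, forall x, exists n,
    (forall i, (n <= i)%N -> pr i x = 0) /\ F x = \sum_(i < n) f i (pr i x).
  apply: (linear_relation (R := fun x w => exists n,
    (forall i, (n <= i)%N -> pr i x = 0) /\ w = \sum_(i < n) f i (pr i x))).
  - by move=> x; have [n hn] := bnd x; exists (\sum_(i < n) f i (pr i x)), n.
  - move=> x w w' [n [hn ->]] [m [hm ->]].
    by rewrite (sum_widen x n (maxn n m)) ?leq_maxl // (sum_widen x m (maxn n m)) ?leq_maxr.
  - move=> a x y w w' [n [hn ->]] [m [hm ->]]; exists (maxn n m); split.
      by move=> i; rewrite geq_max => /andP[? ?]; rewrite linearP hn // hm // scaler0 addr0.
    rewrite (sum_widen x n (maxn n m)) ?leq_maxl // (sum_widen y m (maxn n m)) ?leq_maxr //.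
    by rewrite scaler_sumr -big_split; apply: eq_bigr => i _; rewrite !linearP.
exists F; split=> [i v|G eG x].
  have [n [hn ->]] := eF (inj i v).
  have hn' j : (maxn n i.+1 <= j)%N -> pr j (inj i v) = 0.
    by rewrite geq_max => /andP[/hn].
  rewrite (sum_widen _ n (maxn n i.+1)) ?leq_maxl //.
  have im : (i < maxn n i.+1)%N by rewrite leq_maxr.
  rewrite (bigD1 (Ordinal im)) //= (injE i v).1 big1 ?addr0 // => j ij.
  by rewrite (injE i v).2 ?linear0 // eq_sym.
have [n [hn ->]] := eF x; rewrite [in LHS](sumE x n hn) linear_sum /=.
by apply: eq_bigr => i _.
Qed.
End DirectSum.

(** * Exact differential modules and their cycles *)
Section DifObjects.
Variable A : pzRingType.
Implicit Types (V K : lmodType A) (c : obclass (Mod A)) (T : difmod A).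

(** Since K occurs as a submodule and as a quotient, both the exact objects with
    cokernel in c and those with kernel in c have this form. *)
Definition cycles_in c : obclass (Dif A) := fun T : difmod A =>
  exists (K : lmodType A) (i : {linear K -> T}) (p : {linear T -> K}),
    [/\ lin_exact i p, forall x, dif T x = i (p x) & c K].

Lemma lin_exact_dif K T (i : {linear K -> T}) (p : {linear T -> K}) :
  lin_exact i p -> (forall x, dif T x = i (p x)) -> exact_dif T.
Proof.
move=> [ii ps ex] dE x; split=> [|[y ->]]; last exact: difK.
rewrite dE -(linear0 i) => /ii/ex[k ->]; have [y <-] := ps k.
by exists y; rewrite dE.
Qed.

Lemma cycles_in_exact c T : cycles_in c T -> exact_dif T.
Proof. by move=> [K [i [p [s dE _]]]]; exact: lin_exact_dif s dE. Qed.

Lemma exact_dif_cycles T : exact_dif T -> exists (K : lmodType A) (i : {linear K -> T}) (p : {linear T -> K}),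
  lin_exact i p /\ forall x, dif T x = i (p x).
Proof.
move=> ex; have [K [i [ii hi]]] := submoduleP (im_sub (dif T)).
have [p dp] : exists p, comp (c := Mod A) i p = dif T.
  by apply: (lift_inj (cc := Mod_concrete A)) => // x; apply/hi; exists x.
have dE x : dif T x = i (p x) by rewrite -dp.
exists K, i, p; split=> //; split=> // [k | x].
  have /hi[x ex'] : exists k', i k = i k' by exists k.
  by exists x; apply: ii; rewrite -dE -ex'.
rewrite -hi /=; split=> [px|/ex dx]; first by apply/ex; rewrite dE px linear0.
by apply: ii; rewrite -dE dx linear0.
Qed.

Lemma tildeX_cyclesE c : retract_closed_ob c -> tildeX c = cycles_in c.
Proof.
move=> cr; apply/funext => T; apply/propext; split.
  case=> /exact_dif_cycles[K0 [i0 [p0 [s0 dE]]]] [K [p [cp cK]]].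
  exists K0, i0, p0; split=> //.
  have c0 : is_cokernel (dif T : @hom (Mod A) T T) (p0 : @hom (Mod A) T K0).
    have s : short_exact (i0 : @hom (Mod A) K0 T) (p0 : @hom (Mod A) T K0) by apply/Mod_sesP.
    have e : (dif T : @hom (Mod A) T T) = comp (c := Mod A) i0 p0 by apply: linear_ext.
    split; first by rewrite e compA (ses0 s) zero_comp.
    move=> Z g; rewrite e compA => gip.
    have /(proj2 (proj2 s)) : comp (c := Mod A) g i0 = zero_mor (C := Mod A) K0 Z.
      by apply: (ses_epi s); rewrite gip zero_comp.
    by [].
  have [a [b e]] := ses_coker_uniq c0 cp.
  exact: cr e cK.
move=> tT; split; first exact: cycles_in_exact tT.
case: tT => K [i [p [s dE cK]]]; exists K, p; split=> //.
have {}s : short_exact (i : @hom (Mod A) K T) (p : @hom (Mod A) T K) by apply/Mod_sesP.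
have e : (dif T : @hom (Mod A) T T) = comp (c := Mod A) i p by apply: linear_ext.
split; first by rewrite e compA (ses0 s) zero_comp.
move=> Z g; rewrite e compA => gip.
apply: (proj2 (proj2 s)).
by apply: (ses_epi s); rewrite gip zero_comp.
Qed.

Lemma tildeY_cyclesE c : retract_closed_ob c -> tildeY c = cycles_in c.
Proof.
have keri T (K : lmodType A) (i : {linear K -> T}) (p : {linear T -> K}) :
    lin_exact i p -> (forall x, dif T x = i (p x)) ->
    is_kernel (dif T : @hom (Mod A) T T) (i : @hom (Mod A) K T).
  move=> s dE; have {}s : short_exact (i : @hom (Mod A) K T) (p : @hom (Mod A) T K) by apply/Mod_sesP.
  have e : (dif T : @hom (Mod A) T T) = comp (c := Mod A) i p by apply: linear_ext.
  split; first by rewrite e -compA (ses0 s) comp_zero.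
  move=> Z g; rewrite e -compA => gip.
  apply: (proj2 (proj1 s)).
  by apply: (ses_mono s); rewrite gip comp_zero.
move=> cr; apply/funext => T; apply/propext; split.
  case=> /exact_dif_cycles[K0 [i0 [p0 [s0 dE]]]] [K [p [cp cK]]].
  exists K0, i0, p0; split=> //.
  by have [a [b e]] := ses_ker_uniq (keri _ _ _ _ s0 dE) cp; exact: cr e cK.
move=> tT; split; first exact: cycles_in_exact tT.
by case: tT => K [i [p [s dE cK]]]; exists K, i; split=> //; exact: keri s dE.
Qed.

Lemma cycles_map T T' (K K' : lmodType A) (i : {linear K -> T}) (p : {linear T -> K})
    (i' : {linear K' -> T'}) (p' : {linear T' -> K'}) (f : difhom T T') :
  lin_exact i p -> (forall x, dif T x = i (p x)) ->
  lin_exact i' p' -> (forall x, dif T' x = i' (p' x)) ->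
  exists g : {linear K -> K'}, (forall k, f (i k) = i' (g k)) /\ (forall x, g (p x) = p' (f x)).
Proof.
move=> [ii ps ex] dE [ii' ps' ex'] dE'.
have [g eg] : exists g, comp (c := Mod A) i' g = comp (c := Mod A) (dhom f) i.
  apply: (lift_inj (cc := Mod_concrete A)) => // k /=.
  by have [x <-] := ps k; rewrite -dE dhomC dE'; exists (p' (f x)).
have fi k : f (i k) = i' (g k).
  exact: (esym (congr1 (fun h : {linear K -> T'} => h k) eg)).
by exists g; split=> // x; apply: ii'; rewrite -fi -dE dhomC dE'.
Qed.

Lemma cycles_in_retract c : retract_closed_ob c -> retract_closed_ob (cycles_in c).
Proof.
move=> cr T T' i0 r0 e tT'.
have rf x : dhom r0 (dhom i0 x) = x by have := congr1 (fun h : difhom T T => h x) e.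
have exT : exact_dif T.
  move=> x; split=> [dx|[y ->]]; last exact: difK.
  have /(cycles_in_exact tT')[y ey] : dif T' (dhom i0 x) = 0 by rewrite -dhomC dx linear0.
  by exists (dhom r0 y); rewrite -dhomC -ey rf.
have [K [i [p [s dE]]]] := exact_dif_cycles exT; case: tT' => K' [i' [p' [s' dE' cK']]].
exists K, i, p; split=> //.
have [g [g1 _]] := cycles_map i0 s dE s' dE'; have [h [h1 _]] := cycles_map r0 s' dE' s dE.
apply: (cr K K' g h) cK'; apply: linear_ext => k.
by case: s => ii _ _; apply: ii; rewrite /= -h1 -g1 rf.
Qed.

(** Left exactness of cycles is formal; surjectivity on the right holds since the
    cycles of an exact object are a quotient of it. *)
Lemma cycles_ses (T' T T'' : Dif A) (j : hom T' T) (q : hom T T'')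
   (K' K K'' : lmodType A) (i' : {linear K' -> T'}) (p' : {linear T' -> K'}) (i : {linear K -> T})
   (p : {linear T -> K}) (i'' : {linear K'' -> T''}) (p'' : {linear T'' -> K''}) :
  short_exact j q ->
  lin_exact i' p' -> (forall x, dif T' x = i' (p' x)) ->
  lin_exact i p -> (forall x, dif T x = i (p x)) ->
  lin_exact i'' p'' -> (forall x, dif T'' x = i'' (p'' x)) ->
  exists (g : @hom (Mod A) K' K) (h : @hom (Mod A) K K''), short_exact g h.
Proof.
move=> /Dif_sesP[ji qs ex] s' dE' s dE s'' dE''.
have [g [g1 g2]] := cycles_map j s' dE' s dE; have [h [h1 h2]] := cycles_map q s dE s'' dE''.
exists g, h; apply/Mod_sesP; case: (s') => ii' ps' ex'; case: (s) => ii ps exx; case: s'' => ii'' ps'' ex''.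
split.
- by move=> k k' e; apply/ii'/ji; rewrite !g1 e.
- move=> k''; have [x'' <-] := ps'' k''; have [x <-] := qs x''.
  by exists (p x); rewrite h2.
- move=> k; split=> [hk|[u ->]].
    have /ex[t' et'] : dhom q (i k) = 0 by rewrite h1 hk linear0.
    have /(lin_exact_dif s' dE')[t et] : dif T' t' = 0.
      apply: ji; rewrite dhomC -et' dE linear0.
      by have -> : p (i k) = 0; [apply/exx; exists k | rewrite linear0].
    by exists (p' t); apply: ii; rewrite -g1 -dE' -et et'.
  apply: ii''; rewrite -h1 -g1 linear0; apply/ex; by exists (i' u).
Qed.

Section ExactTwoOfThree.
Variables (T' T T'' : difmod A) (j : difhom T' T) (q : difhom T T'').
Hypothesis s : lin_exact j q.

Lemma exact_ker : exact_dif T -> exact_dif T'' -> exact_dif T'.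
Proof.
case: s => ji qs ex e e'' x; split=> [dx|[y ->]]; last exact: difK.
have /e[y ey] : dif T (j x) = 0 by rewrite -dhomC dx linear0.
have /e''[z'' ez] : dif T'' (q y) = 0 by rewrite -dhomC -ey; apply/ex; exists x.
have [z e0] := qs z''.
have /ex[t et] : q (y - dif T z) = 0 by rewrite linearB dhomC e0 ez subrr.
by exists t; apply: ji; rewrite dhomC -et linearB difK subr0.
Qed.

Lemma exact_mid : exact_dif T' -> exact_dif T'' -> exact_dif T.
Proof.
case: s => ji qs ex e' e'' x; split=> [dx|[y ->]]; last exact: difK.
have /e''[z'' ez] : dif T'' (q x) = 0 by rewrite -dhomC dx linear0.
have [z e0] := qs z''.
have /ex[t et] : q (x - dif T z) = 0 by rewrite linearB dhomC e0 ez subrr.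
have /e'[r er] : dif T' t = 0 by apply: ji; rewrite dhomC -et linearB difK dx subrr linear0.
by exists (j r + z); rewrite linearD -dhomC -er -et subrK.
Qed.

Lemma exact_coker : exact_dif T' -> exact_dif T -> exact_dif T''.
Proof.
case: s => ji qs ex e' e x''; split=> [|[y ->]]; last exact: difK.
have [x <-] := qs x''; rewrite -dhomC => /ex[t et].
have /e'[r er] : dif T' t = 0 by apply: ji; rewrite dhomC -et difK linear0.
have /e[y ey] : dif T (x - j r) = 0 by rewrite linearB et er -dhomC subrr.
exists (q y); rewrite -dhomC -ey linearB.
by have -> : q (j r) = 0; [apply/ex; exists r | rewrite subr0].
Qed.
End ExactTwoOfThree.

Lemma cycles_in_ker c : 
  (forall (X X' K : Mod A) (j : hom K X) (q : hom X X'), short_exact j q -> c X -> c X' -> c K) ->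
  forall (T T'' T' : Dif A) (j : hom T' T) (q : hom T T''), short_exact j q ->
    cycles_in c T -> cycles_in c T'' -> cycles_in c T'.
Proof.
move=> h T T'' T' j q s t t''.
have := exact_ker (proj1 (Dif_sesP j q) s) (cycles_in_exact t) (cycles_in_exact t'').
move=> /exact_dif_cycles[K' [i' [p' [s' dE']]]].
case: t => K [i [p [s1 dE cK]]]; case: t'' => K'' [i'' [p'' [s'' dE'' cK'']]].
exists K', i', p'; split=> //.
have [g [g' sg]] := cycles_ses s s' dE' s1 dE s'' dE''; exact: h sg cK cK''.
Qed.

Lemma cycles_in_ext c : 
  (forall (X X' K : Mod A) (j : hom K X) (q : hom X X'), short_exact j q -> c K -> c X' -> c X) ->
  forall (T T'' T' : Dif A) (j : hom T' T) (q : hom T T''), short_exact j q ->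
    cycles_in c T' -> cycles_in c T'' -> cycles_in c T.
Proof.
move=> h T T'' T' j q s t' t''.
have := exact_mid (proj1 (Dif_sesP j q) s) (cycles_in_exact t') (cycles_in_exact t'').
move=> /exact_dif_cycles[K [i [p [s1 dE]]]].
case: t' => K' [i' [p' [s' dE' cK']]]; case: t'' => K'' [i'' [p'' [s'' dE'' cK'']]].
exists K, i, p; split=> //.
have [g [g' sg]] := cycles_ses s s' dE' s1 dE s'' dE''; exact: h sg cK' cK''.
Qed.

Lemma cycles_in_coker c : 
  (forall (X X' K : Mod A) (j : hom K X) (q : hom X X'), short_exact j q -> c K -> c X -> c X') ->
  forall (T T'' T' : Dif A) (j : hom T' T) (q : hom T T''), short_exact j q ->
    cycles_in c T' -> cycles_in c T -> cycles_in c T''.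
Proof.
move=> h T T'' T' j q s t' t.
have := exact_coker (proj1 (Dif_sesP j q) s) (cycles_in_exact t') (cycles_in_exact t).
move=> /exact_dif_cycles[K'' [i'' [p'' [s'' dE'']]]].
case: t' => K' [i' [p' [s' dE' cK']]]; case: t => K [i [p [s1 dE cK]]].
exists K'', i'', p''; split=> //.
have [g [g' sg]] := cycles_ses s s' dE' s1 dE s'' dE''; exact: h sg cK' cK.
Qed.

(** Injectivity and surjectivity on homology Ker d / Im d, expressed by elements so
    that no homology module is needed. *)
Definition qis : morclass (Dif A) := fun (X Y : difmod A) (f : difhom X Y) =>
  (forall x, dif X x = 0 -> (exists y, f x = dif Y y) -> exists z, x = dif X z) /\
  (forall y, dif Y y = 0 -> exists x z, dif X x = 0 /\ y = f x + dif Y z).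

(** The long exact homology sequence degenerates to an exact triangle of homology
    modules, so the map on homology is bijective iff the third term vanishes. *)
Lemma qis_mono (T' T T'' : Dif A) (j : hom T' T) (q : hom T T'') :
  short_exact j q -> (qis j <-> exact_dif T'').
Proof.
move=> /Dif_sesP[ji qs ex]; split=> [[inj sur] x''|e].
- split=> [|[y ->]]; last exact: difK.
  have [x <-] := qs x''; rewrite -dhomC => /ex[t et].
  have [|z ez] := inj t _ (ex_intro _ x (esym et)).
    by apply: ji; rewrite dhomC -et difK linear0.
  have /sur[x1 [z1 [dx1 e1]]] : dif T (x - dhom j z) = 0.
    by rewrite linearB et ez -dhomC subrr.
  exists (dhom q z1); rewrite -dhomC.
  have q0 t' : dhom q (dhom j t') = 0 by apply/ex; exists t'.
  by rewrite -[x](subrK (dhom j z)) e1 !linearD !q0 addr0 add0r.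
- split=> [t dt [y ey]|y dy].
    have /e[z'' ez] : dif T'' (dhom q y) = 0 by rewrite -dhomC -ey; apply/ex; exists t.
    have [z e0] := qs z''.
    have /ex[s es] : dhom q (y - dif T z) = 0 by rewrite linearB dhomC e0 ez subrr.
    by exists s; apply: ji; rewrite dhomC -es linearB difK subr0.
  have /e[z'' ez] : dif T'' (dhom q y) = 0 by rewrite -dhomC dy linear0.
  have [z e0] := qs z''.
  have /ex[s es] : dhom q (y - dif T z) = 0 by rewrite linearB dhomC e0 ez subrr.
  exists s, z; rewrite -es subrK; split=> //.
  by apply: ji; rewrite dhomC -es linearB difK dy subrr linear0.
Qed.

Lemma qis_epi (T T'' T' : Dif A) (j : hom T' T) (q : hom T T'') :
  short_exact j q -> (qis q <-> exact_dif T').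
Proof.
move=> /Dif_sesP[ji qs ex]; have q0 t' : dhom q (dhom j t') = 0 by apply/ex; exists t'.
split=> [[inj sur] s|e].
- split=> [ds|[y ->]]; last exact: difK.
  have [||z ez] := inj (dhom j s); first by rewrite -dhomC ds linear0.
    by exists 0; rewrite q0 linear0.
  have /sur[x [y'' [dx e1]]] : dif T'' (dhom q z) = 0 by rewrite -dhomC -ez q0.
  have [y e2] := qs y''.
  have /ex[r er] : dhom q (z - x - dif T y) = 0.
    by rewrite !linearB dhomC e2 e1 addrAC addrK subrr.
  by exists r; apply: ji; rewrite dhomC -er !linearB difK dx !subr0.
- split=> [x dx [y'' e0]|y'' dy].
    have [y ey] := qs y''.
    have /ex[s es] : dhom q (x - dif T y) = 0 by rewrite linearB dhomC ey e0 subrr.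
    have /e[r er] : dif T' s = 0.
      by apply: ji; rewrite dhomC -es linearB difK dx subrr linear0.
    by exists (dhom j r + y); rewrite linearD -dhomC -er -es subrK.
  have [x ex0] := qs y''.
  have /ex[s es] : dhom q (dif T x) = 0 by rewrite dhomC ex0.
  have /e[r er] : dif T' s = 0 by apply: ji; rewrite dhomC -es difK linear0.
  exists (x - dhom j r), 0; rewrite linearB es er dhomC subrr; split=> //.
  by rewrite linearB q0 ex0 subr0 linear0 addr0.
Qed.

Lemma qis_23 : two_of_three qis.
Proof.
move=> X Y Z f g; split.
- move=> [fi fs] [gi gs]; split=> [x dx [y ey]|z dz].
    apply: fi => //; apply: gi; first by rewrite -dhomC dx linear0.
    by exists y.
  have [y [w [dy ->]]] := gs z dz; have [x [v [dx ->]]] := fs y dy.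
  by exists x, (dhom g v + w); split=> //; rewrite linearD dhomC linearD addrA.
- move=> [fi fs] [gi gs]; split=> [y dy [z ez]|z dz].
    have [x [v [dx e]]] := fs y dy.
    have [|w ew] := gi x dx.
      exists (z - dhom g v); rewrite /= linearB -ez -dhomC e linearD.
      by rewrite addrK.
    by exists (dhom f w + v); rewrite linearD -dhomC -ew.
  have [x [w [dx ->]]] := gs z dz; exists (dhom f x), w; split=> //.
  by rewrite -dhomC dx linear0.
- move=> [gi gs] [hi hs]; split=> [x dx [y ey]|y dy].
    by apply: hi => //; exists (dhom g y); rewrite /= ey dhomC.
  have [|x [w [dx e]]] := hs (dhom g y); first by rewrite -dhomC dy linear0.
  have [||v ev] := gi (y - dhom f x).
  - by rewrite linearB dy -dhomC dx linear0 subrr.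
  - by exists w; rewrite linearB e /= addrAC subrr add0r.
  by exists x, v; rewrite -ev addrC subrK.
Qed.

Lemma qis_retract : retract_closed qis.
Proof.
move=> X Y X' Y' f g [i [r [j [s [ri sj gi fr]]]]] [inj sur].
have ap (U V : Dif A) (a b : hom U V) x : a = b -> dhom a x = dhom b x by move->.
have rE x : dhom r (dhom i x) = x := ap _ _ _ _ x ri.
have sE x : dhom s (dhom j x) = x := ap _ _ _ _ x sj.
have gE x : dhom g (dhom i x) = dhom j (dhom f x) := ap _ _ _ _ x gi.
have fE x : dhom f (dhom r x) = dhom s (dhom g x) := ap _ _ _ _ x fr.
split=> [x dx [y ey]|y dy].
  have [||z ez] := inj (dhom i x); first by rewrite -dhomC dx linear0.
    by exists (dhom j y); rewrite gE ey dhomC.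
  by exists (dhom r z); rewrite -dhomC -ez rE.
have [|x [z [dx e]]] := sur (dhom j y); first by rewrite -dhomC dy linear0.
exists (dhom r x), (dhom s z); rewrite -dhomC dx linear0; split=> //.
by rewrite fE -dhomC -linearD -e sE.
Qed.

End DifObjects.

(** * Disks and spheres *)
Section SpecialObjects.
Variable A : pzRingType.
Implicit Types (V K J : lmodType A) (c : obclass (Mod A)) (T : difmod A).

(** The analogue of a complex concentrated in one degree. *)
Definition sphere V : difmod A := DifMod (dif := lin_zero V V) (fun=> erefl).

Lemma disk_lin V : linear (fun x : V * V => (x.2, 0) : V * V).
Proof. by move=> a x y; congr pair; rewrite /= scaler0 addr0. Qed.

(** The differential module freely, and also cofreely, generated by V. *)
Definition disk V : difmod A :=
  DifMod (dmod := (V * V : lmodType A)%type) (dif := mklin (@disk_lin V)) (fun=> erefl).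

Lemma cycles_in_disk c V : c V -> cycles_in c (disk V).
Proof.
exists V, (mklin (@inl_lin A V V)), (mklin (@snd_lin A V V)); split=> //; split.
- by move=> x y [].
- by move=> v; exists (0, v).
- by move=> [a b]; split=> [/= ->|[u [_ ->]]] //; exists a.
Qed.

(** The morphism adjoint to j sends x to (j x, j (d x)). *)
Lemma disk_embed T V (j : {linear T -> V}) : injective j ->
  exists f : @hom (Dif A) T (disk V), mono f.
Proof.
move=> ji; have h : linear (fun x => (j x, j (dif T x)) : V * V).
  by move=> a x y; congr pair; rewrite /= !linearP.
have hd x : mklin h (dif T x) = dif (disk V) (mklin h x) by rewrite /= difK linear0.
exists (@DifHom A T (disk V) _ hd).
by apply/(mono_injP (Dif_concrete A)) => x y [/ji].
Qed.

(** The morphism adjoint to q sends (a, b) to d (q a) + q b. *)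
Lemma disk_cover T V (q : {linear V -> T}) : (forall x, exists v, q v = x) ->
  exists f : @hom (Dif A) (disk V) T, epi f.
Proof.
move=> qs; have h : linear (fun x : V * V => dif T (q x.1) + q x.2).
  by move=> a x y; rewrite /= !linearP scalerDr addrACA.
have hd x : mklin h (dif (disk V) x) = dif T (mklin h x).
  by rewrite /= linear0 addr0 linearD difK add0r.
exists (@DifHom A (disk V) T _ hd).
apply/(epi_surjP (Dif_concrete A)) => x; have [v <-] := qs x.
by exists (0, v); rewrite /= !linear0 add0r.
Qed.

Lemma cycles_filtration T K (i : {linear K -> T}) (p : {linear T -> K}) : lin_exact i p ->
  (forall x, dif T x = i (p x)) ->
  exists (j : @hom (Dif A) (sphere K) T) (q : @hom (Dif A) T (sphere K)), short_exact j q.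
Proof.
move=> s dE; have [ii ps ex] := s.
have h1 k : i (dif (sphere K) k) = dif T (i k).
  by rewrite /= linear0 dE; have -> : p (i k) = 0; [apply/ex; exists k | rewrite linear0].
have h2 x : p (dif T x) = dif (sphere K) (p x) by rewrite dE; apply/ex; exists (p x).
by exists (@DifHom A (sphere K) T _ h1), (@DifHom A T (sphere K) _ h2); apply/Dif_sesP.
Qed.

Lemma sphere_filtration T : exists (Z B : lmodType A) (j : @hom (Dif A) (sphere Z) T)
  (q : @hom (Dif A) T (sphere B)), short_exact j q.
Proof.
have [Z [i [ii hi]]] := submoduleP (ker_sub (dif T)).
have [B [m [mi hm]]] := submoduleP (im_sub (dif T)).
have [p dp] : exists p, comp (c := Mod A) m p = dif T.
  by apply: (lift_inj (cc := Mod_concrete A)) => // x; apply/hm; exists x.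
have dE x : dif T x = m (p x) by rewrite -dp.
have h1 k : i (dif (sphere Z) k) = dif T (i k).
  by rewrite /= linear0; symmetry; apply/hi; exists k.
have h2 x : p (dif T x) = dif (sphere B) (p x) by apply: mi; rewrite -dE difK linear0.
exists Z, B, (@DifHom A (sphere Z) T _ h1), (@DifHom A T (sphere B) _ h2); apply/Dif_sesP; split=> //=.
- move=> b; have /hm[x ex] : exists k, m b = m k by exists b.
  by exists x; apply: mi; rewrite -dE.
- by move=> v; rewrite -hi /= dE; split=> [->|e]; [exact: linear0 | apply: mi; rewrite e linear0].
Qed.

(** An extension of M by N that splits over A is given by a map phi from M to N that
    anticommutes with the differentials, and a homotopy for phi changes the linear
    section into a morphism of differential modules. *)
Lemma orth_homotopy (M N : Dif A) : @orth (Mod A) (dmod M) (dmod N) ->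
  (forall phi : {linear dmod M -> dmod N}, (forall x, phi (dif M x) = - dif N (phi x)) ->
     exists s : {linear dmod M -> dmod N}, forall x, phi x = s (dif M x) - dif N (s x)) ->
  orth M N.
Proof.
move=> o h E j q /Dif_sesP s; have [ji qs ex] := s.
have [sg esg] := o E (dhom j) (dhom q) (proj2 (Mod_sesP _ _) s).
have qsg x : dhom q (sg x) = x by exact: (congr1 (fun f : {linear dmod M -> dmod M} => f x) esg).
have thl : linear (fun x => dif E (sg x) - sg (dif M x)).
  move=> a x y; rewrite [sg _]linearP [dif E _]linearP [dif M _]linearP [sg (_ + _)]linearP.
  by rewrite scalerBr opprD addrACA.
have [phi ephi] : exists phi, comp (c := Mod A) (dhom j) phi = mklin thl.
  apply: (lift_inj (cc := Mod_concrete A)) => // x; apply/ex.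
  by rewrite /= linearB qsg dhomC qsg subrr.
have phE x : dhom j (phi x) = dif E (sg x) - sg (dif M x).
  exact: (congr1 (fun f : {linear dmod M -> dmod E} => f x) ephi).
have [|s0 es] := h phi.
  by move=> x; apply: ji; rewrite phE linearN dhomC phE linearB !difK linear0 subr0 sub0r opprK.
have sl : linear (fun x => sg x + dhom j (s0 x)).
  by move=> a x y; rewrite !linearP /= scalerDr addrACA.
have sd x : mklin sl (dif M x) = dif E (mklin sl x).
  rewrite /= linearD -dhomC; apply/eqP; rewrite -subr_eq0 opprD addrACA -linearB -es phE.
  by rewrite -[X in X + _]opprB addNr.
exists (DifHom sd); apply: difhom_ext => x.
by rewrite /= linearD qsg; have -> : dhom q (dhom j (s0 x)) = 0; [apply/ex; exists (s0 x)|rewrite addr0].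
Qed.
End SpecialObjects.

(** * Orthogonality and exact approximations *)
Section Pair.
Variable A : pzRingType.
Variables cX cY : obclass (Mod A).
Hypotheses (cot : cotorsion_pair cX cY) (cpl : complete_pair cX cY)
  (her : hereditary_pair cX cY).
Implicit Types (V K J : lmodType A) (T N : difmod A).
Let abM := @ModA A.
Let abD := @DifA A.

Lemma pair_orth (X Y : Mod A) : cX X -> cY Y -> orth X Y.
Proof. by move=> cx cy; exact: (proj1 (proj1 (perp_orth abM cot) X) cx Y cy). Qed.

Lemma retrX : retract_closed_ob cX. Proof. exact: (proj1 (cot_retract abM cot)). Qed.
Lemma retrY : retract_closed_ob cY. Proof. exact: (proj2 (cot_retract abM cot)). Qed.

Lemma extY (Y Y'' Y' : Mod A) (i : hom Y' Y) (p : hom Y Y'') :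
  short_exact i p -> cY Y' -> cY Y'' -> cY Y.
Proof. by move=> s; exact: (cot_ext abM cot s). Qed.

Lemma extX (X X'' X' : Mod A) (i : hom X' X) (p : hom X X'') :
  short_exact i p -> cX X' -> cX X'' -> cX X.
Proof.
have [h _] := perp_orth abM cot; move=> s /h a /h b; apply/h => Y cy.
by apply: (orth_extr abM s); [apply: a | apply: b].
Qed.

Lemma kerX (X X' K : Mod A) (j : hom K X) (q : hom X X') :
  short_exact j q -> cX X -> cX X' -> cX K.
Proof. by move=> s; case: (s) => k _; exact: (proj1 her _ _ q _ j (ses_epi s) k). Qed.

Lemma cokerY (Y K Y' : Mod A) (j : hom Y' Y) (q : hom Y K) :
  short_exact j q -> cY Y' -> cY Y -> cY K.
Proof. by move=> s; case: (s) => _ k; exact: (proj2 her _ _ j _ q (ses_mono s) k). Qed.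

Lemma coverX (M : Mod A) : exists (X : Mod A) (q : hom X M), epi q /\ cX X.
Proof.
have [_ [Y [X [i [p [s _ cx]]]]]] := cpl M.
by exists X, p; split=> //; exact: ses_epi s.
Qed.

Lemma embedY (M : Mod A) : exists (Y : Mod A) (j : hom M Y), mono j /\ cY Y.
Proof.
have [[Y [X [i [p [s cy _]]]]] _] := cpl M.
by exists Y, i; split=> //; exact: ses_mono s.
Qed.

(** Let d = i p with p onto the cycles K and i their inclusion.  The map psi
    factors through p, and the factor extends along i because the cokernel of i is
    K and Ext^1(K, J) = 0. *)
Lemma lift_through_dif T J (psi : {linear T -> J}) : cycles_in cX T -> cY J ->
  (forall x, psi (dif T x) = 0) -> exists s : {linear T -> J}, forall x, psi x = s (dif T x).
Proof.
move=> [K [i [p [s dE cK]]]] cJ psd; have [ii ps ex] := s.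
have sM := proj2 (Mod_sesP (i : @hom (Mod A) K T) p) s.
have [psi' e1] : exists psi', comp (c := Mod A) psi' p = psi.
  apply: (ses_cofact sM); apply: linear_ext => k /=.
  by have [x <-] := ps k; rewrite -dE psd.
have [t et] := orth_ext abM psi' (pair_orth cK cJ) sM.
exists t => x; rewrite dE.
transitivity (psi' (p x)); first exact: (congr1 (fun f : {linear T -> J} => f x) (esym e1)).
exact: (congr1 (fun f : {linear K -> J} => f (p x)) (esym et)).
Qed.

(** Dual to the previous argument: psi takes values in the cycles of N, and lifts
    along the projection of N onto its cycles. *)
Lemma colift_through_dif K N (psi : {linear K -> N}) : cX K -> cycles_in cY N ->
  (forall x, dif N (psi x) = 0) -> exists s : {linear K -> N}, forall x, psi x = dif N (s x).
Proof.
move=> cK [J [i [p [s dE cJ]]]] psd; have [ii ps ex] := s.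
have sM := proj2 (Mod_sesP (i : @hom (Mod A) J N) p) s.
have [psi' e1] : exists psi', comp (c := Mod A) i psi' = psi.
  apply: (ses_fact sM); apply: linear_ext => k /=.
  by apply: ii; rewrite -dE psd linear0.
have [t et] := orth_lift abM psi' (pair_orth cK cJ) sM.
exists t => x; rewrite dE.
transitivity (i (psi' x)); first exact: (congr1 (fun f : {linear K -> N} => f x) (esym e1)).
congr (i _); exact: (congr1 (fun f : {linear K -> J} => f x) (esym et)).
Qed.

Lemma orth_sphere_cycles K N : cX K -> cycles_in cY N -> @orth (Dif A) (sphere K) N.
Proof.
move=> cK tN; apply: orth_homotopy.
  case: (tN) => J [i [p [s _ cJ]]].
  have sM := proj2 (Mod_sesP (i : @hom (Mod A) J N) p) s.
  by apply: (orth_extl abM sM); exact: pair_orth.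
move=> phi ph; have [|s es] := colift_through_dif (psi := phi) cK tN.
  by move=> x; apply: oppr_inj; rewrite -ph /= linear0 oppr0.
have hl : linear (fun x => - s x) by move=> a x y; rewrite linearP opprD scalerN.
by exists (mklin hl) => x; rewrite /= linear0 oppr0 sub0r linearN opprK es.
Qed.

Lemma orth_cycles_sphere T J : cycles_in cX T -> cY J -> @orth (Dif A) T (sphere J).
Proof.
move=> tT cJ; apply: orth_homotopy.
  case: (tT) => K [i [p [s _ cK]]].
  have sM := proj2 (Mod_sesP (i : @hom (Mod A) K T) p) s.
  by apply: (orth_extr abM sM); exact: pair_orth.
move=> phi ph; have [|s es] := lift_through_dif (psi := phi) tT cJ.
  by move=> x; rewrite ph /= oppr0.
by exists s => x; rewrite /= subr0 es.
Qed.

(** T is an extension of two spheres on its cycles. *)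
Lemma orth_cycles (T N : Dif A) : cycles_in cX T -> cycles_in cY N -> orth T N.
Proof.
move=> [K [i [p [s dE cK]]]] tN; have [j [q sD]] := cycles_filtration s dE.
by apply: (orth_extr abD sD); exact: orth_sphere_cycles.
Qed.

(** Turns a self-extension of K, as produced by [horseshoe], into an exact
    differential module with cycles K. *)
Lemma dif_of_ses V K (m : @hom (Mod A) K V) (n : @hom (Mod A) V K) : short_exact m n ->
  exists d : {linear V -> V}, (forall x, d x = (m : {linear K -> V}) ((n : {linear V -> K}) x)) /\
    (forall x, d (d x) = 0).
Proof.
move=> /Mod_sesP s; have [mi _ ex] := s; exists (comp m n : {linear V -> V}); split=> // x /=.
by have -> : (n : {linear V -> K}) (m (n x)) = 0; [apply/ex; exists (n x) | rewrite linear0].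
Qed.

(** The horseshoe lemma for 0 -> K -> E -> K -> 0 with the same special embedding
    of K used on both sides.  Its three rows are self-extensions, hence exact
    differential modules, and its vertical maps respect the differentials because
    the outer columns coincide. *)
Lemma exact_emb (E : Dif A) : exact_dif E -> exists (Y X : Dif A) (i : hom E Y) (p : hom Y X),
  [/\ short_exact i p, cycles_in cY Y & cycles_in cX X].
Proof.
move=> /exact_dif_cycles[K [i [p [s dE]]]].
have sM := proj2 (Mod_sesP (i : @hom (Mod A) K E) p) s.
have [[Y0 [X0 [u [v [s0 cy cx]]]]] _] := cpl K.
have [Y2 [X2 [m [n [m' [n' [u2 [v2 [sY sX s2 [e1 e2] [e3 e4]]]]]]]]]] :=
  horseshoe abM pair_orth (fun Y' Y K j q s => @cokerY Y K Y' j q s) embedY sM s0 s0 cy cx.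
have ap (U V : Mod A) (f g : hom U V) x : f = g -> (f : {linear _ -> _}) x = (g : {linear _ -> _}) x by move->.
have [dY [dYE dYK]] := dif_of_ses sY; have [dX [dXE dXK]] := dif_of_ses sX.
have h1 x : u2 (dif E x) = dif (DifMod dYK) (u2 x).
  by rewrite dE /= dYE; have /= := ap _ _ _ _ (p x) e1; have /= := ap _ _ _ _ x e2 => -> ->.
have h2 x : v2 (dif (DifMod dYK) x) = dif (DifMod dXK) (v2 x).
  by rewrite /= dYE dXE; have /= := ap _ _ _ _ (n x) e3; have /= := ap _ _ _ _ x e4 => -> ->.
exists (DifMod dYK), (DifMod dXK), (@DifHom A E (DifMod dYK) u2 h1).
exists (@DifHom A (DifMod dYK) (DifMod dXK) v2 h2).
split; first by apply/Dif_sesP; exact/Mod_sesP.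
- by exists Y0, m, n; split=> //; exact/Mod_sesP.
- by exists X0, m', n'; split=> //; exact/Mod_sesP.
Qed.

(** The horseshoe lemma in the opposite category; all arrows are reversed when read
    in the category of modules. *)
Lemma exact_cover (E : Dif A) : exact_dif E -> exists (Y X : Dif A) (i : hom Y X) (p : hom X E),
  [/\ short_exact i p, cycles_in cY Y & cycles_in cX X].
Proof.
move=> /exact_dif_cycles[K [i [p [s dE]]]].
have sM := proj2 (Mod_sesP (i : @hom (Mod A) K E) p) s.
have [_ [Y0 [X0 [v [u [s0 cy cx]]]]]] := cpl K.
have [X2 [Y2 [n [m [n' [m' [u2 [v2 [/op_short_exact sX /op_short_exact sY /op_short_exact s2 [e1 e2] [e3 e4]]]]]]]]]] :=
  horseshoe (abelianlike_op abM) (cX := cY) (cY := cX)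
    (fun Y X cy cx => orth_op abM (pair_orth cx cy))
    (fun X' X K j q s c' c => kerX (op_short_exact s) c c') coverX
    (short_exact_op sM) (short_exact_op s0) (short_exact_op s0) cx cy.
have ap (U V : Mod A) (f g : hom U V) x : f = g -> (f : {linear _ -> _}) x = (g : {linear _ -> _}) x by move->.
have [dX [dXE dXK]] := dif_of_ses sX; have [dY [dYE dYK]] := dif_of_ses sY.
have a1 x : (p : {linear _ -> _}) ((u2 : @hom (Mod A) X2 E) x) = (u : {linear X0 -> K}) ((n : @hom (Mod A) X2 X0) x).
  exact: (ap _ _ (comp (c := Mod A) p u2) (comp (c := Mod A) u n) x e1).
have a2 x : (i : {linear _ -> _}) ((u : {linear X0 -> K}) x) = (u2 : @hom (Mod A) X2 E) ((m : @hom (Mod A) X0 X2) x).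
  exact: (ap _ _ (comp (c := Mod A) i u) (comp (c := Mod A) u2 m) x e2).
have a3 x : (n : @hom (Mod A) X2 X0) ((v2 : @hom (Mod A) Y2 X2) x) = (v : {linear Y0 -> X0}) ((n' : @hom (Mod A) Y2 Y0) x).
  exact: (ap _ _ (comp (c := Mod A) n v2) (comp (c := Mod A) v n') x e3).
have a4 x : (m : @hom (Mod A) X0 X2) ((v : {linear Y0 -> X0}) x) = (v2 : @hom (Mod A) Y2 X2) ((m' : @hom (Mod A) Y0 Y2) x).
  exact: (ap _ _ (comp (c := Mod A) m v) (comp (c := Mod A) v2 m') x e4).
have h1 x : (u2 : @hom (Mod A) X2 E) (dif (DifMod dXK) x) = dif E ((u2 : @hom (Mod A) X2 E) x).
  by rewrite dE /= dXE a1 a2.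
have h2 x : (v2 : @hom (Mod A) Y2 X2) (dif (DifMod dYK) x) = dif (DifMod dXK) ((v2 : @hom (Mod A) Y2 X2) x).
  by rewrite /= dYE dXE a3 a4.
exists (DifMod dYK), (DifMod dXK), (@DifHom A (DifMod dYK) (DifMod dXK) v2 h2).
exists (@DifHom A (DifMod dXK) E u2 h1).
split; first by apply/Dif_sesP; exact/Mod_sesP.
- by exists Y0, m', n'; split=> //; exact/Mod_sesP.
- by exists X0, m, n; split=> //; exact/Mod_sesP.
Qed.
End Pair.

(** * Resolving spheres *)
Section Resolutions.
Variable A : pzRingType.
Variables cX cY : obclass (Mod A).
Hypotheses (cot : cotorsion_pair cX cY) (cpl : complete_pair cX cY).
Implicit Types (V W K J : lmodType A) (T N : difmod A).
Let abM := @ModA A.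
Let abD := @DifA A.


(** Splice special embeddings 0 -> C_n -> J_n -> C_(n+1) -> 0 with C_0 = V, and let I
    be the product of the J_n with differential J_n -> C_(n+1) -> J_(n+1).  The
    inclusion of V is a quasi-isomorphism as the spliced sequence is exact.  A map
    phi from T to I is contracted by solving phi_0 = s_0 d and
    phi_(n+1) = s_(n+1) d - partial s_n in turn with [lift_through_dif].  The product
    is needed because the recursion does not stop. *)
Lemma sphere_coresolution V : exists (I C : Dif A) (j : @hom (Dif A) (sphere V) I) (q : @hom (Dif A) I C),
  [/\ short_exact j q, exact_dif C & forall T, cycles_in cX T -> @orth (Dif A) T I].
Proof.
have step W : exists t : {J : lmodType A & {W' : lmodType A & ({linear W -> J} * {linear J -> W'})%type}},
    lin_exact (projT2 (projT2 t)).1 (projT2 (projT2 t)).2 /\ cY (projT1 t).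
  have [[J [W' [i [p [/Mod_sesP s cJ _]]]]] _] := cpl W.
  by exists (existT _ J (existT _ W' (i, p))).
have [f hf] := dep_choice step.
pose C := fix C n : lmodType A := if n is n'.+1 then projT1 (projT2 (f (C n'))) else V.
pose J n := projT1 (f (C n)).
pose i n : {linear C n -> J n} := (projT2 (projT2 (f (C n)))).1.
pose p n : {linear J n -> C n.+1} := (projT2 (projT2 (f (C n)))).2.
have s n : lin_exact (i n) (p n) := (hf (C n)).1.
have cJ n : cY (J n) := (hf (C n)).2.
have pi0 n c : p n (i n c) = 0 by have [_ _ ex] := s n; apply/ex; exists c.
have iinj n : injective (i n) by have [] := s n.
clearbody i p; clearbody J.
have [I [pr [sep ex]]] := productP J.
have [d [d0 dS]] : exists d : {linear I -> I}, (forall x, pr 0%N (d x) = 0) /\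
    (forall n x, pr n.+1 (d x) = i n.+1 (p n (pr n x))).
  have [d hd] : exists d : {linear I -> I}, forall x, pr 0%N (d x) = 0 /\
      (forall n, pr n.+1 (d x) = i n.+1 (p n (pr n x))).
    apply: (linear_relation (R := fun x y => pr 0%N y = 0 /\
      (forall n, pr n.+1 y = i n.+1 (p n (pr n x))))).
    - move=> x; have [y hy] := ex (fun n => if n is m.+1 then i m.+1 (p m (pr m x)) else 0).
      by exists y; split=> [|n]; rewrite hy.
    - by move=> x y y' [h0 hS] [h0' hS']; apply: sep => -[|n]; rewrite ?h0 ?h0' // hS hS'.
    - move=> a x x' y y' [h0 hS] [h0' hS']; split=> [|n]; rewrite linearP.
        by rewrite h0 h0' scaler0 addr0.
      by rewrite hS hS' !linearP.
  by exists d; split=> [x|n x]; [exact: (hd x).1 | exact: (hd x).2].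
have dK x : d (d x) = 0.
  apply: sep => -[|[|n]]; rewrite linear0 ?d0 // dS; first by rewrite d0 !linear0.
  by rewrite dS pi0 linear0.
have [j [j0 jS]] : exists j : {linear V -> I}, (forall v, pr 0%N (j v) = i 0%N v) /\
    (forall n v, pr n.+1 (j v) = 0).
  have [j hj] : exists j : {linear V -> I}, forall v, pr 0%N (j v) = i 0%N v /\
      (forall n, pr n.+1 (j v) = 0).
    apply: (linear_relation (R := fun v y => pr 0%N y = i 0%N v /\ (forall n, pr n.+1 y = 0))).
    - move=> v; have [y hy] := ex (fun n => if n is m.+1 then 0 else i 0%N v).
      by exists y; split=> [|n]; rewrite hy.
    - by move=> x y y' [h0 hS] [h0' hS']; apply: sep => -[|n]; rewrite ?h0 ?h0' // hS hS'.
    - move=> a x x' y y' [h0 hS] [h0' hS']; split=> [|n]; rewrite linearP.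
        by rewrite h0 h0' -linearP.
      by rewrite hS hS' scaler0 addr0.
  by exists j; split=> [x|n x]; [exact: (hj x).1 | exact: (hj x).2].
pose ID : difmod A := DifMod dK.
have jd v : j (dif (sphere V) v) = dif ID (j v).
  rewrite /= linear0; apply: sep => -[|n]; rewrite linear0 ?d0 // dS.
  by case: n => [|n]; rewrite ?j0 ?pi0 ?jS !linear0.
pose jD : @hom (Dif A) (sphere V) ID := @DifHom A (sphere V) ID j jd.
have mj : mono jD.
  by apply/(mono_injP (Dif_concrete A)) => v w /= e; apply: (iinj 0%N); rewrite -!j0 e.
have [CD [qD sD]] := al_coker abD mj.
exists ID, CD, jD, qD; split=> //.
- apply/(qis_mono sD); split=> [v _ [y /= ey] | y /= dy].
    by exists 0; apply: (iinj 0%N); rewrite -j0 /= ey d0 linear0.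
  have py n : p n (pr n y) = 0.
    by apply: (iinj n.+1); rewrite -dS dy !linear0.
  have [c hc] : exists c : forall n, C n, forall n, pr n y = i n (c n).
    by apply: (dep_choice (T := C) (R := fun n c => pr n y = i n c)) => n; have [_ _ h] := s n; apply/h/py.
  have [z hz] : exists z : forall n, J n, forall n, p n (z n) = c n.+1.
    by apply: (dep_choice (T := J) (R := fun n z => p n z = c n.+1)) => n; have [_ h _] := s n; exact: h.
  have [x hx] := ex z.
  exists (c 0%N), x; split=> //; apply: sep => -[|n]; rewrite linearD ?j0 ?d0 ?addr0 //.
  by rewrite jS dS hx hz hc add0r.
move=> T tT; apply: orth_homotopy.
  have [K [k [q [sK _ cK]]]] := tT.
  have sM := proj2 (Mod_sesP (k : @hom (Mod A) K T) q) sK.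
  have oJ n : @orth (Mod A) T (J n).
    by apply: (orth_extr abM sM); exact: (pair_orth cot).
  apply: (orth_by_retraction abM) => E a b sab.
  have [r hr] := dep_choice (fun n => orth_ext abM (pr n) (oJ n) sab).
  have [R hR] : exists R : {linear E -> I}, forall e n, pr n (R e) = r n e.
    apply: (linear_relation (R := fun e y => forall n, pr n y = r n e)).
    - by move=> e; exact: ex.
    - by move=> e y y' h h'; apply: sep => n; rewrite h h'.
    - by move=> x e e' y y' h h' n; rewrite !linearP h h'.
  exists R; apply: linear_ext => x; apply: sep => n /=; rewrite hR.
  exact: (congr1 (fun g : {linear I -> J n} => g x) (hr n)).
move=> phi ph; have {}ph x : phi (dif T x) = - d (phi x) := ph x.
(* What s_n must satisfy for the next step: phi_(n+1) + partial s_n then vanishes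
   on boundaries of T. *)
pose inv n (t : {linear T -> J n}) := forall x, p n (t (dif T x)) = p n (pr n (phi x)).
have [s0 es0] : exists s0 : {linear T -> J 0%N}, forall x, pr 0%N (phi x) = s0 (dif T x).
  have hl : linear (fun x => pr 0%N (phi x)) by move=> a x y; rewrite !linearP.
  have [|t et] := lift_through_dif cot (psi := mklin hl) tT (cJ 0%N).
    by move=> x; rewrite /= ph linearN d0 oppr0.
  by exists t => x; rewrite -et.
have stepS n (t : {t : {linear T -> J n} | inv n t}) :
    exists t' : {t' : {linear T -> J n.+1} | inv n.+1 t'},
    forall x, pr n.+1 (phi x) = sval t' (dif T x) - i n.+1 (p n (sval t x)).
  case: t => t ht /=.
  have hl : linear (fun x => pr n.+1 (phi x) + i n.+1 (p n (t x))).
    by move=> a x y; rewrite !linearP scalerDr addrACA.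
  have [|t' et] := lift_through_dif cot (psi := mklin hl) tT (cJ n.+1).
    by move=> x; rewrite /= ph linearN dS ht addNr.
  have ht' : inv n.+1 t' by move=> x; rewrite -et /= linearD pi0 addr0.
  by exists (exist _ t' ht') => x /=; rewrite -et /= addrK.
have [g hg] := dep_choice (fun n => dep_choice (stepS n)).
have inv0 : inv 0%N s0 by move=> x; rewrite es0.
pose u := fix u n : {t : {linear T -> J n} | inv n t} :=
  if n is m.+1 then g m (u m) else exist _ s0 inv0.
have [R hR] : exists R : {linear T -> I}, forall x n, pr n (R x) = sval (u n) x.
  apply: (linear_relation (R := fun x y => forall n, pr n y = sval (u n) x)).
  - by move=> x; exact: ex.
  - by move=> x y y' h h'; apply: sep => n; rewrite h h'.
  - by move=> a x x' y y' h h' n; rewrite !linearP h h'.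
exists R => x; apply: sep => -[|n]; rewrite linearB !hR.
  by rewrite d0 subr0 es0.
by rewrite dS hR; exact: hg.
Qed.


(** The dual construction, on the direct sum S of the P_n with differential
    P_(n+1) -> C_(n+1) -> P_n.  A map from S is determined by its restrictions to
    the P_n, so here it is the direct sum that lets the recursion go on forever. *)
Lemma sphere_resolution V : exists (P K : Dif A) (j : @hom (Dif A) K P) (q : @hom (Dif A) P (sphere V)),
  [/\ short_exact j q, exact_dif K & forall N, cycles_in cY N -> @orth (Dif A) P N].
Proof.
have step W : exists t : {P : lmodType A & {W' : lmodType A & ({linear W' -> P} * {linear P -> W})%type}},
    lin_exact (projT2 (projT2 t)).1 (projT2 (projT2 t)).2 /\ cX (projT1 t).
  have [_ [W' [P [i [p [/Mod_sesP s _ cP]]]]]] := cpl W.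
  by exists (existT _ P (existT _ W' (i, p))).
have [f hf] := dep_choice step.
pose C := fix C n : lmodType A := if n is n'.+1 then projT1 (projT2 (f (C n'))) else V.
pose P n := projT1 (f (C n)).
pose i n : {linear C n.+1 -> P n} := (projT2 (projT2 (f (C n)))).1.
pose p n : {linear P n -> C n} := (projT2 (projT2 (f (C n)))).2.
have s n : lin_exact (i n) (p n) := (hf (C n)).1.
have cP n : cX (P n) := (hf (C n)).2.
have pi0 n c : p n (i n c) = 0 by have [_ _ ex] := s n; apply/ex; exists c.
have iinj n : injective (i n) by have [] := s n.
clearbody i p; clearbody P.
have [S [pr [inj [sep ex bnd injE univ]]]] := directsum_universal P.
have [d dE] : exists d : {linear S -> S}, forall x n, pr n (d x) = i n (p n.+1 (pr n.+1 x)).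
  apply: (linear_relation (R := fun x y => forall n, pr n y = i n (p n.+1 (pr n.+1 x)))).
  - move=> x; have [m hm] := bnd x; apply: ex; exists m => n mn.
    by rewrite hm ?linear0 // (leq_trans mn).
  - by move=> x y y' h h'; apply: sep => n; rewrite h h'.
  - by move=> a x x' y y' h h' n; rewrite !linearP h h'.
have dK x : d (d x) = 0.
  by apply: sep => n; rewrite linear0 !dE pi0 linear0.
pose SD : difmod A := DifMod dK.
have ql : linear (fun x => p 0%N (pr 0%N x)) by move=> a x y; rewrite !linearP.
have qd x : mklin ql (d x) = dif (sphere V) (mklin ql x) by rewrite /= dE pi0.
pose qD : @hom (Dif A) SD (sphere V) := @DifHom A SD (sphere V) (mklin ql) qd.
have eq : epi qD.
  apply/(epi_surjP (Dif_concrete A)) => v /=.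
  have [_ ps _] := s 0%N; have [y ey] := ps v.
  by exists (inj 0%N y); rewrite (injE 0%N y).1.
have [KD [jD sD]] := al_ker abD eq.
exists SD, KD, jD, qD; split=> //.
- apply/(qis_epi sD); split=> [x /= dx [_ /= qx] | v _].
    have px n : p n (pr n x) = 0.
      case: n => [|n]; first exact: qx.
      by apply: (iinj n); rewrite -dE dx !linear0.
    have [z hz] : exists z : forall n, P n, z 0%N = 0 /\
        forall n, pr n x = i n (p n.+1 (z n.+1)) /\ (pr n x = 0 -> z n.+1 = 0).
      (* Zero is chosen wherever possible, to stay in the direct sum. *)
      have [z hz] : exists z : forall n, P n.+1, forall n,
          pr n x = i n (p n.+1 (z n)) /\ (pr n x = 0 -> z n = 0).
        apply: (dep_choice (T := fun n => P n.+1 : Type)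
          (R := fun n z => pr n x = i n (p n.+1 z) /\ (pr n x = 0 -> z = 0))) => n.
        have [x0|xn0] := pselect (pr n x = 0).
          by exists 0; rewrite x0 !linear0.
        have [_ _ h] := s n; have /h[c ec] := px n.
        have [_ h' _] := s n.+1; have [z ez] := h' c.
        by exists z; split=> [|e]; [rewrite ec ez | case: xn0].
      exists (fun n => if n is m.+1 then z m else 0); split=> // n; exact: hz.
    have [|z' hz'] := ex z.
      have [m hm] := bnd x; exists m.+1 => -[|n] // mn.
      by apply: (hz.2 n).2; exact: hm.
    by exists z'; apply: sep => n; rewrite dE hz' (hz.2 n).1.
  have [_ ps _] := s 0%N; have [y ey] := ps v.
  exists (inj 0%N y), 0; split; last by rewrite /= addr0 (injE 0%N y).1 ey.
  by apply: sep => n; rewrite linear0 dE (injE 0%N y).2 // !linear0.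
have dinj0 v : d (inj 0%N v) = 0.
  by apply: sep => n; rewrite linear0 dE (injE 0%N v).2 // !linear0.
have dinjS n v : d (inj n.+1 v) = inj n (i n (p n.+1 v)).
  apply: sep => m; rewrite dE; have [<-|nm] := eqVneq n m.
    by rewrite (injE n.+1 v).1 (injE n _).1.
  by rewrite (injE n.+1 v).2 ?eqSS // (injE n _).2 // !linear0.
move=> N tN; apply: orth_homotopy.
  have [K [k [q [sK _ cK]]]] := tN.
  have sM := proj2 (Mod_sesP (k : @hom (Mod A) K N) q) sK.
  have oP n : @orth (Mod A) (P n) N.
    by apply: (orth_extl abM sM); exact: (pair_orth cot).
  move=> E a b sab.
  have [r hr] := dep_choice (fun n => orth_lift abM (inj n) (oP n) sab).
  have [R [hR _]] := univ E r.
  exists R; apply: linear_ext => x.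
  have [F [_ uF]] := univ S inj.
  have -> : (idm (S : Mod A) : {linear S -> S}) x = F x by apply: (uF idfun).
  apply: (uF (comp (c := Mod A) b R)) => n v /=; rewrite hR.
  exact: (congr1 (fun g : {linear P n -> S} => g v) (hr n)).
move=> phi ph; have {}ph x : phi (d x) = - dif N (phi x) := ph x.
pose inv n (t : {linear P n -> N}) := forall w,
  phi (inj n (i n (p n.+1 w))) + dif N (t (i n (p n.+1 w))) = 0.
have [s0 es0] : exists s0 : {linear P 0%N -> N}, forall x, phi (inj 0%N x) = - dif N (s0 x).
  have hl : linear (fun x => - phi (inj 0%N x)).
    by move=> a x y; rewrite !linearP.
  have [|t et] := colift_through_dif cot (psi := mklin hl) (cP 0%N) tN.
    by move=> x; rewrite /= linearN -ph dinj0 linear0.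
  by exists t => x; rewrite -et /= opprK.
have stepS n (t : {t : {linear P n -> N} | inv n t}) :
    exists t' : {t' : {linear P n.+1 -> N} | inv n.+1 t'},
    forall w, phi (inj n.+1 w) = sval t (i n (p n.+1 w)) - dif N (sval t' w).
  case: t => t ht /=.
  have hl : linear (fun w => t (i n (p n.+1 w)) - phi (inj n.+1 w)).
    by move=> a x y; rewrite !linearP addrACA -scalerDr.
  have [|t' et] := colift_through_dif cot (psi := mklin hl) (cP n.+1) tN.
    by move=> x; rewrite /= linearB -[X in _ - X]opprK -ph opprK dinjS addrC ht.
  have ht' : inv n.+1 t'.
    by move=> w; rewrite -et /= pi0 !linear0 add0r subrr.
  by exists (exist _ t' ht') => x /=; rewrite -et /= opprB addrC subrK.
have [g hg] := dep_choice (fun n => dep_choice (stepS n)).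
have inv0 : inv 0%N s0 by move=> x; rewrite es0 addNr.
pose u := fix u n : {t : {linear P n -> N} | inv n t} :=
  if n is m.+1 then g m (u m) else exist _ s0 inv0.
have [R [hR _]] := univ N (fun n => sval (u n)).
have hl : linear (fun x => R (d x) - dif N (R x)).
  by move=> a x y; rewrite !linearP addrACA -scalerDr.
exists R => x.
have hl' n : linear (fun v => phi (inj n v)) by move=> a v w; rewrite !linearP.
have [F [_ uF]] := univ N (fun n => mklin (hl' n)).
rewrite (uF phi) // -(uF (mklin hl)) // => -[|n] v /=.
  by rewrite dinj0 linear0 sub0r hR es0.
by rewrite dinjS !hR; symmetry; exact: hg.
Qed.
End Resolutions.

(** * The induced cotorsion pairs *)
Section PairFromSpecial.
Variables (C : zcategory) (ab : abelianlike C) (cX : obclass C).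

Lemma rperp_rorth : rperp cX = rorth cX.
Proof.
apply/funext => N; apply/propext.
by split=> h X cx; [apply/(Ext1P ab)/h | apply/(Ext1P ab)/h].
Qed.

Hypotheses (hker : forall (X X' K : C) (j : hom K X) (q : hom X X'),
    short_exact j q -> cX X -> cX X' -> cX K)
  (hext : forall (X X' K : C) (j : hom K X) (q : hom X X'),
    short_exact j q -> cX K -> cX X' -> cX X)
  (hepi : forall M : C, exists X (q : hom X M), epi q /\ cX X)
  (hret : retract_closed_ob cX)
  (hemb : forall M : C, special_emb cX M).

(** An object M left orthogonal to the right class is a retract of the X in a
    special sequence Y -> X -> M, which splits. *)
Lemma pair_of_special : [/\ cotorsion_pair cX (rperp cX), complete_pair cX (rperp cX)
  & hereditary_pair cX (rperp cX)].
Proof.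
rewrite rperp_rorth; split.
- split=> [N | M]; first by rewrite rperp_rorth.
  split=> [h | cM].
    have [Y [X [i [p [s oY cx]]]]] := special_cover ab hext hepi M hemb.
    have [t et] := (proj1 (Ext1P ab M Y) (h Y oY)) _ _ _ s.
    exact: hret et cx.
  by move=> Y oY; apply/(Ext1P ab); exact: oY.
- move=> M; split; first exact: hemb.
  exact: (special_cover ab hext hepi M hemb).
- split=> [X X' p K i ep k c c' | Y' Y i K p mi k c c'].
    exact: hker (epi_ker_ses ab ep k) c c'.
  exact: (rorth_coker ab hker hepi (mono_coker_ses ab mi k) c c').
Qed.
End PairFromSpecial.

Section OpPairs.
Variables (C : zcategory) (ab : abelianlike C).
Let abo := abelianlike_op ab.

Lemma Ext1_op (M N : C) : @Ext1_zero (op C) N M <-> Ext1_zero M N.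
Proof.
split=> [/(Ext1P abo) h | /(Ext1P ab) h].
- exact/(Ext1P ab)/(op_orth ab).
- exact/(Ext1P abo)/(orth_op ab).
Qed.

Lemma rperp_op (c : obclass C) : @rperp (op C) c = @lperp C c.
Proof. by apply/funext => N; apply/propext; split=> h X cx;
  [exact: (proj1 (@Ext1_op _ _) (h X cx)) | exact: (proj2 (@Ext1_op _ _) (h X cx))]. Qed.

Lemma lperp_op (c : obclass C) : @lperp (op C) c = @rperp C c.
Proof. by apply/funext => N; apply/propext; split=> h X cx;
  [exact: (proj1 (@Ext1_op _ _) (h X cx)) | exact: (proj2 (@Ext1_op _ _) (h X cx))]. Qed.

Lemma cotorsion_op (c1 c2 : obclass C) : @cotorsion_pair (op C) c1 c2 -> cotorsion_pair c2 c1.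
Proof. by case; rewrite rperp_op lperp_op. Qed.

Lemma complete_op (c1 c2 : obclass C) : @complete_pair (op C) c1 c2 -> complete_pair c2 c1.
Proof.
move=> h M; have [[Y [X [i [p [s a b]]]]] [Y' [X' [i' [p' [s' a' b']]]]]] := h M; split.
- by exists X', Y', p', i'; split=> //; exact: op_short_exact.
- by exists X, Y, p, i; split=> //; exact: op_short_exact.
Qed.

Lemma hereditary_op (c1 c2 : obclass C) : @hereditary_pair (op C) c1 c2 -> hereditary_pair c2 c1.
Proof.
case=> h1 h2; split=> [X X' p K i ep k | Y' Y i K p mi k] c c'.
- exact: (h2 X' X p K i) c' c.
- exact: (h1 Y Y' i K p) c' c.
Qed.
End OpPairs.

Section InducedPairs.
Variable A : pzRingType.
Variables cX cY : obclass (Mod A).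
Hypotheses (cot : cotorsion_pair cX cY) (cpl : complete_pair cX cY)
  (her : hereditary_pair cX cY).
Let abM := @ModA A.
Let abD := @DifA A.

Lemma tildeX_cycles : tildeX cX = cycles_in cX.
Proof. exact: tildeX_cyclesE (retrX cot). Qed.

Lemma tildeY_cycles : tildeY cY = cycles_in cY.
Proof. exact: tildeY_cyclesE (retrY cot). Qed.

Lemma disk_coverX (M : Dif A) : exists (X : Dif A) (q : hom X M), epi q /\ cycles_in cX X.
Proof.
have [V [q [eq cV]]] := coverX cpl (dmod M).
have [f ef] := disk_cover (proj1 (epi_surjP (Mod_concrete A) q) eq).
by exists (disk V), f; split=> //; exact: cycles_in_disk.
Qed.

Lemma disk_embedY (M : Dif A) : exists (Y : Dif A) (j : hom M Y), mono j /\ cycles_in cY Y.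
Proof.
have [V [j [mj cV]]] := embedY cpl (dmod M).
have [f ef] := disk_embed (proj1 (mono_injP (Mod_concrete A) j) mj).
by exists (disk V), f; split=> //; exact: cycles_in_disk.
Qed.

(** Spheres first, then all objects as extensions of spheres. *)
Lemma cyclesX_special_emb (M : Dif A) : special_emb (cycles_in cX) M.
Proof.
have sphere_emb V : special_emb (cycles_in cX) (sphere V : Dif A).
  have [I [D [j [q [s eD oI]]]]] := sphere_coresolution cot cpl V.
  have [Y' [X' [j' [q' [s' tY tX]]]]] := exact_cover cot cpl her eD.
  apply: (special_emb_fix abD s s' oI _ tX) => T tT; exact: (orth_cycles cot).
have [Z [B [j [q s]]]] := sphere_filtration M.
apply: (special_emb_ext abD (cycles_in_ker (kerX her)) (cycles_in_ext (extX cot)) disk_coverX _ s) => //.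
move=> N; have [Y [f [mf tY]]] := disk_embedY N.
by exists Y, f; split=> // T tT; exact: (orth_cycles cot).
Qed.

Lemma cyclesY_special_cover (M : Dif A) : @special_emb (op (Dif A)) (cycles_in cY) M.
Proof.
have abo := abelianlike_op abD.
have oo (T N : Dif A) : cycles_in cX T -> cycles_in cY N -> @orth (op (Dif A)) N T.
  by move=> tT tN; apply: (orth_op abD); exact: (orth_cycles cot).
have sphere_emb V : @special_emb (op (Dif A)) (cycles_in cY) (sphere V).
  have [P [K [j [q [s eK oP]]]]] := sphere_resolution cot cpl V.
  have [Y' [X' [j' [q' [s' tY tX]]]]] := exact_emb cot cpl her eK.
  apply: (special_emb_fix abo (short_exact_op s) (short_exact_op s') _ _ tY) => T tT.
    by apply: (orth_op abD); exact: oP.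
  exact: oo.
have [Z [B [j [q s]]]] := sphere_filtration M.
apply: (@special_emb_ext (op (Dif A)) abo (cycles_in cY) _ _ _ _ _ _ _ _ _ (short_exact_op s)) => //.
- by move=> X X' K j' q' /op_short_exact s' c c'; exact: (cycles_in_coker (cokerY her) s' c' c).
- by move=> X X' K j' q' /op_short_exact s' c c'; exact: (cycles_in_ext (extY cot) s' c' c).
- exact: disk_embedY.
move=> N; have [Y [f [mf tY]]] := disk_coverX N.
by exists Y, f; split=> // T tT; exact: oo.
Qed.

Theorem tildeX_dgY_pair : [/\ cotorsion_pair (tildeX cX) (dgY cX),
  complete_pair (tildeX cX) (dgY cX) & hereditary_pair (tildeX cX) (dgY cX)].
Proof.
rewrite /dgY tildeX_cycles; apply: (pair_of_special abD).
- exact: cycles_in_ker (kerX her).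
- exact: cycles_in_ext (extX cot).
- exact: disk_coverX.
- exact: cycles_in_retract (retrX cot).
- exact: cyclesX_special_emb.
Qed.

Theorem dgX_tildeY_pair : [/\ cotorsion_pair (dgX cY) (tildeY cY),
  complete_pair (dgX cY) (tildeY cY) & hereditary_pair (dgX cY) (tildeY cY)].
Proof.
have [] := @pair_of_special (op (Dif A)) (abelianlike_op abD) (cycles_in cY).
- by move=> X X' K j' q' /op_short_exact s' c c'; exact: (cycles_in_coker (cokerY her) s' c' c).
- by move=> X X' K j' q' /op_short_exact s' c c'; exact: (cycles_in_ext (extY cot) s' c' c).
- exact: disk_embedY.
- by move=> M M' i r e; exact: (cycles_in_retract (retrY cot) (i := r) (r := i) e).
- exact: cyclesY_special_cover.
rewrite (rperp_op abD) /dgX tildeY_cycles => h1 h2 h3; split.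
- exact: (cotorsion_op abD).
- exact: (complete_op (c1 := cycles_in cY)).
- exact: (hereditary_op (c1 := cycles_in cY)).
Qed.

(** An exact cover Y -> X -> M has Y in tilde Y, so it splits when M is in dg X. *)
Lemma tildeX_exact (M : Dif A) : tildeX cX M <-> dgX cY M /\ exact_dif M.
Proof.
rewrite /dgX tildeX_cycles tildeY_cycles; split=> [t | [h e]].
  split; last exact: cycles_in_exact t.
  by move=> Y tY; apply/(Ext1P abD); exact: (orth_cycles cot).
have [Y [X [i [p [s tY tX]]]]] := exact_cover cot cpl her e.
have [t et] := (proj1 (Ext1P abD M Y) (h Y tY)) _ _ _ s.
exact: (cycles_in_retract (retrX cot)) et tX.
Qed.

Lemma tildeY_exact (M : Dif A) : tildeY cY M <-> dgY cX M /\ exact_dif M.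
Proof.
rewrite /dgY tildeX_cycles tildeY_cycles; split=> [t | [h e]].
  split; last exact: cycles_in_exact t.
  by move=> Y tY; apply/(Ext1P abD); exact: (orth_cycles cot).
have [Y [X [i [p [s tY tX]]]]] := exact_emb cot cpl her e.
have [t et] := orthr abD (proj1 (Ext1P abD X M) (h X tX)) s.
exact: (cycles_in_retract (retrY cot)) et tY.
Qed.

Theorem induced_compatible :
  compatible_pairs (dgX cY) (tildeY cY) (tildeX cX) (dgY cX).
Proof.
split=> [X V | Z].
  by rewrite tildeX_cycles tildeY_cycles => tX tV; apply/(Ext1P abD); exact: (orth_cycles cot).
by rewrite tildeX_exact tildeY_exact; split=> [[[? ?] ?] | [? [? ?]]].
Qed.

Theorem induced_model : exists M : model_structure (Dif A),
  [/\ abelian_model M,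
      forall X : Dif A, cofibrant M X <-> dgX cY X,
      forall X : Dif A, fibrant M X <-> dgY cX X
    & forall X : Dif A, trivial_ob M X <-> exact_dif X].
Proof.
have [c1 p1 _] := tildeX_dgY_pair; have [c2 p2 _] := dgX_tildeY_pair.
have e0 : exact_dif (zob : Dif A).
  move=> x; split=> [_|[y ->]]; last exact: difK.
  by exists 0; rewrite linear0; exact: thinmx0.
have tX := tildeX_exact; have tY := tildeY_exact.
pose M := hovey_model abD c2 p2 c1 p1 tX tY (@qis_23 A) (@qis_retract A) (@qis_mono A) (@qis_epi A).
exists M; split.
- exact: hovey_abelian.
- exact: hovey_cofibrant.
- exact: hovey_fibrant.
- exact: hovey_trivial.
Qed.
End InducedPairs.

(** * The pair of projective modules and all modules *)
Section ProjectivePair.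
Variable A : nzRingType.
Let abM := @ModA A.

Definition all_ob : obclass (Mod A) := fun _ => True.
Definition proj_ob : obclass (Mod A) := lperp all_ob.

Lemma fglift_linear (V : lmodType A) (K : choiceType) (f : K -> V) :
  linear (fglift f : {freeg K / A} -> V).
Proof.
move=> a x y; have fa := lift_is_additive f.
have fD u v : fglift f (u + v) = fglift f u + fglift f v.
  have f0 : fglift f 0 = 0 by have := fa 0 0; rewrite !subrr.
  by have := fa u (- v); rewrite opprK => ->; have := fa 0 v; rewrite !sub0r f0 sub0r => ->; rewrite opprK.
have f0 : fglift f 0 = 0 by have := fa 0 0; rewrite !subrr.
rewrite fD; congr (_ + _).
have fs (I : Type) (r : seq I) (F : I -> {freeg K / A}) :
    fglift f (\sum_(i <- r) F i) = \sum_(i <- r) fglift f (F i).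
  by elim: r => [|i r IH]; rewrite ?big_nil // !big_cons fD IH.
rewrite -{2}[x]freeg_sumE [a *: _]/(fgscale a x) /fgscale !fs scaler_sumr.
by apply: eq_bigr => i _; rewrite !liftU scalerA.
Qed.

Lemma free_ext (V : lmodType A) (K : choiceType) (f g : {linear {freeg K / A} -> V}) :
  (forall z, f << z >> = g << z >>) -> f =1 g.
Proof.
move=> h x; rewrite -[x]freeg_sumE !linear_sum; apply: eq_bigr => z _ /=.
have -> : << coeff z x *g z >> = coeff z x *: << z >> :> {freeg K / A}.
  by apply/eqP/freeg_eqP => y; rewrite coeffZ !coeffU mul1r.
by rewrite !linearZ /= h.
Qed.

Lemma free_projective (K : choiceType) : proj_ob ({freeg K / A} : lmodType A).
Proof.
move=> N _; apply/(Ext1P abM) => E j p /Mod_sesP[_ ps _].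
have [e he] := choice (fun x : K => ps << x >>).
exists (mklin (fglift_linear e)); apply: linear_ext.
by apply: free_ext => z /=; rewrite liftU scale1r he.
Qed.

Lemma projective_cover (M : Mod A) : exists (P : Mod A) (q : hom P M), epi q /\ proj_ob P.
Proof.
exists ({freeg (M : lmodType A) / A} : lmodType A), (mklin (fglift_linear (idfun : M -> M))).
split; last exact: free_projective.
by apply/(epi_surjP (Mod_concrete A)) => x; exists << x >>; rewrite /= liftU scale1r.
Qed.

Lemma projective_cotorsion : cotorsion_pair proj_ob all_ob.
Proof. by split=> [N | M]; split=> // _ X; exact. Qed.

Lemma projective_complete : complete_pair proj_ob all_ob.
Proof.
move=> M; split.
  exists M, zob, (idm M), (to0 M); split=> //; first exact: ses_id_to0.
  move=> Y _; apply/(Ext1P abM) => E i p s; exists (from0 E).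
  by rewrite [LHS]from0_uniq [RHS]from0_uniq.
have [P [q [eq cP]]] := projective_cover M; have [K [i s]] := al_ker abM eq.
by exists K, P, i, q.
Qed.

Lemma projective_hereditary : hereditary_pair proj_ob all_ob.
Proof.
split=> // X X' p K i ep ki h h'.
have s := epi_ker_ses abM ep ki.
move=> N _; apply/(Ext1P abM)/(op_orth abM).
apply: (@rorth_coker (op (Mod A)) (abelianlike_op abM) all_ob _ _ X' X K p i) => //.
- by move=> M; exists M, (idm M); split=> // T u v; rewrite !compm1.
- exact: short_exact_op.
- by move=> Y _; apply/(orth_op abM)/(Ext1P abM)/h'.
- by move=> Y _; apply/(orth_op abM)/(Ext1P abM)/h.
Qed.

Lemma tildeY_all : tildeY all_ob = @exact_dif A.
Proof.
rewrite tildeY_cyclesE //; apply/funext => T; apply/propext; split; first exact: cycles_in_exact.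
by move=> /exact_dif_cycles[K [i [p [s dE]]]]; exists K, i, p.
Qed.

(** T is an extension of spheres, and spheres on modules of the right class are
    always in dg Y; here that class contains every module. *)
Lemma dgY_proj (T : Dif A) : dgY proj_ob T.
Proof.
have cot := projective_cotorsion; have abD := @DifA A.
rewrite /dgY (tildeX_cycles cot) (rperp_rorth abD) => X tX.
have [Z [B [j [q s]]]] := sphere_filtration T.
by apply: (orth_extl abD s); apply: (orth_cycles_sphere cot tX).
Qed.

Lemma projective_model : exists M : model_structure (Dif A),
  [/\ abelian_model M,
      forall X : Dif A, cofibrant M X <-> lperp (@exact_dif A) X,
      forall X : Dif A, fibrant M X
    & forall X : Dif A, trivial_ob M X <-> exact_dif X].
Proof.
have [M [h1 h2 h3 h4]] :=
  induced_model projective_cotorsion projective_complete projective_hereditary.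
exists M; split=> // [X | X]; first by rewrite h2 /dgX tildeY_all.
by apply/h3; exact: dgY_proj.
Qed.
End ProjectivePair.

(** * Moving a model structure along a fully faithful functor, onto on objects *)
Section Transport.
Variables (C D : zcategory) (F : functor C D).
Hypotheses (Ffull : forall (X Y : C) (g : hom (F X) (F Y)), exists f, fmap F f = g)
  (Ffaith : forall (X Y : C) (f g : hom X Y), fmap F f = fmap F g -> f = g)
  (Fsurj : forall Y : D, exists X, F X = Y).
Implicit Types X Y Z K : C.

Lemma transport_zero X Y : fmap F (zero_mor X Y) = zero_mor (F X) (F Y).
Proof.
rewrite /zero_mor fmapM.
have [g eg] := Ffull (zero_mor (F X) (F (zob : C))).
by rewrite -(to0_uniq g) eg comp_zero.
Qed.

Lemma transport_mono X Y (f : hom X Y) : mono f <-> mono (fmap F f).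
Proof.
split=> [mf T | mf T g h e]; last by apply/Ffaith/mf; rewrite -!fmapM e.
have [X' <-] := Fsurj T => g h; have [g' <-] := Ffull g; have [h' <-] := Ffull h.
by rewrite -!fmapM => /Ffaith/mf ->.
Qed.

Lemma transport_epi X Y (f : hom X Y) : epi f <-> epi (fmap F f).
Proof.
split=> [mf T | mf T g h e]; last by apply/Ffaith/mf; rewrite -!fmapM e.
have [X' <-] := Fsurj T => g h; have [g' <-] := Ffull g; have [h' <-] := Ffull h.
by rewrite -!fmapM => /Ffaith/mf ->.
Qed.

Lemma transport_kernel X Y K (f : hom X Y) (i : hom K X) :
  is_kernel f i <-> is_kernel (fmap F f) (fmap F i).
Proof.
split=> -[e h]; split.
- by rewrite -fmapM e transport_zero.
- move=> T; have [X' <-] := Fsurj T => g; have [g' <-] := Ffull g.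
  rewrite -fmapM -transport_zero => /Ffaith/h[u [<- uq]].
  exists (fmap F u); split; first by rewrite fmapM.
  by move=> v; have [v' <-] := Ffull v; rewrite -!fmapM => /Ffaith/uq ->.
- by apply: Ffaith; rewrite fmapM e transport_zero.
- move=> T g e'; have := congr1 (fmap F (Y := Y)) e'; rewrite fmapM transport_zero.
  move=> /h[u [eu uq]]; have [u' eu'] := Ffull u; exists u'; split.
    by apply: Ffaith; rewrite fmapM eu'.
  by move=> v ev; apply: Ffaith; rewrite eu'; apply: uq; rewrite -fmapM ev.
Qed.

Lemma transport_cokernel X Y K (f : hom X Y) (i : hom Y K) :
  is_cokernel f i <-> is_cokernel (fmap F f) (fmap F i).
Proof.
split=> -[e h]; split.
- by rewrite -fmapM e transport_zero.
- move=> T; have [X' <-] := Fsurj T => g; have [g' <-] := Ffull g.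
  rewrite -fmapM -transport_zero => /Ffaith/h[u [<- uq]].
  exists (fmap F u); split; first by rewrite fmapM.
  by move=> v; have [v' <-] := Ffull v; rewrite -!fmapM => /Ffaith/uq ->.
- by apply: Ffaith; rewrite fmapM e transport_zero.
- move=> T g e'; have := congr1 (fmap F (Y := T)) e'; rewrite fmapM transport_zero.
  move=> /h[u [eu uq]]; have [u' eu'] := Ffull u; exists u'; split.
    by apply: Ffaith; rewrite fmapM eu'.
  by move=> v ev; apply: Ffaith; rewrite eu'; apply: uq; rewrite -fmapM ev.
Qed.

Lemma transport_ses X Y Z (i : hom X Y) (p : hom Y Z) :
  short_exact i p <-> short_exact (fmap F i) (fmap F p).
Proof. by rewrite /short_exact -transport_kernel -transport_cokernel. Qed.

Lemma transport_Ext X Y : Ext1_zero X Y <-> Ext1_zero (F X) (F Y).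
Proof.
split=> h; last first.
  move=> [E1 i1 p1 s1] [E2 i2 p2 s2].
  have [u [/= u1 u2]] := h (Extension (proj1 (transport_ses _ _) s1)) (Extension (proj1 (transport_ses _ _) s2)).
  by have [u' eu] := Ffull u; exists u'; split; apply: Ffaith; rewrite fmapM eu.
move=> [E1 i1 p1 s1] [E2 i2 p2 s2]; rewrite /ext_equiv /=.
have [E1' e1] := Fsurj E1; have [E2' e2] := Fsurj E2; subst E1 E2.
have [i1' ei1] := Ffull i1; have [i2' ei2] := Ffull i2.
have [p1' ep1] := Ffull p1; have [p2' ep2] := Ffull p2; subst i1 i2 p1 p2.
have [u [/= u1 u2]] := h (Extension (proj2 (transport_ses _ _) s1)) (Extension (proj2 (transport_ses _ _) s2)).
by exists (fmap F u); rewrite -!fmapM u1 u2.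
Qed.

Variable M : model_structure D.
Hypothesis Mab : abelian_model M.

Lemma weq_id (X : D) : weq M (idm X).
Proof.
have [Z [i [p [[_ wi] _ e]]]] := tcof_fib_factor M (idm X).
apply: (@weq_retract _ M _ _ _ _ (idm X) i _ wi).
by exists (idm X), (idm X), i, p; split; rewrite ?comp1m ?compm1.
Qed.

Lemma iso_weq (X Y : D) (f : hom X Y) : is_iso f -> weq M f.
Proof.
move=> [g [gf fg]]; apply: (@weq_retract _ M _ _ _ _ f (idm X) _ (weq_id X)).
by exists (idm X), (idm X), g, f; split; rewrite ?comp1m ?compm1.
Qed.

(** Surjectivity on objects, rather than up to isomorphism, makes the factorizations
    pull back without any correction. *)
Definition pull_model : model_structure C.
Proof.
refine (@ModelStructure C (fun X Y f => weq M (fmap F f)) (fun X Y f => cof M (fmap F f))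
  (fun X Y f => fib M (fmap F f)) _ _ _ _ _ _ _ _).
- by move=> X Y Z f g; rewrite fmapM; exact: weq_23.
- move=> X Y X' Y' f g [i [r [j [s [e1 e2 e3 e4]]]]]; apply: weq_retract.
  exists (fmap F i), (fmap F r), (fmap F j), (fmap F s).
  by rewrite -!fmapM e1 e2 e3 e4 !fmap1.
- move=> X Y X' Y' f g [i [r [j [s [e1 e2 e3 e4]]]]]; apply: cof_retract.
  exists (fmap F i), (fmap F r), (fmap F j), (fmap F s).
  by rewrite -!fmapM e1 e2 e3 e4 !fmap1.
- move=> X Y X' Y' f g [i [r [j [s [e1 e2 e3 e4]]]]]; apply: fib_retract.
  exists (fmap F i), (fmap F r), (fmap F j), (fmap F s).
  by rewrite -!fmapM e1 e2 e3 e4 !fmap1.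
- move=> X Y X' Y' i p f g ci fp e.
  have [|h [h1 h2]] := tcof_fib_lift ci fp (f := fmap F f) (g := fmap F g).
    by rewrite -!fmapM e.
  have [h' eh] := Ffull h; exists h'.
  by split; apply: Ffaith; rewrite fmapM eh.
- move=> X Y X' Y' i p f g ci fp e.
  have [|h [h1 h2]] := cof_tfib_lift ci fp (f := fmap F f) (g := fmap F g).
    by rewrite -!fmapM e.
  have [h' eh] := Ffull h; exists h'.
  by split; apply: Ffaith; rewrite fmapM eh.
- move=> X Y f; have [Z [i [p [hi hp e]]]] := tcof_fib_factor M (fmap F f).
  have [Z' eZ] := Fsurj Z; subst Z.
  have [i' ei] := Ffull i; have [p' ep] := Ffull p; subst i p.
  by exists Z', i', p'; split=> //; apply: Ffaith; rewrite fmapM.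
- move=> X Y f; have [Z [i [p [hi hp e]]]] := cof_tfib_factor M (fmap F f).
  have [Z' eZ] := Fsurj Z; subst Z.
  have [i' ei] := Ffull i; have [p' ep] := Ffull p; subst i p.
  by exists Z', i', p'; split=> //; apply: Ffaith; rewrite fmapM.
Defined.

Lemma zob_iso : is_iso (to0 (F zob)).
Proof.
exists (from0 (F zob)); split; last by rewrite [LHS]to0_uniq [RHS]to0_uniq.
have [g eg] := Ffull (from0 (F zob) ∘ to0 (F zob)).
by rewrite -eg (to0_uniq g) -(to0_uniq (idm zob)) fmap1.
Qed.

Lemma from_zob_uniq Y (f g : hom (F zob) (F Y)) : f = g.
Proof.
have [f' <-] := Ffull f; have [g' <-] := Ffull g.
by rewrite (from0_uniq f') (from0_uniq g').
Qed.

Lemma to_zob_uniq Y (f g : hom (F Y) (F zob)) : f = g.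
Proof.
have [f' <-] := Ffull f; have [g' <-] := Ffull g.
by rewrite (to0_uniq f') (to0_uniq g').
Qed.

(** F 0 is a zero object but need not be the chosen one, so F (0 -> X) and
    0 -> F X are compared as retracts of each other. *)
Lemma pull_cofibrant X : cofibrant pull_model X <-> cofibrant M (F X).
Proof.
have [g [g1 g2]] := zob_iso.
split.
- apply: (@cof_retract _ M _ _ _ _ (from0 (F X)) (fmap F (from0 X))).
  exists g, (to0 (F zob)), (idm _), (idm _); split; rewrite ?comp1m ?compm1 //.
  + exact: from0_uniq.
  + exact: from_zob_uniq.
- apply: (@cof_retract _ M _ _ _ _ (fmap F (from0 X)) (from0 (F X))).
  exists (to0 (F zob)), g, (idm _), (idm _); split; rewrite ?comp1m ?compm1 //.
  + exact: from_zob_uniq.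
  + exact: from0_uniq.
Qed.

Lemma pull_fibrant X : fibrant pull_model X <-> fibrant M (F X).
Proof.
have [g [g1 g2]] := zob_iso.
split.
- apply: (@fib_retract _ M _ _ _ _ (to0 (F X)) (fmap F (to0 X))).
  exists (idm _), (idm _), g, (to0 (F zob)); split; rewrite ?comp1m ?compm1 //.
    by apply: to_zob_uniq.
  by symmetry; apply: to0_uniq.
- apply: (@fib_retract _ M _ _ _ _ (fmap F (to0 X)) (to0 (F X))).
  exists (idm _), (idm _), (to0 (F zob)), g; split; rewrite ?comp1m ?compm1 //.
    by symmetry; apply: to0_uniq.
  by apply: to_zob_uniq.
Qed.

Lemma pull_weakly_equivalent (Y1 Y2 : D) : weakly_equivalent M Y1 Y2 ->
  forall X1 X2, F X1 = Y1 -> F X2 = Y2 -> weakly_equivalent pull_model X1 X2.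
Proof.
elim=> {Y1 Y2} [Y1 Y2 [f w] | Y | Y1 Y2 _ h | Y1 Y2 Y3 _ h1 _ h2] X1 X2 e1 e2.
- subst Y1 Y2; have [f' ef] := Ffull f; apply: rst_step; exists f'.
  by rewrite /= ef.
- have [f ef] : exists f : hom X1 X2, is_iso (fmap F f).
    rewrite -e2 in e1; have : exists f : hom (F X1) (F X2), is_iso f.
      by rewrite e1; exists (idm _), (idm _); rewrite comp1m.
    by move=> [f hf]; have [f' ef] := Ffull f; exists f'; rewrite ef.
  by apply: rst_step; exists f; exact: iso_weq.
- by apply: rst_sym; exact: h.
- by have [X e] := Fsurj Y2; apply: rst_trans (h1 _ _ e1 e) (h2 _ _ e e2).
Qed.

Lemma push_weakly_equivalent X1 X2 :
  weakly_equivalent pull_model X1 X2 -> weakly_equivalent M (F X1) (F X2).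
Proof.
elim=> {X1 X2} [X1 X2 [f w] | X | X1 X2 _ h | X1 X2 X3 _ h1 _ h2].
- by apply: rst_step; exists (fmap F f).
- exact: rst_refl.
- exact: rst_sym.
- exact: rst_trans h1 h2.
Qed.

Lemma pull_trivial X : trivial_ob pull_model X <-> trivial_ob M (F X).
Proof.
have z : weakly_equivalent M (F zob) zob.
  by apply: rst_step; exists (to0 (F zob)); exact/iso_weq/zob_iso.
split=> [/push_weakly_equivalent h | h]; first exact: rst_trans h z.
by apply: (pull_weakly_equivalent (rst_trans _ _ _ _ _ h (rst_sym _ _ _ _ z))).
Qed.

Lemma pull_abelian : abelian_model pull_model.
Proof.
have exC X Y (f : hom X Y) (P : D -> Prop) (Q : C -> Prop) : (forall X, Q X <-> P (F X)) ->
    (exists (K : D) (p : hom (F Y) K), is_cokernel (fmap F f) p /\ P K) <->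
    (exists K (p : hom Y K), is_cokernel f p /\ Q K).
  move=> PQ; split=> -[K [p [h k]]].
    have [K' e] := Fsurj K; subst K; have [p' e] := Ffull p; subst p.
    by exists K', p'; split; [exact/transport_cokernel | exact/PQ].
  by exists (F K), (fmap F p); split; [exact/transport_cokernel | exact/PQ].
have exK X Y (f : hom X Y) (P : D -> Prop) (Q : C -> Prop) : (forall X, Q X <-> P (F X)) ->
    (exists (K : D) (p : hom K (F X)), is_kernel (fmap F f) p /\ P K) <->
    (exists K (p : hom K X), is_kernel f p /\ Q K).
  move=> PQ; split=> -[K [p [h k]]].
    have [K' e] := Fsurj K; subst K; have [p' e] := Ffull p; subst p.
    by exists K', p'; split; [exact/transport_kernel | exact/PQ].
  by exists (F K), (fmap F p); split; [exact/transport_kernel | exact/PQ].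
have cf X := pull_cofibrant X; have fb X := pull_fibrant X; have tr X := pull_trivial X.
have and3E (P Q R : Prop) : [/\ P, Q & R] <-> P /\ (Q /\ R) by split=> [[]|[? []]].
have ex3 (E : Type) (H : E -> Type) (P : forall e, H e -> Prop) (Q R : E -> Prop) :
    (exists e (p : H e), [/\ P e p, Q e & R e]) <-> (exists e (p : H e), P e p /\ (Q e /\ R e)).
  by split=> -[e [p h]]; exists e, p; exact/and3E.
move=> X Y f; have [h1 h2 h3 h4] := Mab (fmap F f); split.
- apply: (iff_trans h1); rewrite -transport_mono.
  by rewrite (exC _ _ f _ _ cf).
- apply: (iff_trans h2); rewrite -transport_mono !ex3.
  by rewrite (exC _ _ f (fun K : D => cofibrant M K /\ trivial_ob M K)
       (fun K => cofibrant pull_model K /\ trivial_ob pull_model K)) // => K; rewrite cf tr.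
- apply: (iff_trans h3); rewrite -transport_epi.
  by rewrite (exK _ _ f _ _ fb).
- apply: (iff_trans h4); rewrite -transport_epi !ex3.
  by rewrite (exK _ _ f (fun K : D => fibrant M K /\ trivial_ob M K)
       (fun K => fibrant pull_model K /\ trivial_ob pull_model K)) // => K; rewrite fb tr.
Qed.
End Transport.

(** Factor f as a cofibration i followed by a trivial fibration p.  The latter lies
    in W since its kernel is trivial, so both sides are reduced to i, for which they
    say that the cokernel of i is trivial. *)
Lemma abelian_weq (C : zcategory) (M : model_structure C) (E : obclass C) (W : morclass C) :
  abelian_model M -> (forall X, trivial_ob M X <-> E X) -> two_of_three W ->
  (forall (X Y K : C) (i : hom X Y) (p : hom Y K), mono i -> is_cokernel i p -> (W _ _ i <-> E K)) ->
  (forall (X Y K : C) (i : hom K X) (p : hom X Y), epi p -> is_kernel p i -> (W _ _ p <-> E K)) ->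
  forall (X Y : C) (f : hom X Y), weq M f <-> W _ _ f.
Proof.
move=> ab tr W23 Wm We X Y f.
have [Z [i [p [ci tp ->]]]] := cof_tfib_factor M f.
have [_ _ _ h4] := ab _ _ p; have [h1 h2 _ _] := ab _ _ i.
have Wp : W _ _ p by have /h4[ep [K [k [hk _ /tr e]]]] := tp; apply/(We _ _ _ _ _ ep hk).
have [m23 _ l23] := @weq_23 _ M _ _ _ i p; have [n23 _ k23] := W23 _ _ _ i p.
suff iE : weq M i <-> W _ _ i.
  split=> [h | h]; first by apply: n23 Wp; apply/iE/l23 => //; case: tp.
  by apply: m23; [apply/iE/k23 | case: tp].
split=> [wi | Wi].
  have /h2[mi [K [k [hk _ /tr e]]]] : cof M i /\ weq M i by [].
  exact/(Wm _ _ _ _ _ mi hk).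
have /h1[mi [K [k [hk ck]]]] := ci.
suff : cof M i /\ weq M i by case.
by apply/h2; split=> //; exists K, k; split=> //; apply/tr/(Wm _ _ _ _ _ mi hk).
Qed.

(** * Equivalences of localizations *)
Section LocFunctor.
Variables (C D : category) (WC : morclass C) (WD : morclass D) (F : functor C D).
Hypothesis FW : forall (X Y : C) (f : hom X Y), WC f -> WD (fmap F f).

Fixpoint zz_map (X Y : C) (s : zigzag WC X Y) : zigzag WD (F X) (F Y) :=
  match s in zigzag _ X Y return zigzag WD (F X) (F Y) with
  | zz_nil X => zz_nil WD (F X)
  | zz_fwd _ _ _ f s' => zz_fwd (fmap F f) (zz_map s')
  | zz_bwd _ _ _ w Ww s' => zz_bwd (FW Ww) (zz_map s')
  end.

Lemma zz_map_cat (X Y Z : C) (s : zigzag WC X Y) (t : zigzag WC Y Z) :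
  zz_map (zz_cat s t) = zz_cat (zz_map s) (zz_map t).
Proof. by elim: s t => //= [X' Y' Z' f s IH|X' Y' Z' w Ww s IH] t; rewrite IH. Qed.

Lemma zz_map_eq (X Y : C) (s t : zigzag WC X Y) : zz_eq s t -> zz_eq (zz_map s) (zz_map t).
Proof.
elim=> /= {X Y s t}.
- by move=> *; apply: zz_refl.
- by move=> *; apply: zz_sym.
- by move=> X Y s t u _ h _; apply: zz_trans h.
- by move=> *; apply: zz_fwd_congr.
- by move=> *; apply: zz_bwd_congr.
- by move=> *; rewrite fmap1; apply: zz_id.
- by move=> *; rewrite fmapM; apply: zz_comp.
- by move=> *; apply: zz_fwdK.
- by move=> *; apply: zz_bwdK.
Qed.

Definition loc_functor : functor (localization WC) (localization WD).
Proof.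
refine (@Functor (localization WC) (localization WD) F
  (fun X Y (h : loc_hom WC X Y) => zz_class (zz_map (zz_repr h))) _ _).
- move=> X; apply/zz_class_eq; exact: (zz_map_eq (zz_classK (zz_nil WC X))).
- move=> X Y Z g f; apply/zz_class_eq.
  apply: (zz_trans (zz_map_eq (zz_classK _))); rewrite zz_map_cat.
  by apply: zz_sym; apply: zz_cat_congr; exact: zz_classK.
Defined.

Lemma loc_functor_class (X Y : C) (s : zigzag WC X Y) :
  fmap loc_functor (zz_class s : @hom (localization WC) X Y) = zz_class (zz_map s).
Proof. by apply/zz_class_eq; exact: zz_map_eq (zz_classK s). Qed.
End LocFunctor.

Section LocNat.
Variables (C : category) (W : morclass C).

Definition loc_mor (X Y : C) (f : hom X Y) : @hom (localization W) X Y :=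
  zz_class (zz_fwd f (zz_nil W Y)).

Lemma loc_compE (X Y Z : C) (s : zigzag W X Y) (t : zigzag W Y Z) :
  comp (c := localization W) (zz_class t) (zz_class s) = zz_class (zz_cat s t).
Proof. by apply/zz_class_eq; apply: zz_cat_congr; exact: zz_classK. Qed.

Lemma loc_mor_iso (X Y : C) (f : hom X Y) : is_iso f -> is_iso (loc_mor f).
Proof.
have fe (U : C) (g : hom U U) : g = idm U -> zz_eq (zz_fwd g (zz_nil W U)) (zz_nil W U).
  by move=> ->; exact: zz_id.
move=> [g [gf fg]]; exists (loc_mor g); rewrite !loc_compE /=; split; apply/zz_class_eq.
- exact: zz_trans (zz_comp _ _ _) (fe _ _ gf).
- exact: zz_trans (zz_comp _ _ _) (fe _ _ fg).
Qed.
End LocNat.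

Section LocEquiv.
Variables (C D : category) (WC : morclass C) (WD : morclass D).
Variables (F : functor C D) (G : functor D C).
Hypothesis FW : forall (X Y : C) (f : hom X Y), WC f -> WD (fmap F f).
Hypothesis GW : forall (X Y : D) (f : hom X Y), WD f -> WC (fmap G f).
Variable eta : forall X : C, hom X (G (F X)).
Hypothesis eta_nat : forall (X Y : C) (f : hom X Y), fmap G (fmap F f) ∘ eta X = eta Y ∘ f.

(** Naturality with respect to the zigzag s, by induction on its length; for a
    reversed arrow w one inserts w^-1 w in front and moves w across the unit. *)
Lemma loc_unit_nat (X Y : C) (s : zigzag WC X Y) :
  zz_eq (zz_fwd (eta X) (zz_map GW (zz_map FW s)))
        (zz_cat s (zz_fwd (eta Y) (zz_nil WC (G (F Y))))).
Proof.
elim: s => [X'|X' Y' Z f s IH|X' Y' Z w Ww s IH] /=; first exact: zz_refl.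
  apply: zz_trans (zz_comp _ _ _) _; rewrite eta_nat.
  by apply: zz_trans (zz_sym (zz_comp _ _ _)) _; exact: zz_fwd_congr.
apply: zz_trans (zz_sym (zz_bwdK Ww _)) _; apply: zz_bwd_congr.
apply: zz_trans (zz_comp _ _ _) _; rewrite -eta_nat.
apply: zz_trans (zz_sym (zz_comp _ _ _)) _.
by apply: zz_trans _ IH; apply: zz_fwd_congr; exact: zz_fwdK.
Qed.

Lemma loc_unit (X Y : C) (f : @hom (localization WC) X Y) :
  comp (c := localization WC) (fmap (loc_functor GW) (fmap (loc_functor FW) f)) (loc_mor WC (eta X))
  = comp (c := localization WC) (loc_mor WC (eta Y)) f.
Proof.
rewrite -(zz_reprK f) !loc_functor_class !loc_compE; apply/zz_class_eq.
exact: loc_unit_nat.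
Qed.
End LocEquiv.

Lemma localization_equivalent (C D : category) (WC : morclass C) (WD : morclass D)
    (F : functor C D) (G : functor D C)
    (eta : forall X : C, hom X (G (F X))) (del : forall Y : D, hom Y (F (G Y))) :
  (forall (X Y : C) (f : hom X Y), WC _ _ f -> WD _ _ (fmap F f)) ->
  (forall (X Y : D) (f : hom X Y), WD _ _ f -> WC _ _ (fmap G f)) ->
  (forall X, is_iso (eta X)) -> (forall Y, is_iso (del Y)) ->
  (forall (X Y : C) (f : hom X Y), fmap G (fmap F f) ∘ eta X = eta Y ∘ f) ->
  (forall (X Y : D) (f : hom X Y), fmap F (fmap G f) ∘ del X = del Y ∘ f) ->
  equivalent_cat (localization WC) (localization WD).
Proof.
move=> FW GW ei di en dn.
have [eps heps] : exists eps : forall Y : D, @hom (localization WD) (F (G Y)) Y,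
    forall Y, comp (c := localization WD) (eps Y) (loc_mor WD (del Y)) = idm (Y : localization WD) /\
      comp (c := localization WD) (loc_mor WD (del Y)) (eps Y) = idm (F (G Y) : localization WD).
  have h (Y : D) : exists e : @hom (localization WD) (F (G Y)) Y,
    comp (c := localization WD) e (loc_mor WD (del Y)) = idm (Y : localization WD) /\
      comp (c := localization WD) (loc_mor WD (del Y)) e = idm (F (G Y) : localization WD).
    exact: (loc_mor_iso WD (di Y)).
  by exists (fun Y => projT1 (cid (h Y))) => Y; exact: projT2 (cid (h Y)).
exists (loc_functor FW), (loc_functor GW), (fun X => loc_mor WC (eta X)), eps; split.
- by move=> X; exact: loc_mor_iso.
- by move=> Y; exists (loc_mor WD (del Y)); have [? ?] := heps Y; split.
- by move=> X X' f; exact: (loc_unit FW GW en).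
- move=> Y Y' g; have [h1 h2] := heps Y; have [h1' h2'] := heps Y'.
  transitivity (comp (comp (eps Y') (comp (loc_mor WD (del Y') : @hom (localization WD) _ _) g)) (eps Y)).
    by rewrite compA h1' comp1m.
  by rewrite -(loc_unit GW FW dn) -!compA h2 compm1.
Qed.

(** * Functors on the Jordan category *)
Section JordanFunctors.
Variables (k : comNzRingType) (A : algType k).
Local Notation dual := {poly %/ ('X^2 : {poly k})}.

Definition dual_coef (i : nat) (f : dual) : k := (polyn f)`_i.

Lemma dual_eq (f g : dual) : dual_coef 0 f = dual_coef 0 g -> dual_coef 1 f = dual_coef 1 g -> f = g.
Proof.
rewrite /dual_coef => e0 e1; apply: val_inj; apply/polyP => i /=.
have sz : size (mk_monic ('X^2 : {poly k})) = 3 by rewrite (mk_monic_Xn k 2) size_polyXn.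
have h (p : dual) : (size (polyn p) <= 2)%N.
  by have := size_mk_monic p; rewrite [X in (_ < X)%N]sz.
by case: i => [|[|i]] //; rewrite !nth_default // (leq_trans (h _)).
Qed.

Lemma dual_coef_linear i c (f g : dual) : dual_coef i (c *: f + g) = c * dual_coef i f + dual_coef i g.
Proof. by rewrite /dual_coef /= coefD coefZ. Qed.

Lemma dual_coef1 : (dual_coef 0 1 = 1) * (dual_coef 1 1 = 0).
Proof. by rewrite /dual_coef /= !coefC. Qed.

Lemma dual_coefX : (dual_coef 0 'qX = 0) * (dual_coef 1 'qX = 1).
Proof. by rewrite /dual_coef qpolyXE ?monicXn ?size_polyXn // !coefX. Qed.

Lemma dual_coefM (f g : dual) : (dual_coef 0 (g * f) = dual_coef 0 g * dual_coef 0 f) *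
  (dual_coef 1 (g * f) = dual_coef 0 g * dual_coef 1 f + dual_coef 1 g * dual_coef 0 f).
Proof.
rewrite /dual_coef /=.
set p := (_ * _)%R : {poly k}.
have e i : (i < 2)%N -> (Pdiv.CommonRing.rmodp p (mk_monic 'X^2))`_i = p`_i.
  move=> i2; have hm : 'X^2 \is @monic k := monicXn _ _.
  by rewrite (mk_monic_Xn k 2) [p in RHS](Pdiv.RingMonic.rdivp_eq hm) coefD coefMXn i2 add0r.
by rewrite !e // /p !coefM !big_ord_recl !big_ord0 /= !addr0.
Qed.

(** The element f_0 + f_1 eps acts as f_0 + f_1 d, so a functor is determined by the
    action of eps, and compatibility with eps is all that naturality asks. *)
Lemma lfmapE (F : lfunctor A (Jordan k)) (f : dual) x :
  lfmap F (f : @lhom k (Jordan k) tt tt) x =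
  (dual_coef 0 f)%:A *: (x : F tt) + (dual_coef 1 f)%:A *: lfmap F (jeps k) x.
Proof.
have -> : f = dual_coef 0 f *: 1 + (dual_coef 1 f *: 'qX + 0).
  by apply: dual_eq; rewrite !dual_coef_linear !dual_coef1 !dual_coefX /dual_coef /= coef0 ?mulr0 ?mulr1 ?addr0 ?add0r.
rewrite !(lfmap_linear, dual_coef_linear, dual_coef1, dual_coefX).
have d0 i : dual_coef i 0 = 0 by rewrite /dual_coef coef0.
have F0 : lfmap F (0 : @lhom k (Jordan k) tt tt) x = 0.
  have := lfmap_linear (l := F) (-1) 0 (0 : @lhom k (Jordan k) tt tt) x.
  by rewrite scaler0 addr0 scaleN1r scaleNr scale1r addNr.
have F1 : lfmap F (1 : @lhom k (Jordan k) tt tt) x = x := lfmap1 (l := F) x.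
by rewrite !d0 !mulr0 !mulr1 !addr0 add0r F0 F1 addr0.
Qed.

(** Scalars of k act by central elements of A. *)
Lemma scale_linear (V : lmodType A) (c : k) (f : {linear V -> V}) :
  linear (fun x => c%:A *: f x).
Proof. by move=> a x y; rewrite linearP scalerDr !scalerA mulr_algl mulr_algr. Qed.

Lemma jordan_act_linear (X : difmod A) (f : dual) :
  linear (fun x : X => (dual_coef 0 f)%:A *: x + (dual_coef 1 f)%:A *: dif X x).
Proof.
move=> a x y; rewrite (scale_linear (V := X) _ (lin_id X) a x y) (scale_linear _ (dif X) a x y).
by rewrite /= scalerDr addrACA.
Qed.

Definition jordan_lfun (X : difmod A) : lfunctor A (Jordan k).
Proof.
refine (@LFunctor k A (Jordan k) (fun _ => dmod X)
  (fun _ _ f => mklin (jordan_act_linear (X := X) f)) _ _ _).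
- by move=> q x; rewrite /= !dual_coef1 !scale1r !scale0r addr0.
- move=> q r s g f x /=.
  have AM (a b : k) : (a * b)%:A = a%:A * b%:A :> A by rewrite mulr_algl scalerA.
  rewrite !dual_coefM [dif X (_ + _)]linearD [dif X (_ *: x)]linearZ [dif X (_ *: dif X x)]linearZ /= difK.
  by rewrite scaler0 addr0 AM scalerDl !AM scalerDl !scalerDr !scalerA !addrA.
- move=> q r c f g x /=.
  rewrite !dual_coef_linear !scalerDl !scalerDr !scalerA addrACA.
  by congr (_ + _ + _); rewrite ?mulr_algl ?scalerA.
Defined.

(** Equality of objects, not mere isomorphism: it makes the comparison functor
    onto on objects in the strict sense. *)
Lemma difmod_eq (V : lmodType A) (d d' : {linear V -> V}) h h' : d =1 d' ->
  DifMod (dif := d) h = DifMod (dif := d') h'.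
Proof.
by move=> /linear_ext e; subst d'; rewrite (Prop_irrelevance h h').
Qed.

Lemma dif_of_jordan (X : difmod A) x : dif (dif_of_lfun (jordan_lfun X)) x = dif X x.
Proof. by rewrite /= !dual_coefX !scale1r !scale0r add0r. Qed.

Definition dif_functor : functor (Fun A (Jordan k)) (Dif A).
Proof.
refine (@Functor (Fun A (Jordan k)) (Dif A) (@dif_of_lfun k A)
  (fun F G a => @DifHom A (dif_of_lfun F) (dif_of_lfun G) (a tt) (fun x => lnatC a (jeps k) x)) _ _).
- by move=> F; apply: difhom_ext.
- by move=> F G H b a; apply: difhom_ext.
Defined.

Lemma lnat_of_difhomP (F G : lfunctor A (Jordan k)) (h : difhom (dif_of_lfun F) (dif_of_lfun G))
  (q r : Jordan k) (f : lhom q r) x :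
  (match r return {linear F r -> G r} with tt => dhom h end) (lfmap F f x) =
  lfmap G f ((match q return {linear F q -> G q} with tt => dhom h end) x).
Proof.
case: q r f x => -[] f x.
have e : dhom h (lfmap F (jeps k) x) = lfmap G (jeps k) (dhom h x) := dhomC h x.
by rewrite (lfmapE f x) [RHS](lfmapE f) -e linearD !linearZ.
Qed.

Lemma dif_functor_full (F G : Fun A (Jordan k)) (h : hom (dif_functor F) (dif_functor G)) :
  exists a, fmap dif_functor a = h.
Proof.
exists (LNat (lnat_of_difhomP h)); exact: difhom_ext.
Qed.

Lemma dif_functor_faithful (F G : Fun A (Jordan k)) (a b : hom F G) :
  fmap dif_functor a = fmap dif_functor b -> a = b.
Proof.
move=> e; apply: lnat_ext => -[] x.
exact: (congr1 (fun h : difhom (dif_of_lfun F) (dif_of_lfun G) => dhom h x) e).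
Qed.

Lemma dif_functor_surj (X : Dif A) : exists F, dif_functor F = X.
Proof.
exists (jordan_lfun X); case: X => V d dK; apply: difmod_eq => x.
exact: (@dif_of_jordan (DifMod dK) x).
Qed.

Lemma jordan_natP (X Y : difmod A) (g : difhom X Y) (q r : Jordan k) (f : lhom q r) x :
  dhom g (lfmap (jordan_lfun X) f x) = lfmap (jordan_lfun Y) f (dhom g x).
Proof. by rewrite /= linearD !linearZ /= dhomC. Qed.

Definition jordan_functor : functor (Dif A) (Fun A (Jordan k)).
Proof.
refine (@Functor (Dif A) (Fun A (Jordan k)) jordan_lfun
  (fun X Y g => @LNat k A (Jordan k) (jordan_lfun X) (jordan_lfun Y) (fun=> dhom g) (jordan_natP g)) _ _).
- by move=> X; apply: lnat_ext.
- by move=> X Y Z g f; apply: lnat_ext.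
Defined.

Lemma dif_unitP (X : difmod A) x :
  lin_id X (dif X x) = dif (dif_of_lfun (jordan_lfun X)) (lin_id X x).
Proof. by rewrite dif_of_jordan. Qed.

(** The identity map, between two differentials that agree pointwise but are not
    the same term. *)
Definition dif_unit (X : Dif A) : hom X (dif_functor (jordan_functor X)) :=
  @DifHom A X (dif_of_lfun (jordan_lfun X)) (lin_id X) (@dif_unitP X).

Lemma dif_unit_iso X : is_iso (dif_unit X).
Proof.
have h x : lin_id X (dif (dif_of_lfun (jordan_lfun X)) x) = dif X (lin_id X x).
  exact: dif_of_jordan.
exists (@DifHom A (dif_of_lfun (jordan_lfun X)) X (lin_id X) h).
by split; apply: difhom_ext.
Qed.

Lemma jordan_unit_iso (F : Fun A (Jordan k)) :
  exists e : hom F (jordan_functor (dif_functor F)), is_iso e /\ forall x, lnatf e tt x = x.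
Proof.
have [a ea] := dif_functor_full (dif_unit (dif_functor F)).
have [g [g1 g2]] := dif_unit_iso (dif_functor F); have [b eb] := dif_functor_full g.
exists a; split; last first.
  move=> x; exact: (congr1 (fun h : difhom (dif_of_lfun F) (dif_of_lfun (jordan_lfun (dif_of_lfun F))) => dhom h x) ea).
exists b; split; apply: dif_functor_faithful; rewrite fmapM ea eb fmap1.
  exact: g1.
exact: g2.
Qed.

End JordanFunctors.

Theorem theorem2 (k : comNzRingType) (k_noeth : noetherian k)
    (k_hered : hereditary_ring k) (A : algType k) (cX cY : obclass (Mod A))
    (cot : cotorsion_pair cX cY) (cpl : complete_pair cX cY)
    (her : hereditary_pair cX cY) :
  [/\ cotorsion_pair (tildeX cX) (dgY cX),
      complete_pair (tildeX cX) (dgY cX)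
    & hereditary_pair (tildeX cX) (dgY cX)] /\
  [/\ cotorsion_pair (dgX cY) (tildeY cY),
      complete_pair (dgX cY) (tildeY cY)
    & hereditary_pair (dgX cY) (tildeY cY)] /\
  compatible_pairs (dgX cY) (tildeY cY) (tildeX cX) (dgY cX) /\
  exists M : model_structure (Dif A),
    [/\ abelian_model M,
        forall X : Dif A, cofibrant M X <-> dgX cY X,
        forall X : Dif A, fibrant M X <-> dgY cX X
      & forall X : Dif A, trivial_ob M X <-> exact_dif X] /\
    (exists N : model_structure (Fun A (Jordan k)), Qshaped_model N) /\
    (forall N : model_structure (Fun A (Jordan k)),
       Qshaped_model N -> equivalent_cat (Ho M) (Ho N)).
Proof.
have full := @dif_functor_full k A; have faith := @dif_functor_faithful k A.
have surj := @dif_functor_surj k A.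
split; first exact: (tildeX_dgY_pair cot cpl her).
split; first exact: (dgX_tildeY_pair cot cpl her).
split; first exact: (induced_compatible cot cpl her).
have [M hM] := induced_model cot cpl her; exists M; split=> //; split.
  have [P [h1 h2 h3 h4]] := projective_model A.
  exists (pull_model full faith surj P); split.
  - exact: pull_abelian.
  - move=> F; rewrite pull_cofibrant h2; split=> h G eG.
      by apply/(transport_Ext full faith surj)/h.
    by have [G' eG'] := surj G; subst G; apply/(transport_Ext full faith surj)/h.
  - by move=> F; rewrite pull_trivial h4.
  - by move=> F; rewrite pull_fibrant.
move=> N [ab _ trN _]; have [abM _ _ trM] := hM.
have wM (X Y : Dif A) (f : hom X Y) : weq M f <-> qis f.
  apply: (abelian_weq abM trM (@qis_23 A)) => X' Y' K i p.
    by move=> mi /(mono_coker_ses (DifA A) mi)/qis_mono.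
  by move=> ep /(epi_ker_ses (DifA A) ep)/qis_epi.
have wN (F G : Fun A (Jordan k)) (f : hom F G) : weq N f <-> qis (fmap (dif_functor A) f).
  apply: (abelian_weq (W := fun F G f => qis (fmap (dif_functor A) f)) ab trN).
  - by move=> X Y Z f' g'; exact: (@qis_23 A _ _ _ (fmap (dif_functor A) f') (fmap (dif_functor A) g')).
  - move=> X' Y' K i p /(transport_mono full faith surj) mi /(transport_cokernel full faith surj) hp.
    exact: (qis_mono (mono_coker_ses (DifA A) mi hp)).
  - move=> X' Y' K i p /(transport_epi full faith surj) mi /(transport_kernel full faith surj) hp.
    exact: (qis_epi (epi_ker_ses (DifA A) mi hp)).
have [eta eta_iso eta_id] : exists2 eta : forall F : Fun A (Jordan k),
    hom F (jordan_functor A (dif_functor A F)), forall F, is_iso (eta F) & forall F x, lnatf (eta F) tt x = x.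
  have [eta h] := dep_choice (@jordan_unit_iso k A).
  by exists eta => F; [exact: (h F).1 | exact: (h F).2].
apply: (@localization_equivalent (Dif A) (Fun A (Jordan k)) _ _ (jordan_functor A) (dif_functor A)
  (@dif_unit k A) eta).
- move=> X Y f /wM w; apply/wN.
  have u Z : qis (@dif_unit k A Z) by apply/wM/iso_weq/dif_unit_iso.
  have e : comp (fmap (dif_functor A) (fmap (jordan_functor A) f)) (@dif_unit k A X) =
      comp (@dif_unit k A Y) f by apply: difhom_ext.
  have [h1 _ _] := @qis_23 A _ _ _ f (@dif_unit k A Y).
  have [_ h2 _] := @qis_23 A _ _ _ (@dif_unit k A X) (fmap (dif_functor A) (fmap (jordan_functor A) f)).
  by apply: h2; rewrite ?e //; apply: h1.
- by move=> F G f /wN w; apply/wM.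
- exact: dif_unit_iso.
- exact: eta_iso.
- by move=> X Y f; apply: difhom_ext.
- move=> F G f; apply: lnat_ext => -[] x.
  have e1 : lnatf (eta G) tt (lnatf f tt x) = lnatf f tt x := eta_id G _.
  have e2 : lnatf (eta F) tt x = x := eta_id F x.
  by rewrite /= e1 e2.
Qed.
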